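(* Let $\mathcal{X}_n=\{X_1,\dots,X_n\}$ be a set of $n$ i.i.d. random samples in $\mathbb{R}^d$ from the density $f_{\mathrm e}(x)=c_{\mathrm e}e^{-\|x\|}$. For radii $R_n$ let $\beta_{k,n}=\beta_k\big(\check{C}(\mathcal{X}_n\cap (B_{R_n}(0))^c,1)\big)$. Define $$R_{0,n}^{\epsilon}=\log n+(d-1+\epsilon)\log\log n,\qquad R_{0,n}=R_{0,n}^{0},$$ $$R_{k,n}^{\epsilon}=\log n+\Big(\frac{d-1}{k+2}+\epsilon\Big)\log\log n\quad (k\ge1),\qquad R_{k,n}=R_{k,n}^{0},$$ and let $R_{k,n}^{-\epsilon}$ denote the same expressions with $\epsilon$ replaced by $-\epsilon$. Then for $k\ge0$ and $\epsilon>0$, $$\lim_{n\to\infty}\mathbb{E}\{\beta_{k,n}\}=\begin{cases}0 & R_n=R_{k,n}^{\epsilon},\\ \mu_{\mathrm e,k}& R_n=R_{k,n},\\ \infty& R_n=R_{k,n}^{-\epsilon},\end{cases}$$ where $\mu_{\mathrm e,0}=s_{d-1}c_{\mathrm e}$ and, for $k\ge 1$, $$\mu_{\mathrm e,k}=\frac{s_{d-1}c_{\mathrm e}^{k+2}}{(k+2)!}\int_0^\infty\int_{(\mathbb{R}^d)^{k+1}}T_k(0,\mathbf{y})\,e^{-\left((k+2)\rho+\sum_{i=1}^{k+1}y_i^1\right)}\prod_{i=1}^{k+1}\mathbf{1}\{y_i^1>-\rho\}\,d\mathbf{y}\,d\rho,$$ with $y_i^1$ the first coordinate of $y_i\in\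mathbb{R}^d$.
   Context: $\|\cdot\|$ is the Euclidean norm; $B_r(x)$ is the Euclidean ball of radius $r$ about $x$ in $\mathbb{R}^d$, and $(B_r(x))^c$ is its complement; $c_{\mathrm e}$ is the normalization constant making $f_{\mathrm e}$ a probability density; $s_{d-1}$ is the surface area of the $(d-1)$-dimensional unit sphere in $\mathbb{R}^d$. For a finite set $\mathcal{Y}\subset\mathbb{R}^d$ and $\varepsilon>0$, the Čech complex $\check{C}(\mathcal{Y},\varepsilon)$ is the abstract simplicial complex whose $0$-simplices are the points of $\mathcal{Y}$ and in which $[x_{i_0},\dots,x_{i_m}]$ is an $m$-simplex if $\bigcap_{j=0}^m B_\varepsilon(x_{i_j})\neq\emptyset$. $\beta_k$ denotes the $k$-th Betti number. For $k\ge1$ and $\mathcal{Y}\subset\mathbb{R}^d$, $T_k(\mathcal{Y})=1$ if $|\mathcal{Y}|=k+2$ and $\beta_k(\check{C}(\mathcal{Y},1))=1$, and $T_k(\mathcal{Y})=0$ otherwise; for $\mathbf{y}=(y_1,\dots,y_{k+1})\in(\mathbb{R}^d)^{k+1}$, $T_k(0,\mathbf{y})=T_k(\{0,y_1,\dots,y_{k+1}\})$. $\mathbf{1}\{\cdot\}$ is the indicator function.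
   Formalization: The formal theorem assumes d ≥ 2, and for the limit ∞ (R_n = R_{k,n}^{-ε}) also k < d: for d = 1 the three-case claim fails for every k, and for k ≥ d the Betti number is always 0, so the limit cannot be ∞. *)

(* Defs.v *)
From HB Require Import structures.
From mathcomp Require Import all_boot all_order all_algebra finmap.

Set Implicit Arguments.
Unset Strict Implicit.
Unset Printing Implicit Defensive.

Import Order.TTheory GRing.Theory Num.Theory.

Local Open Scope ring_scope.

(* Simplicial homology, with coefficients in a field, of a family [K] of
   finite sets of vertices; the empty set is never a simplex (homology is not
   reduced).  Vertices are ordered by [enum_rank]; [faces K m] is the set of
   simplices with m vertices, that is of dimension m - 1. *)
Section homology.
Context (F : fieldType) {V : finType}.
Implicit Types (K : {set {set V}}) (s t : {set V}).

Definition faces K (m : nat) : {set {set V}} :=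
  [set s in K | (s != set0) && (#|s| == m)].

(* coefficient of t in the boundary of s:
   d[v_0, ..., v_p] = \sum_j (-1)^j [v_0, ..., v_{j-1}, v_{j+1}, ..., v_p] *)
Definition incidence s t : F :=
  \sum_(v in s | (s :\ v)%SET == t)
    (-1) ^+ #|[set w in s | (enum_rank w < enum_rank v)%N]|.

(* acts on row vectors, from the m-chains to the (m - 1)-chains *)
Definition boundary K (m : nat) : 'M[F]_(#|faces K m.+1|, #|faces K m|) :=
  \matrix_(i, j) incidence (enum_val i) (enum_val j).

Definition betti K (k : nat) : nat :=
  (\rank (kermx (boundary K k)) - \rank (boundary K k.+1))%N.

End homology.

From mathcomp Require Import all_classical all_reals all_analysis.

Import numFieldNormedType.Exports.

Local Open Scope classical_set_scope.
Local Open Scope ring_scope.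

(* Finite powers of a sigma-finite measure.  The sigma-algebra of
   [n.-tuple T] is generated by the coordinates, i.e. it is the product one. *)
Section power_measure.
Context {disp : measure_display} {T : measurableType disp} {R : realType}.

Definition tuple_cons (n : nat) (p : T * n.-tuple T) : n.+1.-tuple T :=
  [tuple of p.1 :: p.2].

Lemma measurable_tuple_cons (n : nat) :
  measurable_fun [set: T * n.-tuple T] (@tuple_cons n).
Proof. exact: measurable_cons. Qed.

Section cons_measure.
Variables (mu : {sigma_finite_measure set T -> \bar R}) (n : nat)
  (nu : {sigma_finite_measure set (n.-tuple T) -> \bar R}).

Definition cons_measure : set (n.+1.-tuple T) -> \bar R :=
  pushforward (mu \x nu)%E (@tuple_cons n).

Let cons_measure0 : cons_measure set0 = 0%E.
Proof. by rewrite /cons_measure /pushforward preimage_set0 measure0. Qed.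

Let cons_measure_ge0 A : (0 <= cons_measure A)%E.
Proof. by rewrite /cons_measure /pushforward measure_ge0. Qed.

Let cons_measure_sigma_additive : semi_sigma_additive cons_measure.
Proof.
move=> G mG tG mUG; rewrite /cons_measure /pushforward preimage_bigcup.
have mpre A : measurable A -> measurable (@tuple_cons n @^-1` A).
  by move=> mA; rewrite -[X in measurable X]setTI; exact: measurable_tuple_cons.
apply: measure_semi_sigma_additive.
- by move=> i; exact: mpre.
- apply/trivIsetP => /= i j _ _ ij; rewrite -preimage_setI.
  by move/trivIsetP : tG => /(_ _ _ _ _ ij) ->//; rewrite preimage_set0.
- by rewrite -preimage_bigcup; exact: mpre.
Qed.

HB.instance Definition _ := isMeasure.Build _ _ _ cons_measure
  cons_measure0 cons_measure_ge0 cons_measure_sigma_additive.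

Lemma cons_measure_sigma_finite : sigma_finite setT cons_measure.
Proof.
have [F FT Foo] : sigma_finite setT (mu \x nu)%E.
  have /sigma_finiteP[G [TG ndG Goo]] := sigma_finiteT mu.
  have /sigma_finiteP[H [TH ndH Hoo]] := sigma_finiteT nu.
  exists (fun i => G i `*` H i).
    rewrite -setXTT TG TH predeqE => -[x y]; split.
      move=> [/= [i _ Gix] [j _ Hjy]]; exists (maxn i j) => //; split.
      - by move: x Gix; exact/subsetPset/ndG/leq_maxl.
      - by move: y Hjy; exact/subsetPset/ndH/leq_maxr.
    by move=> [i _ []/= ? ?]; split; exists i.
  move=> i; have [? ?] := Goo i; have [? ?] := Hoo i.
  split; first exact: measurableX.
  by rewrite product_measure1E// lte_mul_pinfty// ge0_fin_numE.
pose u (t : n.+1.-tuple T) : T * n.-tuple T := (thead t, [tuple of behead t]).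
have mu_ : measurable_fun setT u.
  by apply: measurable_fun_pair;
    [exact: measurable_tnth|exact: measurable_behead].
have uK p : u (tuple_cons p) = p.
  by case: p => x t; rewrite /u theadE; congr pair; exact: val_inj.
exists (fun i => u @^-1` F i).
  rewrite -preimage_bigcup.
  by rewrite -FT preimage_setT.
move=> i; have [mF Fi] := Foo i; split.
  by rewrite -[X in measurable X]setTI; exact: mu_.
rewrite /cons_measure /pushforward -comp_preimage.
by rewrite (_ : u \o _ = id) ?preimage_id//; apply/funext => p /=; exact: uK.
Qed.

HB.instance Definition _ :=
  Measure_isSigmaFinite.Build _ _ _ cons_measure cons_measure_sigma_finite.

End cons_measure.

Fixpoint power_measure (mu : {sigma_finite_measure set T -> \bar R}) (n : nat)
    : {sigma_finite_measure set (n.-tuple T) -> \bar R} :=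
  if n is m.+1 return {sigma_finite_measure set (n.-tuple T) -> \bar R}
  then cons_measure mu (power_measure mu m)
  else \d_([tuple] : 0.-tuple T).

End power_measure.

(* R^d, with its product (= Borel) sigma-algebra and Lebesgue measure.  The
   norm has to be defined: the library norm on row vectors is the sup norm. *)
Notation euclidean R d := (d.-tuple (measurableTypeR R)).

Section euclidean_space.
Context {R : realType} {d : nat}.
Implicit Types x y : euclidean R d.

Definition lebesgue_euclidean
    : {sigma_finite_measure set (euclidean R d) -> \bar R} :=
  power_measure (@lebesgue_measure R) d.

Definition origin : euclidean R d := [tuple (0 : R) | i < d].

Definition euclidean_dist x y : R :=
  Num.sqrt (\sum_(i < d) ((tnth x i : R) - tnth y i) ^+ 2).

Definition euclidean_norm x : R := euclidean_dist x origin.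

Definition euclidean_ball x (r : R) : set (euclidean R d) :=
  [set y | euclidean_dist y x < r].

(* only meaningful for [0 < d] *)
Definition first_coord x : R := nth (0 : R) x 0.

End euclidean_space.

Section cech.
Context (F : fieldType) {R : realType} {d : nat}.
Implicit Types Y : {fset euclidean R d}.

Definition cech Y (r : R) : {set {set Y}} :=
  finset.finset (fun s : {set Y} => (s != finset.set0) &&
     `[< \bigcap_(v in [set` s]) euclidean_ball (val v) r !=set0 >]).

Definition T_ (k : nat) Y : nat :=
  ((#|` Y| == k.+2) && (betti F (cech Y 1) k == 1))%N.

End cech.

Section exponential_density.
Context {R : realType}.

Definition c_e (d : nat) : R :=
  (fine (\int[lebesgue_euclidean]_(x in [set: euclidean R d])
           (expR (- euclidean_norm x))%:E)%E)^-1.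

Definition f_e {d : nat} (x : euclidean R d) : R :=
  c_e d * expR (- euclidean_norm x).

(* area of the unit sphere of R^d; the area of a part A of the sphere is
   d times the volume of the cone {t *: x | x in A, 0 < t < 1} *)
Definition sphere_area (d : nat) : R :=
  d%:R * fine (lebesgue_euclidean (euclidean_ball (@origin R d) 1)).

End exponential_density.

Section samples.
Context {disp : measure_display} {Omega : measurableType disp} {R : realType}
  {d : nat} (P : probability Omega R).
Variable X : nat -> {RV P >-> euclidean R d}.

Definition mutually_independent : Prop :=
  forall (J : {fset nat}) (A : nat -> set (euclidean R d)),
    (forall i, measurable (A i)) ->
    P (\bigcap_(i in [set` J]) X i @^-1` A i) =
      (\prod_(i <- J) P (X i @^-1` A i))%E.

Definition has_density (Y : {RV P >-> euclidean R d})
    (f : euclidean R d -> R) : Prop :=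
  forall A, measurable A ->
    distribution P Y A = (\int[lebesgue_euclidean]_(x in A) (f x)%:E)%E.

(* the n samples are X 0, ..., X (n - 1) *)
Definition samples (n : nat) (w : Omega) : {fset euclidean R d} :=
  [fset X (val i) w | i in 'I_n]%fset.

Definition outer_samples (n : nat) (r : R) (w : Omega)
    : {fset euclidean R d} :=
  [fset x in samples n w | x \in ~` euclidean_ball origin r]%fset.

Definition betti_outer (F : fieldType) (k n : nat) (r : R) (w : Omega) : nat :=
  betti F (cech (outer_samples n r w) 1) k.

End samples.

Section limits.
Context {R : realType}.

Definition cutoff_radius (d k : nat) (eps : R) (n : nat) : R :=
  ln n%:R +
  ((if k is 0 then d.-1%:R else d.-1%:R / k.+2%:R) + eps) * ln (ln n%:R).

Definition mu_e (F : fieldType) (d k : nat) : \bar R :=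
  if k is 0 then (sphere_area d * c_e d)%:E
  else ((sphere_area d * c_e d ^+ k.+2 / (k.+2)`!%:R)%:E *
    \int[lebesgue_measure]_(rho in `[0%R, +oo[)
      \int[power_measure lebesgue_euclidean k.+1]_(y in
          [set: k.+1.-tuple (euclidean R d)])
        ((T_ F k [fset x in (origin : euclidean R d) :: y]%fset)%:R *
         expR (- (k.+2%:R * rho + \sum_(i < k.+1) first_coord (tnth y i))) *
         \prod_(i < k.+1)
           (- rho < first_coord (tnth y i))%R%:R)%:E)%E.

End limits.

(* Main.v *)
From HB Require Import structures.
Require Import Defs.
From mathcomp Require Import all_boot all_order all_algebra finmap.
From mathcomp Require Import ring lra.

(** Let [m] be the least number of vertices that carry a [k]-cycle: [m = 1] if
    [k = 0], and [m = k + 2] if [k >= 1], when they form a hollow simplex, [m]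
    points whose unit balls have no common point although any [m - 1] of these
    balls have one. Far from the origin the samples are so sparse that the Betti
    number is, up to a negligible error, the number of these configurations
    among the outer samples, whose expectation is an integral.

    - Combinatorics. In a complex whose simplices consist of pairwise adjacent
      vertices, each detached hollow simplex carries a homology class of its
      own, and a cycle is determined up to boundaries by its values on one facet
      of each hollow simplex and on the faces that are connected to at least two
      further vertices ([le_betti], [ge_betti]). So the difference between the
      Betti number and the number of hollow simplices is at most the number of
      [(m + 1)]-tuples of samples near each other ([betti_le_cell_sets],
      [cell_sets_le_betti]).

    - Integrals. By independence ([joint_law]), the expected number of sets of
      [m] samples beyond the radius [r] in a given kind of configuration is
      a binomial coefficient times [c_e ^+ m * tail_integral _ r]. Let the
      configurations be bounded and invariant under isometries. The first point
      is translated to the origin, moved to the first axis by a rotation, and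
      integrated in polar coordinates: [tail_scaled] is
      [sphere_area * r ^+ (d - 1) * expR (- m * r)] times an integral. This
      integral converges by domination as [r] grows
      ([cvg_integral_scaled_fun]), because the norm of [y + t e_1] minus [t]
      tends to the first coordinate of [y].

    - Asymptotics. If [r = ln N + a * ln (ln N) + b], then
      [N ^+ m * r ^+ (d - 1) * expR (- m * r)] is equivalent to
      [expR (- m * b)] times the power of [ln N] of exponent [d - 1 - m * a]
      ([tail_asymptotics]). This tends to 0, to a constant or to infinity
      according to the position of [a] with respect to [(d - 1) / m]. For the
      near [(m + 1)]-tuples the exponent is smaller by [a], which makes them
      negligible at or above the critical exponent, and relatively so below it
      ([expected_betti_cvg0], [expected_betti_cvg], [expected_betti_cvgy]).

    - Positivity. The divergence needs the limit constant to be positive. If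
      [k < d], then a simplex with [k + 2] vertices inscribed in the unit
      sphere, with the origin inside, is hollow once it is slightly dilated, and
      remains so when its vertices are moved a little
      ([hollow_points_perturb], [limit_integral_gt0]). *)

Set Implicit Arguments.
Unset Strict Implicit.
Unset Printing Implicit Defensive.

Import Order.TTheory GRing.Theory Num.Theory.

Local Open Scope ring_scope.

(** * Betti numbers and minimal cycles *)

Section boundary.
Context (F : fieldType) {V : finType}.
Implicit Types (K C : {set {set V}}) (s t r : {set V}) (u v w : V).

Definition vertex_sign s v : F :=
  (-1) ^+ #|[set w in s | (enum_rank w < enum_rank v)%N]|.

Lemma vertex_sign_neq0 s v : vertex_sign s v != 0.
Proof. by rewrite /vertex_sign signr_eq0. Qed.

Lemma incidence_facet s v : v \in s -> incidence F s (s :\ v) = vertex_sign s v.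
Proof.
move=> vs; rewrite /incidence (bigD1 v) ?vs ?eqxx//= big1 ?addr0// => w.
move=> /andP[/andP[ws /eqP sw] wv]; exfalso.
by have := in_setD1 v s w; rewrite sw !inE eqxx /= vs eq_sym (negbTE wv).
Qed.

Lemma incidence_neq0 s t :
  incidence F s t != 0 -> exists2 v, v \in s & t = s :\ v.
Proof.
have [/existsP[v /andP[vs /eqP <-]] _|] :=
  boolP [exists v, (v \in s) && (s :\ v == t)]; first by exists v.
move=> /existsPn h; rewrite /incidence big1 ?eqxx// => v vst.
by have := h v; rewrite vst.
Qed.

Lemma incidence_eq0 s t : ~~ (t \subset s) -> incidence F s t = 0.
Proof.
apply: contraNeq => /incidence_neq0[v _ ->]; exact: subsetDl.
Qed.

(** Deleting the smaller of [v] and [w] shifts the rank of the other one by 1,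
    and deleting the larger one does not. *)
Lemma vertex_signD s v w : v \in s -> w \in s -> v != w ->
  vertex_sign s v * vertex_sign (s :\ v) w =
  - (vertex_sign s w * vertex_sign (s :\ w) v).
Proof.
wlog vw : v w / (enum_rank v < enum_rank w)%N.
  move=> wl vs ws vw; have [lt|] := ltnP (enum_rank v) (enum_rank w).
    exact: wl.
  rewrite leq_eqVlt => /orP[/eqP/val_inj/enum_rank_inj wv|lt].
    by rewrite wv eqxx in vw.
  by rewrite [in RHS]wl ?opprK// eq_sym.
move=> vs ws neq; rewrite /vertex_sign.
have -> : [set x in s :\ w | (enum_rank x < enum_rank v)%N] =
          [set x in s | (enum_rank x < enum_rank v)%N].
  apply/setP => x; rewrite !inE.
  have [->|//] := eqVneq x w.
  by rewrite /= (ltnNge (enum_rank w)) (ltnW vw) andbF.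
have -> : #|[set x in s | (enum_rank x < enum_rank w)%N]| =
          #|[set x in s :\ v | (enum_rank x < enum_rank w)%N]|.+1.
  rewrite (cardsD1 v) !inE vs vw /= add1n; congr (_.+1); apply: eq_card => x.
  by rewrite !inE andbA.
by rewrite exprS mulN1r mulNr opprK mulrC.
Qed.

Lemma setD1C s v w : s :\ v :\ w = s :\ w :\ v.
Proof. by apply/setP => x; rewrite !inE andbCA. Qed.

(** The terms cancel in pairs, as [r] is reached by deleting two vertices in
    either order. The sum is over all sets [t], so that it applies to an [s]
    that is not a simplex itself. *)
Lemma boundary_boundary s r :
  \sum_(t : {set V}) incidence F s t * incidence F t r = 0.
Proof.
have -> : \sum_(t : {set V}) incidence F s t * incidence F t r =
   \sum_(v in s) \sum_(w in s | (w != v) && (s :\ v :\ w == r))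
      vertex_sign s v * vertex_sign (s :\ v) w.
  rewrite /incidence; under eq_bigr do rewrite mulr_suml.
  rewrite (exchange_big_dep (mem s)) /=; last by move=> t v _ /andP[].
  apply: eq_bigr => v vs; rewrite (big_pred1 (s :\ v)) => [|t /=]; last first.
    by rewrite vs eq_sym.
  rewrite mulr_sumr; apply: eq_big => // w.
  by rewrite !inE [_ && (w \in s)]andbC -andbA.
rewrite (eq_bigr (fun v =>
  \sum_(w in s | (w != v) && (s :\ v :\ w == r) && (enum_rank v < enum_rank w)%N)
      vertex_sign s v * vertex_sign (s :\ v) w +
  \sum_(w in s | (w != v) && (s :\ v :\ w == r) && (enum_rank w < enum_rank v)%N)
      vertex_sign s v * vertex_sign (s :\ v) w)); last first.
  move=> v vs; rewrite (bigID (fun w : V => (enum_rank v < enum_rank w)%N)) /=.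
  congr (_ + _); apply: eq_bigl => w; rewrite -!andbA; congr (_ && _) => //.
  have [//|wv] := eqVneq w v; congr (_ && _) => /=.
  rewrite -leqNgt leq_eqVlt.
  by rewrite (inj_eq val_inj) (inj_eq enum_rank_inj) (negbTE wv).
rewrite big_split /= [X in _ + X](exchange_big_dep (mem s)) /=; last first.
  by move=> v w _ /andP[].
rewrite -big_split /= big1// => v vs.
rewrite [X in _ + X](eq_bigl (fun w => (w \in s) && ((w != v) && (s :\ v :\ w == r)
     && (enum_rank v < enum_rank w)%N))); last first.
  move=> w /=; rewrite vs /= eq_sym.
  have [ws|] := boolP (w \in s); rewrite ?andbF //=.
  have [->|wv] := eqVneq w v; rewrite ?andbF //=.
  by rewrite setD1C.
rewrite -big_split big1//= => w /andP[ws /andP[/andP[wv _] _]].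
by rewrite [X in X + _]vertex_signD ?addNr// eq_sym.
Qed.

Lemma facesP K m s :
  reflect [/\ s \in K, s != finset.set0 & #|s| = m] (s \in faces K m).
Proof. by rewrite inE; apply: (iffP and3P) => -[? ? /eqP]. Qed.

End boundary.

Section chains.
Context (F : fieldType) {V : finType}.
Variables (C : {set {set V}}).
Implicit Types (s t r : {set V}).

(** Extended by 0 to all sets of vertices, so that sums over the cofaces of a
    set need not mention [C]. *)
Definition coeff (z : 'rV[F]_#|C|) t : F :=
  \sum_(i < #|C|) z 0 i * (enum_val i == t)%:R.

Lemma coeff_enum_val z i : coeff z (enum_val i) = z 0 i.
Proof.
rewrite /coeff (bigD1 i)//= eqxx mulr1 big1 ?addr0// => j ji.
by rewrite (inj_eq enum_val_inj) (negbTE ji) mulr0.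
Qed.

Lemma coeff_out z t : t \notin C -> coeff z t = 0.
Proof.
move=> tC; rewrite /coeff big1// => i _; have [it|] := eqVneq; last by rewrite mulr0.
by rewrite -it enum_valP in tC.
Qed.

Lemma sum_enum_val (P : {set V} -> F) :
  \sum_(i < #|C|) P (enum_val i) = \sum_(t in C) P t.
Proof. by rewrite -big_enum_val. Qed.

(** A matrix, so that the restriction of a space of chains has a rank. *)
Definition restrict_mx p (g : 'I_p -> {set V}) : 'M[F]_(#|C|, p) :=
  \matrix_(i, j) (enum_val i == g j)%:R.

Lemma mul_restrict_mx p (g : 'I_p -> {set V}) z j :
  (z *m restrict_mx g) 0 j = coeff z (g j).
Proof. by rewrite !mxE; apply: eq_bigr => i _; rewrite mxE. Qed.

End chains.

Section betti_bounds.
Context (F : fieldType) {V : finType}.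
Variables (K : {set {set V}}).
Implicit Types (s t r S : {set V}) (u v w : V).

Lemma mul_boundary k (z : 'rV[F]_#|faces K k.+1|) j :
  (z *m boundary F K k) 0 j =
  \sum_(t : {set V}) coeff z t * incidence F t (enum_val j).
Proof.
rewrite mxE (bigID (mem (faces K k.+1))) /= [X in _ = _ + X]big1 ?addr0; last first.
  by move=> t tK; rewrite coeff_out ?mul0r.
rewrite -(sum_enum_val (faces K k.+1) (fun t => coeff z t * incidence F t (enum_val j))).
by apply: eq_bigr => i _; rewrite coeff_enum_val mxE.
Qed.

(** Restriction to the faces [g] is injective on homology. *)
Lemma betti_le k p (g : 'I_p -> {set V}) :
  (forall z : 'rV_#|faces K k.+1|, z *m boundary F K k = 0 ->
     (forall j, coeff z (g j) = 0) -> (z <= boundary F K k.+1)%MS) ->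
  (betti F K k <= p)%N.
Proof.
move=> h; rewrite /betti leq_subLR.
rewrite -(mxrank_mul_ker (kermx (boundary F K k)) (restrict_mx F (faces K k.+1) g)).
rewrite addnC leq_add ?rank_leq_col// mxrankS//; apply/rV_subP => z.
rewrite sub_capmx => /andP[/sub_kermxP zZ /sub_kermxP zg]; apply: h => // j.
by rewrite -mul_restrict_mx zg mxE.
Qed.

(** Boundaries vanish on the faces [g], so restriction to these faces factors
    through homology; there it maps [zs] to [p] independent vectors. *)
Lemma betti_ge k p (g : 'I_p -> {set V}) (zs : 'M_(p, #|faces K k.+1|)) :
  zs *m boundary F K k = 0 -> boundary F K k.+1 *m boundary F K k = 0 ->
  boundary F K k.+1 *m restrict_mx F (faces K k.+1) g = 0 ->
  \rank (zs *m restrict_mx F (faces K k.+1) g) = p ->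
  (p <= betti F K k)%N.
Proof.
move=> zZ bZ bg zg; rewrite /betti leq_subRL; last first.
  by apply: mxrankS; apply/sub_kermxP.
rewrite -(mxrank_mul_ker (kermx (boundary F K k)) (restrict_mx F (faces K k.+1) g)).
rewrite addnC leq_add//.
  by rewrite -[leqLHS]zg mxrankS// submxMr//; apply/sub_kermxP.
by rewrite mxrankS// sub_capmx; apply/andP; split; apply/sub_kermxP.
Qed.

Hypothesis Kdown : forall s t, s \in K -> t \subset s -> t != finset.set0 -> t \in K.

(** [s] may be a hollow simplex: its boundary is then a cycle that need not be
    the boundary of a chain of [K]. *)
Lemma boundary_boundary_faces k s r : #|s| = k.+2 ->
  (forall v, v \in s -> s :\ v \in K) ->
  \sum_(t in faces K k.+1) incidence F s t * incidence F t r = 0.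
Proof.
move=> sc sK; rewrite -[RHS](boundary_boundary F s r).
rewrite [RHS](bigID (mem (faces K k.+1))) /= [X in _ = _ + X]big1 ?addr0// => t tK.
have [->|/incidence_neq0[v vs ti]] := eqVneq (incidence F s t) 0; first by rewrite mul0r.
case/negP: tK; apply/facesP.
have tc : #|t| = k.+1.
  by move: sc; rewrite (cardsD1 v) vs ti add1n => -[].
by split=> //; [rewrite ti sK | rewrite -card_gt0 tc].
Qed.

Lemma boundaryM k : boundary F K k.+1 *m boundary F K k = 0.
Proof.
apply/matrixP => i j; rewrite mxE [RHS]mxE.
under eq_bigr do rewrite !mxE.
rewrite (sum_enum_val (faces K k.+1)
  (fun t => incidence F (enum_val i) t * incidence F t (enum_val j))).
have /facesP[iK i0 ic] := enum_valP i.
apply: boundary_boundary_faces => // v vi; apply: (Kdown iK); first exact: subD1set.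
by move: ic; rewrite (cardsD1 v) vi add1n => -[ic]; rewrite -card_gt0 ic.
Qed.

Variable e : rel V.
Hypothesis Ke : forall s u v, s \in K -> u \in s -> v \in s -> u != v -> e u v.

Definition adjacent s w := [exists a in s, e a w].

(** The sets of [k + 2] vertices on which [K] is a hollow simplex. *)
Definition hollow k : {set {set V}} :=
  [set S : {set V} | [&& #|S| == k.+2, S \notin K & [forall v in S, S :\ v \in K]]].

(** The [k]-faces that extend to [k + 3] vertices of the same component. *)
Definition crowded k : {set {set V}} :=
  [set t in faces K k.+1 | [exists u, [&& u \notin t, adjacent t u &
     [exists w, (w \notin u |: t) && adjacent (u |: t) w]]]].

Lemma hollowP k S : reflect
  [/\ #|S| = k.+2, S \notin K & forall v, v \in S -> S :\ v \in K] (S \in hollow k).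
Proof.
rewrite inE; apply: (iffP and3P) => -[Sc SK Sf]; split=> //; first exact/eqP.
- by move=> v vS; move/forallP/(_ v): Sf; rewrite vS.
- exact/eqP.
- by apply/forallP => v; apply/implyP; exact: Sf.
Qed.

Definition detached s := [forall w, (w \notin s) ==> ~~ adjacent s w].

Lemma detachedP s a w : detached s -> a \in s -> w \notin s -> e a w = false.
Proof.
move=> /forallP /(_ w) /implyP h aS /h; apply: contraNF => eaw.
by apply/existsP; exists a; rewrite aS.
Qed.

(** The vertices of a simplex are pairwise related by [e], so that a simplex
    cannot leave a detached set. *)
Lemma detached_supset s t x : detached s -> t \in K -> (exists2 a, a \in s & a \in t) ->
  x \in t -> x \in s.
Proof.
move=> si tK [a aS aT] xT; apply/negPn/negP => xS.
have := detachedP si aS xS; rewrite (Ke tK)//.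
by apply: contraNneq xS => <-.
Qed.

Lemma coface_detached S s t : detached S -> s \in K -> t != finset.set0 -> t \subset S ->
  incidence F s t != 0 -> s \subset S.
Proof.
move=> Si sK /set0Pn[a ta] /subsetP/(_ a ta) aS /incidence_neq0[x _ tx].
apply/subsetP => y; apply: (detached_supset Si sK); exists a => //.
by move: ta; rewrite tx !inE => /andP[].
Qed.

Lemma coface_detached_eq m S s t : detached S -> #|S| = m -> s \in faces K m ->
  t != finset.set0 -> t \subset S -> incidence F s t != 0 -> s = S.
Proof.
move=> Si Sc /facesP[sK _ sc] t0 tS st; apply/eqP.
by rewrite eqEcard Sc sc leqnn andbT (coface_detached Si sK t0 tS st).
Qed.

Section cycle.
Variables (k : nat) (z : 'rV[F]_#|faces K k.+2|).
Hypothesis zZ : z *m boundary F K k.+1 = 0.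

Lemma cycle_eq0 r : r \in faces K k.+1 ->
  \sum_(t : {set V}) coeff z t * incidence F t r = 0.
Proof.
move=> rK; have := mul_boundary z (enum_rank_in rK r).
by rewrite zZ mxE enum_rankK_in.
Qed.

(** As [S] is detached, the only simplices with the face [S :\ v :\ w] are the
    facets of [S] opposite to [v] and to [w]; so their terms cancel in the
    boundary of [z]. *)
Lemma cycle_two_facets S v w : #|S| = k.+3 -> detached S ->
  v \in S -> w \in S -> v != w ->
  coeff z (S :\ v) * vertex_sign F (S :\ v) w =
  - (coeff z (S :\ w) * vertex_sign F (S :\ w) v).
Proof.
move=> Sc Si; wlog: v w / S :\ v \in K => [wl vS wS vw|SvK vS wS vw].
  have [|SvK] := boolP (S :\ v \in K); first by move/wl; apply.
  have [|SwK] := boolP (S :\ w \in K).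
    by move=> /wl ->//; rewrite ?opprK// eq_sym.
  by rewrite !coeff_out ?mul0r ?oppr0// inE (negbTE SvK, negbTE SwK).
pose r := S :\ v :\ w.
have Sv : #|S :\ v| = k.+2 by move: Sc; rewrite (cardsD1 v) vS add1n => -[].
have wSv : w \in S :\ v by rewrite !inE eq_sym vw.
have vSw : v \in S :\ w by rewrite !inE vw.
have rc : #|r| = k.+1 by move: Sv; rewrite (cardsD1 w) wSv add1n => -[].
have r0 : r != finset.set0 by rewrite -card_gt0 rc.
have rK : r \in faces K k.+1.
  apply/facesP; split => //; apply: Kdown SvK _ r0; exact: subD1set.
have := cycle_eq0 rK.
rewrite (bigD1 (S :\ v))//= (bigD1 (S :\ w))/=; last first.
  by apply: contraTneq vSw => ->; rewrite !inE eqxx.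
rewrite big1 ?addr0; last first.
  move=> t /andP[tv tw]; have [tK|tK] := boolP (t \in faces K k.+2); last first.
    by rewrite coeff_out ?mul0r.
  have [->|rt0] := eqVneq (incidence F t r) 0; first by rewrite mulr0.
  have /facesP[tK' _ _] := tK; have [x xt rt] := incidence_neq0 rt0.
  have rS : r \subset S by rewrite /r !subDset !subsetU ?subxx ?orbT.
  have xS := subsetP (coface_detached Si tK' r0 rS rt0) _ xt; exfalso.
  have xr : x \notin r by rewrite rt !inE eqxx.
  have tE : t = x |: r by rewrite rt setD1K.
  move: xr; rewrite !inE xS andbT -negb_or negbK => /orP[/eqP xw|/eqP xv].
    by move/eqP: tv; apply; rewrite tE xw /r setD1K.
  by move/eqP: tw; apply; rewrite tE xv /r setD1C setD1K.
rewrite /r incidence_facet// setD1C incidence_facet//.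
by move/eqP; rewrite addr_eq0 => /eqP.
Qed.

(** On the facets of a detached [S], a cycle is a multiple of the boundary of
    [S]. *)
Lemma cycle_detached S v w : #|S| = k.+3 -> detached S ->
  v \in S -> w \in S ->
  coeff z (S :\ v) * vertex_sign F S v = coeff z (S :\ w) * vertex_sign F S w.
Proof.
move=> Sc Si vS wS; have [->//|vw] := eqVneq v w.
have h := cycle_two_facets Sc Si vS wS vw.
have h' := vertex_signD F vS wS vw.
have sq s x : vertex_sign F s x * vertex_sign F s x = 1.
  by rewrite /vertex_sign -exprD addnn -muln2 exprM sqrr_sign.
have := congr1 (fun x => x * (vertex_sign F S v * vertex_sign F (S :\ v) w)) h.
rewrite mulrACA sq mulr1 => ->.
by rewrite h' mulrNN mulrACA sq mulr1.
Qed.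

End cycle.

Definition facet s : {set V} := if [pick v in s] is Some v then s :\ v else finset.set0.

Lemma facetE s : s != finset.set0 -> exists2 v, v \in s & facet s = s :\ v.
Proof.
rewrite /facet; case: pickP => [v vs _|h /set0Pn[v vs]]; first by exists v.
by rewrite h in vs.
Qed.

Lemma not_crowded k t u : t \in faces K k.+1 -> t \notin crowded k -> u \notin t ->
  adjacent t u -> detached (u |: t).
Proof.
move=> tK; rewrite inE tK /= => /existsPn/(_ u) + ut tu.
rewrite ut tu /= => /existsPn h.
by apply/forallP => w; apply/implyP => wS; have := h w; rewrite wS.
Qed.

Lemma crowded_detached k S t : detached S -> t \in faces K k.+1 -> t \subset S ->
  #|S| = k.+2 -> t \notin crowded k.
Proof.
move=> Si tK tS Sc; apply/negP; rewrite inE tK /= => /existsP[u /and3P[ut /existsP[a /andP[at_ au]]]].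
move=> /existsP[w /andP[wut /existsP[b /andP[bt bw]]]].
have uS : u \in S.
  apply/negPn/negP => uS; have := detachedP Si (subsetP tS _ at_) uS.
  by rewrite au.
have SE : u |: t = S.
  apply/eqP; rewrite eqEcard subUset sub1set uS tS /= cardsU1 ut.
  by have /facesP[_ _ ->] := tK; rewrite Sc.
by rewrite SE in wut bt; rewrite (detachedP Si bt wut) in bw.
Qed.

(** A cycle [z] that vanishes on the crowded faces, and on one facet of each
    hollow simplex, is a boundary. Let [t] be a face that is not crowded. If no
    vertex is adjacent to [t], then [t] is a component by itself, and a cycle
    vanishes there. Otherwise let [u] be adjacent to [t]; then [u |: t] is
    detached, so that [z] is there a multiple of the boundary of [u |: t] by
    [cycle_detached]. If [u |: t] is a simplex, then this is a boundary. If
    not, the multiple is 0: either [u |: t] is hollow and [z] vanishes on one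
    of its facets by assumption, or [u |: t] lacks a facet. *)
Lemma betti_le_hollow_crowded k :
  (betti F K k.+1 <= #|hollow k.+1| + #|crowded k.+1|)%N.
Proof.
pose C := (facet @: hollow k.+1) :|: crowded k.+1.
apply: (@leq_trans #|C|); last first.
  rewrite (leq_trans (leq_card_setU _ _))// leq_add2r; exact: leq_imset_card.
apply: (@betti_le _ _ (fun j : 'I_#|C| => enum_val j)) => z zZ zC.
have {zC} zC t : t \in C -> coeff z t = 0.
  by move=> tC; have := zC (enum_rank_in tC t); rewrite enum_rankK_in.
have facetK t S : facet S = t -> #|S| = k.+3 -> exists2 v, v \in S & t = S :\ v.
  move=> <- Sc; have [|v vS ->] := @facetE S; first by rewrite -card_gt0 Sc.
  by exists v.
(* The calm simplices are the detached ones; [b] collects the multiples of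
   their boundaries that [z] is made of. *)
pose calm (s : {set V}) := [forall v in s, s :\ v \notin crowded k.+1].
pose b s := if calm s then coeff z (facet s) * incidence F s (facet s) else 0.
suff -> : z = (\row_i b (enum_val i)) *m boundary F K k.+2 by exact: submxMl.
apply/rowP => i; rewrite mxE -coeff_enum_val.
under eq_bigr do rewrite !mxE.
rewrite (sum_enum_val (faces K k.+3) (fun s => b s * incidence F s (enum_val i))).
set t := enum_val i.
have tK : t \in faces K k.+2 by exact: enum_valP.
have /facesP[tK' t0 tc] := tK.
have [tG|tG] := boolP (t \in crowded k.+1).
  rewrite (zC t); last by rewrite inE tG orbT.
  rewrite big1// => s _; rewrite /b.
  have [/forallP sc|] := boolP (calm s); rewrite ?mul0r//.
  have [->|/incidence_neq0[v vs tv]] := eqVneq (incidence F s t) 0; first by rewrite mulr0.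
  by have := sc v; rewrite vs -tv tG.
have [/existsP[u /andP[ut tu]]|/existsPn tiso] :=
    boolP [exists u, (u \notin t) && adjacent t u]; last first.
  have ti : detached t.
    apply/forallP => w; apply/implyP => wt; have := tiso w.
    by rewrite wt.
  have -> : coeff z t = 0.
    have /set0Pn[v vt] := t0.
    have rc : #|t :\ v| = k.+1 by move: tc; rewrite (cardsD1 v) vt add1n => -[].
    have r0 : t :\ v != finset.set0 by rewrite -card_gt0 rc.
    have rK : t :\ v \in faces K k.+1.
      apply/facesP; split => //; apply: Kdown tK' _ r0; exact: subD1set.
    have := cycle_eq0 zZ rK.
    rewrite (bigD1 t)//= big1 ?addr0; last first.
      move=> t' tt'; have [t'K|t'K] := boolP (t' \in faces K k.+2); last first.
        by rewrite coeff_out ?mul0r.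
      have [->|ti'] := eqVneq (incidence F t' (t :\ v)) 0; first by rewrite mulr0.
      case/eqP: tt'; exact: coface_detached_eq ti tc t'K r0 (subD1set _ _) ti'.
    rewrite incidence_facet// => /eqP; rewrite mulf_eq0.
    by rewrite (negbTE (vertex_sign_neq0 _ _ _)) orbF => /eqP.
  rewrite big1// => s sK.
  have [->|st] := eqVneq (incidence F s t) 0; first by rewrite mulr0.
  have /facesP[sK' _ sc] := sK.
  have := subset_leq_card (coface_detached ti sK' t0 (subxx t) st).
  by rewrite sc tc ltnn.
have Si := not_crowded tK tG ut tu.
have Sc : #|u |: t| = k.+3 by rewrite cardsU1 ut tc.
have uS : u \in u |: t by rewrite !inE eqxx.
have tE : t = (u |: t) :\ u by rewrite setU1K.
have [SK|SK] := boolP (u |: t \in K); last first.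
  rewrite big1 => [|s sK]; last first.
    have [->|st] := eqVneq (incidence F s t) 0; first by rewrite mulr0.
    have sE := coface_detached_eq Si Sc sK t0 (subsetUr _ _) st.
    by have /facesP[sK' _ _] := sK; rewrite -sE sK' in SK.
  have [Sh|] := boolP [forall v in u |: t, (u |: t) :\ v \in K].
    have [v vS fE] := facetK _ _ erefl Sc.
    have : coeff z (facet (u |: t)) = 0.
      by apply: zC; rewrite inE imset_f// inE Sc eqxx SK.
    rewrite fE {2}tE => c0.
    have := cycle_detached zZ Sc Si uS vS; rewrite c0 mul0r => /eqP.
    by rewrite mulf_eq0 (negbTE (vertex_sign_neq0 _ _ _)) orbF => /eqP.
  move=> /forallPn[v]; rewrite negb_imply => /andP[vS vK].
  have := cycle_detached zZ Sc Si uS vS.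
  rewrite (@coeff_out _ _ _ _ (_ :\ v)); last by rewrite inE (negbTE vK).
  rewrite mul0r -tE => /eqP.
  by rewrite mulf_eq0 (negbTE (vertex_sign_neq0 _ _ _)) orbF => /eqP.
have SK' : u |: t \in faces K k.+3.
  by apply/facesP; split => //; rewrite -card_gt0 Sc.
rewrite (bigD1 (u |: t))//= big1 ?addr0; last first.
  move=> s /andP[sK sS].
  have [->|st] := eqVneq (incidence F s t) 0; first by rewrite mulr0.
  by case/eqP: sS; exact: coface_detached_eq Si Sc sK t0 (subsetUr _ _) st.
rewrite /b ifT; last first.
  apply/forallP => v; apply/implyP => vS.
  apply: (crowded_detached Si) => //; last by rewrite subD1set.
  have c : #|(u |: t) :\ v| = k.+2 by move: Sc; rewrite (cardsD1 v) vS add1n => -[].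
  have n0 : (u |: t) :\ v != finset.set0 by rewrite -card_gt0 c.
  by apply/facesP; split => //; apply: Kdown SK _ n0; rewrite subD1set.
have [v vS ->] := facetK _ _ erefl Sc.
have hi : incidence F (u |: t) t = vertex_sign F (u |: t) u.
  by rewrite -(incidence_facet F uS) -tE.
rewrite (incidence_facet F vS) -(cycle_detached zZ Sc Si uS vS) -tE hi -mulrA.
by rewrite /vertex_sign -exprD addnn -muln2 exprM sqrr_sign mulr1.
Qed.


Lemma facet_hollow k S : S \in hollow k ->
  [/\ #|facet S| = k.+1, facet S \in faces K k.+1 &
      exists2 v, v \in S & facet S = S :\ v].
Proof.
move=> /hollowP[Sc SK Sh].
have [|v vS fE] := @facetE S; first by rewrite -card_gt0 Sc.
have c : #|facet S| = k.+1 by move: Sc; rewrite fE (cardsD1 v) vS add1n => -[].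
split => //; last by exists v.
apply/facesP; split => //; last by rewrite -card_gt0 c.
by rewrite fE Sh.
Qed.

(** A facet of [S'] has at least two vertices, so that it meets another facet
    of [S'], which contains the vertex [v] opposite to it. As [S] is detached,
    it contains that second facet as well, hence [v]. *)
Lemma detached_hollow_inj k S S' : S \in hollow k.+1 -> S' \in hollow k.+1 ->
  detached S -> facet S' \subset S -> S = S'.
Proof.
move=> /hollowP[Sc _ _] S'h Si fS; have [fc _ [v vS' fE]] := facet_hollow S'h.
have /hollowP[S'c _ S'f] := S'h.
apply/esym/eqP; rewrite eqEcard Sc S'c leqnn andbT.
have /card_gt1P[a [b [af bf ab]]] : (1 < #|facet S'|)%N by rewrite fc.
have aS' : a \in S' by move: af; rewrite fE !inE => /andP[].
have bv : b != v by move: bf; rewrite fE !inE => /andP[].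
have bS' : b \in S' by move: bf; rewrite fE !inE => /andP[].
have av : a != v by move: af; rewrite fE !inE => /andP[].
suff vS : v \in S by rewrite -(setD1K vS') subUset sub1set vS -fE.
apply: (detached_supset Si (S'f a aS')); last by rewrite !inE eq_sym av vS'.
by exists b; rewrite ?(subsetP fS)// !inE eq_sym ab bS'.
Qed.

(** The boundaries of the sets of [A] are cycles. On the chosen facets they form
    a diagonal matrix, while boundaries vanish there: a simplex with [k + 3]
    vertices above a facet of [S] would be [S] itself. *)
Lemma le_betti_detached_hollow k (A : {set {set V}}) :
  A \subset hollow k.+1 -> (forall S, S \in A -> detached S) ->
  (#|A| <= betti F K k.+1)%N.
Proof.
move=> Ah Ai; pose g (j : 'I_#|A|) := facet (enum_val j).
have eh (j : 'I_#|A|) : enum_val j \in hollow k.+1 by apply: (subsetP Ah); exact: enum_valP.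
have ei (j : 'I_#|A|) : detached (enum_val j) by apply: Ai; exact: enum_valP.
have sumg (s : {set V}) j :
    \sum_(i < #|faces K k.+2|) incidence F s (enum_val i) *
       restrict_mx F (faces K k.+2) g i j = incidence F s (g j).
  have [_ gK _] := facet_hollow (eh j).
  rewrite (bigD1 (enum_rank_in gK (g j)))//= mxE enum_rankK_in// eqxx mulr1.
  rewrite big1 ?addr0// => i ij; rewrite mxE.
  case: eqP => [ig|]; last by rewrite mulr0.
  by rewrite -ig enum_valK_in eqxx in ij.
apply: (@betti_ge _ _ g (\matrix_(j, i) incidence F (enum_val j) (enum_val i))).
- apply/matrixP => i j; rewrite mxE [RHS]mxE.
  under eq_bigr do rewrite !mxE.
  rewrite (sum_enum_val (faces K k.+2)
    (fun t => incidence F (enum_val i) t * incidence F t (enum_val j))).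
  by have /hollowP[ic _ ih] := eh i; exact: boundary_boundary_faces.
- exact: boundaryM.
- apply/matrixP => i j; rewrite mxE [RHS]mxE.
  under eq_bigr do rewrite mxE.
  rewrite sumg; apply/eqP/negPn/negP => ig.
  have [gc _ [w wj gE]] := facet_hollow (eh j).
  have g0 : g j != finset.set0 by rewrite -card_gt0 gc.
  have gj : g j \subset enum_val j by rewrite /g gE subD1set.
  have /hollowP[jc /negP jK _] := eh j; apply: jK.
  rewrite -(coface_detached_eq (ei j) jc (enum_valP i) g0 gj ig).
  by have /facesP[] := enum_valP i.
- have -> : (\matrix_(j, i) incidence F (enum_val j) (enum_val i)) *m
      restrict_mx F (faces K k.+2) g =
      diag_mx (\row_j incidence F (enum_val j) (g j)).
    apply/matrixP => i j; rewrite mxE; under eq_bigr do rewrite mxE.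
    rewrite sumg !mxE; have [->|ij] := eqVneq i j; rewrite ?mulr1n ?mulr0n//.
    apply: incidence_eq0; apply: contraNN ij => gi; apply/eqP/enum_val_inj.
    by apply: detached_hollow_inj (eh i) (eh j) (ei i) gi.
  apply: mxrank_unit; rewrite unitmxE det_diag unitfE.
  apply/prodf_neq0 => i _; rewrite mxE /g.
  have [_ _ [v vi ->]] := facet_hollow (eh i).
  by rewrite incidence_facet// vertex_sign_neq0.
Qed.

Lemma boundary0 p (M : 'M[F]_(p, _)) : M *m boundary F K 0 = 0.
Proof.
apply/matrixP => i j; exfalso.
have /facesP[_ + /eqP] := enum_valP j; rewrite cards_eq0 => j0.
by rewrite (negbTE j0).
Qed.

(** Detached vertices are components, and the edges avoid them. *)
Lemma le_betti_detached_vertices (A : {set {set V}}) :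
  A \subset faces K 1 -> (forall S, S \in A -> detached S) ->
  (#|A| <= betti F K 0)%N.
Proof.
move=> AK Ai; pose g (j : 'I_#|A|) := enum_val j : {set V}.
have gK j : g j \in faces K 1 by apply: (subsetP AK); exact: enum_valP.
apply: (@betti_ge _ _ g (restrict_mx F (faces K 1) g)^T).
- exact: boundary0.
- exact: boundary0.
- apply/matrixP => i j; rewrite mxE [RHS]mxE big1// => l _; rewrite !mxE.
  case: eqP => [lg|]; last by rewrite mulr0.
  rewrite mulr1; apply/eqP/negPn/negP => /incidence_neq0[v vi gE].
  have /facesP[sK _ sc] := enum_valP i.
  have /facesP[_ g0 gc] := gK j.
  have /set0Pn[a ag] := g0.
  have ai : a \in enum_val i by move: ag; rewrite -lg gE !inE => /andP[].
  have := detached_supset (Ai _ (enum_valP j)) sK (ex_intro2 _ _ a ag ai) vi.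
  by rewrite -/(g j) -lg gE !inE eqxx.
- suff -> : (restrict_mx F (faces K 1) g)^T *m restrict_mx F (faces K 1) g = 1%:M.
    exact: mxrank1.
  apply/matrixP => i j; rewrite !mxE.
  rewrite (bigD1 (enum_rank_in (gK i) (g i)))//= big1 ?addr0; last first.
    move=> l li; rewrite !mxE; case: eqP => [lg|]; last by rewrite mul0r.
    by case/eqP: li; apply: enum_val_inj; rewrite enum_rankK_in.
  by rewrite !mxE enum_rankK_in// eqxx mul1r (inj_eq enum_val_inj).
Qed.

(** The least that a component has to contain in order to carry a [k]-cycle
    that does not bound. *)
Definition cells k := if k is 0 then faces K 1 else hollow k.

Lemma card_cells k S : S \in cells k -> #|S| = (if k is 0 then 1 else k.+2)%N.
Proof.
case: k => [|k] /=; first by move=> /facesP[].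
by move=> /hollowP[].
Qed.

Lemma le_betti k (A : {set {set V}}) :
  A \subset cells k -> (forall S, S \in A -> detached S) ->
  (#|A| <= betti F K k)%N.
Proof. by case: k => [|k] AK Ai; [exact: le_betti_detached_vertices | exact: le_betti_detached_hollow]. Qed.

Lemma ge_betti k : (betti F K k <= #|cells k| + (if k is 0 then 0 else #|crowded k|))%N.
Proof.
case: k => [|k] /=; last exact: betti_le_hollow_crowded.
by rewrite addn0 /betti (leq_trans (leq_subr _ _))// rank_leq_row.
Qed.

(** No face is crowded for want of vertices, and the only possible hollow
    simplex is the whole vertex set. *)
Lemma betti_min k : #|V| = k.+3 -> betti F K k.+1 = (finset.setT \in hollow k.+1 : nat).
Proof.
move=> Vc; have crowded0 : crowded k.+1 = finset.set0.
  apply/setP => t; rewrite !inE; apply/negP => /andP[/and3P[_ _ /eqP tc]].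
  move=> /existsP[u /and3P[ut _ /existsP[w /andP[wut _]]]].
  have : (#|w |: (u |: t)| <= #|V|)%N by exact: max_card.
  by rewrite cardsU1 wut cardsU1 ut tc Vc ltnn.
have hT : hollow k.+1 = if finset.setT \in hollow k.+1 then [set finset.setT] else finset.set0.
  have sT S : S \in hollow k.+1 -> S = finset.setT.
    move=> /hollowP[Sc _ _]; apply/eqP.
    by rewrite eqEcard finset.subsetT cardsT Sc Vc leqnn.
  case: ifPn => h; apply/setP => S; apply/idP/idP.
  - by move=> /sT ->; rewrite finset.set11.
  - by move=> /set1P ->.
  - move=> Sh; have SE : S = finset.setT by apply: sT.
    by rewrite SE (negbTE h) in Sh.
  - by rewrite finset.in_set0.
apply/eqP; rewrite eqn_leq; apply/andP; split.
  rewrite (leq_trans (ge_betti k.+1))//= crowded0 cards0 addn0 {1}hT.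
  by case: ifP; rewrite ?cards1 ?cards0.
have [h|//] := boolP (finset.setT \in hollow k.+1); have := @le_betti k.+1 [set finset.setT].
rewrite cards1; apply; first by rewrite sub1set.
move=> S /set1P ->; apply/forallP => w; apply/implyP.
by rewrite inE.
Qed.

End betti_bounds.

From mathcomp Require Import all_classical all_reals all_analysis measurable_realfun.

Import numFieldNormedType.Exports.

Local Open Scope classical_set_scope.
Local Open Scope ring_scope.

(** * Maps that scale a product measure *)

Section power_integral.
Context {disp : measure_display} {T : measurableType disp} {R : realType}.
Variable mu : {sigma_finite_measure set T -> \bar R}.
Local Open Scope ereal_scope.

Lemma integral_power0 (g : 0.-tuple T -> \bar R) :
  measurable_fun [set: 0.-tuple T] g ->
  \int[power_measure mu 0]_y g y = g [tuple].
Proof. by move=> mg; rewrite /= integral_dirac// diracT mul1e. Qed.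

Lemma ge0_integral_powerS n (g : n.+1.-tuple T -> \bar R) :
  measurable_fun [set: n.+1.-tuple T] g -> (forall y, 0 <= g y) ->
  \int[power_measure mu n.+1]_y g y =
  \int[mu]_x \int[power_measure mu n]_y g [tuple of x :: y].
Proof.
move=> mg g0.
transitivity (\int[pushforward (mu \x power_measure mu n) (@tuple_cons _ T n)]_y g y).
  by [].
rewrite ge0_integral_pushforward//; last exact: measurable_tuple_cons.
rewrite preimage_setT fubini_tonelli1//.
  exact: measurableT_comp mg (@measurable_tuple_cons _ _ _).
by move=> x; exact: g0.
Qed.

Lemma measurable_cons2 n (g : n.+1.-tuple T -> \bar R) :
  measurable_fun [set: n.+1.-tuple T] g ->
  measurable_fun setT (fun p : T * n.-tuple T => g [tuple of p.1 :: p.2]).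
Proof. move=> mg; exact: measurableT_comp mg (@measurable_tuple_cons _ _ _). Qed.

End power_integral.

(** The image of [mu] under [phi] is [c] times [mu]; stated with integrals,
    since it is applied inside iterated ones. *)
Definition scales_measure {disp} {T : measurableType disp} {R : realType}
    (mu : {measure set T -> \bar R}) (phi : T -> T) (c : R) : Prop :=
  measurable_fun setT phi /\
  forall g : T -> \bar R, measurable_fun setT g -> (forall x, 0 <= g x)%E ->
    (\int[mu]_x g (phi x) = c%:E * \int[mu]_x g x)%E.

Section scales_measure.
Context {disp : measure_display} {T : measurableType disp} {R : realType}.

Lemma scales_measureP (mu : {measure set T -> \bar R}) (phi : T -> T) (c : R) :
  measurable_fun setT phi -> 0 <= c ->
  (forall A, measurable A -> mu (phi @^-1` A) = (c%:E * mu A)%E) ->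
  scales_measure mu phi c.
Proof.
move=> mphi c0 h; split=> // g mg g0.
have := @ge0_integral_pushforward _ _ T T R phi mphi mu setT g measurableT mg.
rewrite preimage_setT => <-; last by [].
transitivity (\int[mscale (NngNum c0) mu]_x g x)%E.
  by apply: eq_measure_integral => A mA _; exact: h.
by rewrite ge0_integral_mscale.
Qed.

Lemma scales_measure_comp (mu : {measure set T -> \bar R}) phi psi (a b : R) :
  scales_measure mu phi a -> scales_measure mu psi b ->
  scales_measure mu (phi \o psi) (b * a).
Proof.
move=> [mphi hphi] [mpsi hpsi]; split; first exact: measurableT_comp.
move=> g mg g0; rewrite /= (hpsi (g \o phi))//.
- by rewrite hphi// muleA -EFinM.
- exact: measurableT_comp.
- by move=> x; apply: g0.
Qed.

Lemma scales_measure_id (mu : {measure set T -> \bar R}) : scales_measure mu id 1.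
Proof. by split=> // g mg g0; rewrite mul1e. Qed.

(** The maps are indexed by [nat], for the coordinates of the tail of a tuple
    to be covered by the induction hypothesis. *)
Lemma scales_power (mu : {sigma_finite_measure set T -> \bar R}) (c : R) n
    (phi : nat -> T -> T) :
  0 <= c -> (forall i, scales_measure mu (phi i) c) ->
  scales_measure (power_measure mu n)
    (fun y => [tuple phi i (tnth y i) | i < n]) (c ^+ n).
Proof.
move=> c0; elim: n phi => [|n IH] phi hphi.
  split; first by apply/measurable_fun_tnthP => -[].
  move=> g mg g0; rewrite expr0 mul1e !integral_power0//.
    by rewrite [X in g X]tuple0.
  apply: measurableT_comp mg _.
  by apply/measurable_fun_tnthP => -[].
have mphi : measurable_fun setT (fun y : n.+1.-tuple T => [tuple phi i (tnth y i) | i < n.+1]).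
  apply/measurable_fun_tnthP => i.
  rewrite (_ : _ \o _ = phi i \o (fun y => tnth y i)); last first.
    by apply/funext => y /=; rewrite tnth_mktuple.
  apply: measurableT_comp; [exact: (hphi i).1|exact: measurable_tnth].
split=> // g mg g0; rewrite !ge0_integral_powerS//; last exact: measurableT_comp mg mphi.
have [mIH hIH] := IH (fun i => phi i.+1) (fun i => hphi i.+1).
have E x (y : n.-tuple T) :
    [tuple phi i (tnth [tuple of x :: y] i) | i < n.+1] =
    [tuple of phi 0%N x :: [tuple phi i.+1 (tnth y i) | i < n]].
  apply: eq_from_tnth => i; rewrite tnth_mktuple.
  case: (unliftP ord0 i) => [j|] ->; last by rewrite !tnth0.
  by rewrite !tnthS tnth_mktuple.
under eq_integral do under eq_integral do rewrite E.
transitivity (\int[mu]_x ((c ^+ n)%:E * \int[power_measure mu n]_y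
    g [tuple of phi 0%N x :: y]))%E.
  apply: eq_integral => x _.
  rewrite (hIH (fun y => g [tuple of phi 0%N x :: y]))//.
  exact: measurable_fun_pair2 (measurable_cons2 mg).
have mF : measurable_fun setT (fun x => \int[power_measure mu n]_y g [tuple of x :: y])%E.
  exact: measurable_fun_fubini_tonelli_F (measurable_cons2 mg) (fun=> g0 _).
rewrite ge0_integralZl_EFin ?exprn_ge0//; first last.
- exact: measurableT_comp mF (hphi 0%N).1.
- by move=> x _; apply: integral_ge0.
rewrite ((hphi 0%N).2 (fun x => \int[power_measure mu n]_y g [tuple of x :: y]))%E//.
  by rewrite muleA -EFinM -exprSr.
by move=> x; apply: integral_ge0.
Qed.

End scales_measure.

Section lebesgue_scaling.
Context {R : realType}.
Let mu := (@lebesgue_measure R).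

(** Lebesgue measure is characterized by the measure of intervals. *)
Lemma lebesgue_scalesP (phi : R -> R) (c : R) :
  measurable_fun [set: R] phi -> 0 < c ->
  (forall x y : R, mu (phi @^-1` `]x, y]) = (c%:E * mu `]x, y])%E) ->
  scales_measure mu phi c.
Proof.
move=> mphi c0 h; apply: scales_measureP => //; first exact: ltW.
move=> A mA; have ci0 : 0 <= c^-1 by rewrite invr_ge0 ltW.
pose nu : {measure set (measurableTypeR R) -> \bar R} :=
  mscale (NngNum ci0) (pushforward mu (phi : measurableTypeR R -> measurableTypeR R)).
transitivity (c%:E * (c^-1%:E * mu (phi @^-1` A)))%E.
  by rewrite muleA -EFinM mulfV ?mul1e// gt_eqF.
congr (_ * _)%E; apply/esym.
apply: (@lebesgue_measure_unique R (nu mphi)) => // X [[x y] /= _ <-].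
rewrite -[RHS]/(c^-1%:E * mu (phi @^-1` `]x, y]))%E h.
by rewrite muleA -EFinM mulVf ?mul1e// gt_eqF.
Qed.

Lemma lebesgue_shift (a : R) : scales_measure mu (fun x => x + a) 1.
Proof.
apply: lebesgue_scalesP => //.
  by apply: measurable_funD => //; exact: measurable_cst.
move=> x y; rewrite mul1e.
have -> : (fun z => z + a) @^-1` [set` `]x, y]] = [set` `]x - a, y - a]].
  by apply/seteqP; split => z /=; rewrite !in_itv /= ltrBlDr lerBrDr.
rewrite /mu !lebesgue_measure_itv /= !lte_fin ltrD2r.
by case: ifP => // _; rewrite -!EFinD; congr EFin; ring.
Qed.

Lemma lebesgue_scale (a : R) : 0 < a -> scales_measure mu (fun x => a * x) a^-1.
Proof.
move=> a0; apply: lebesgue_scalesP; first exact: mulrl_measurable.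
  by rewrite invr_gt0.
move=> x y.
have -> : (fun z => a * z) @^-1` [set` `]x, y]] = [set` `]x / a, y / a]].
  by apply/seteqP; split => z /=; rewrite !in_itv /= ltr_pdivrMr// ler_pdivlMr// ![z * a]mulrC.
rewrite /mu !lebesgue_measure_itv /= !lte_fin ltr_pM2r ?invr_gt0//.
case: ifP => // _; last by rewrite mule0.
by rewrite -!EFinD -EFinM; congr EFin; field; rewrite gt_eqF.
Qed.

Lemma lebesgue_opp : scales_measure mu -%R 1.
Proof.
apply: scales_measureP; [exact: oppr_measurable|by []|].
by move=> A mA; rewrite mul1e; exact: lebesgue_measureN.
Qed.

End lebesgue_scaling.

(** * Euclidean geometry *)

Lemma sqrtr_measurable {R : realType} : measurable_fun [set: R] (@Num.sqrt R).
Proof. by apply: continuous_measurable_fun; exact: sqrt_continuous. Qed.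

Section euclid.
Context {R : realType} {d : nat}.
Implicit Types x y z a : euclidean R d.

(** A coordinate as an element of [R], rather than of the alias of [R] that
    carries the sigma-algebra. *)
Definition coord x (i : 'I_d) : R := tnth x i.
Definition vec (f : 'I_d -> R) : euclidean R d := [tuple (f i : measurableTypeR R) | i < d].

Lemma coord_vec f i : coord (vec f) i = f i.
Proof. by rewrite /coord tnth_mktuple. Qed.

Lemma eq_coord x y : (forall i, coord x i = coord y i) -> x = y.
Proof. by move=> h; apply: eq_from_tnth => i; exact: h. Qed.

Definition addv x y := vec (fun i => coord x i + coord y i).
Definition scalev (c : R) x := vec (fun i => c * coord x i).
Definition oppv x := vec (fun i => - coord x i).
Definition dotv x y : R := \sum_(i < d) coord x i * coord y i.

Lemma coord_origin i : coord origin i = 0.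
Proof. by rewrite /coord tnth_mktuple. Qed.

Lemma coord_addv x y i : coord (addv x y) i = coord x i + coord y i.
Proof. exact: coord_vec. Qed.

Lemma coord_scalev c x i : coord (scalev c x) i = c * coord x i.
Proof. exact: coord_vec. Qed.

Lemma euclidean_distE x y :
  euclidean_dist x y = Num.sqrt (\sum_(i < d) (coord x i - coord y i) ^+ 2).
Proof. by []. Qed.

Lemma euclidean_normE x : euclidean_norm x = Num.sqrt (\sum_(i < d) coord x i ^+ 2).
Proof.
by congr Num.sqrt; apply: eq_bigr => i _; rewrite -[tnth origin i]/(coord origin i) coord_origin subr0.
Qed.

Lemma sumsq_ge0 (f : 'I_d -> R) : 0 <= \sum_(i < d) f i ^+ 2.
Proof. by apply: sumr_ge0 => i _; exact: sqr_ge0. Qed.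

Lemma euclidean_dist_ge0 x y : 0 <= euclidean_dist x y.
Proof. exact: sqrtr_ge0. Qed.

Lemma euclidean_norm_ge0 x : 0 <= euclidean_norm x.
Proof. exact: sqrtr_ge0. Qed.

Lemma euclidean_norm_sq x : euclidean_norm x ^+ 2 = dotv x x.
Proof.
by rewrite euclidean_normE sqr_sqrtr ?sumsq_ge0.
Qed.

Lemma euclidean_distC x y : euclidean_dist x y = euclidean_dist y x.
Proof.
congr Num.sqrt; apply: eq_bigr => i _; rewrite -sqrrN opprB //.
Qed.

Lemma euclidean_distxx x : euclidean_dist x x = 0.
Proof.
by rewrite euclidean_distE big1 ?sqrtr0// => i _; rewrite subrr expr0n.
Qed.

Lemma cauchy_schwarz (f g : 'I_d -> R) :
  \sum_i f i * g i <=
  Num.sqrt (\sum_i f i ^+ 2) * Num.sqrt (\sum_i g i ^+ 2).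
Proof.
set A := \sum_i f i ^+ 2; set B := \sum_i g i ^+ 2; set C := \sum_i _.
have A0 : 0 <= A := sumsq_ge0 f.
have B0 : 0 <= B := sumsq_ge0 g.
have [a b] := (sqr_sqrtr A0, sqr_sqrtr B0).
set p := Num.sqrt A in a *; set q := Num.sqrt B in b *.
have p0 : 0 <= p by exact: sqrtr_ge0.
have q0 : 0 <= q by exact: sqrtr_ge0.
have h : 0 <= p * q * (p * q - C).
  suff -> : p * q * (p * q - C) = (\sum_i (q * f i - p * g i) ^+ 2) / 2.
    by rewrite divr_ge0// sumsq_ge0.
  have -> : \sum_i (q * f i - p * g i) ^+ 2 = q ^+ 2 * A - (2 * p * q) * C + p ^+ 2 * B.
    rewrite !mulr_sumr -sumrN -!big_split /=.
    by apply: eq_bigr => i _; ring.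
  by rewrite -a -b; field.
have [pq|] := ltP 0 (p * q); first by move: h; rewrite pmulr_rge0// subr_ge0.
move=> pq; have {}pq : p * q = 0 by apply/eqP; rewrite eq_le pq mulr_ge0.
rewrite pq; suff -> : C = 0 by [].
have zero (f' : 'I_d -> R) : Num.sqrt (\sum_i f' i ^+ 2) = 0 -> forall i, f' i = 0.
  move=> /eqP; rewrite sqrtr_eq0 => h0 i.
  have : \sum_i f' i ^+ 2 == 0 by rewrite eq_le h0 sumsq_ge0.
  rewrite psumr_eq0 => [/allP /(_ i)|j _]; last exact: sqr_ge0.
  by rewrite mem_index_enum sqrf_eq0 => /(_ isT)/eqP.
move/eqP: pq; rewrite mulf_eq0 => /orP[] /eqP /zero h0; rewrite /C big1// => i _.
  by rewrite h0 mul0r.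
by rewrite h0 mulr0.
Qed.

Lemma minkowski2 (f g : 'I_d -> R) :
  Num.sqrt (\sum_i (f i + g i) ^+ 2) <=
  Num.sqrt (\sum_i f i ^+ 2) + Num.sqrt (\sum_i g i ^+ 2).
Proof.
have s0 : 0 <= Num.sqrt (\sum_i f i ^+ 2) + Num.sqrt (\sum_i g i ^+ 2).
  by rewrite addr_ge0// sqrtr_ge0.
rewrite -[leRHS]ger0_norm// -sqrtr_sqr.
apply: ler_wsqrtr; rewrite sqrrD !sqr_sqrtr ?sumsq_ge0//.
have := cauchy_schwarz f g.
have -> : \sum_i (f i + g i) ^+ 2 =
  \sum_i f i ^+ 2 + (\sum_i f i * g i) *+ 2 + \sum_i g i ^+ 2.
  rewrite -sumrMnl -!big_split /=; apply: eq_bigr => i _; exact: sqrrD.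
by move=> h; rewrite !lerD2r lerD2l lerMn2r h orbT.
Qed.

Lemma euclidean_triangle y x z :
  euclidean_dist x z <= euclidean_dist x y + euclidean_dist y z.
Proof.
rewrite !euclidean_distE; apply: le_trans (minkowski2 _ _); apply: ler_wsqrtr.
by apply: ler_sum => i _; rewrite addrA subrK.
Qed.

Lemma euclidean_norm_triangle x y : euclidean_norm x <= euclidean_norm y + euclidean_dist x y.
Proof. by rewrite addrC; exact: euclidean_triangle. Qed.

Lemma euclidean_dist_addv x y a : euclidean_dist (addv x a) (addv y a) = euclidean_dist x y.
Proof.
rewrite !euclidean_distE; congr Num.sqrt; apply: eq_bigr => i _.
by rewrite !coord_addv; congr (_ ^+ 2); ring.
Qed.

Lemma coord_le_dist x y i : `|coord x i - coord y i| <= euclidean_dist x y.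
Proof.
rewrite -sqrtr_sqr; apply: ler_wsqrtr; rewrite (bigD1 i)//= lerDl.
by apply: sumr_ge0 => j _; exact: sqr_ge0.
Qed.

Lemma euclidean_dist_eq0 x y : euclidean_dist x y = 0 -> x = y.
Proof.
move=> h; apply: eq_coord => i; apply/eqP; rewrite -subr_eq0 -normr_eq0.
by rewrite eq_le normr_ge0 andbT -h coord_le_dist.
Qed.

Lemma measurable_coord i : measurable_fun [set: euclidean R d] (coord^~ i).
Proof. exact: (@measurable_tnth _ (measurableTypeR R)). Qed.

Section measurable_maps.
Context {disp : measure_display} {T : measurableType disp}.

Lemma measurable_vec (f : 'I_d -> T -> R) :
  (forall i, measurable_fun [set: T] (f i)) ->
  measurable_fun [set: T] (fun w => vec (f^~ w)).
Proof.
move=> mf; apply/measurable_fun_tnthP => i.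
apply: (eq_measurable_fun (f i)); last exact: mf.
by move=> w _ /=; rewrite tnth_mktuple.
Qed.

Lemma measurable_coord_comp (f : T -> euclidean R d) i :
  measurable_fun [set: T] f -> measurable_fun [set: T] (fun w => coord (f w) i).
Proof. by move=> mf; apply: measurableT_comp (measurable_coord i) mf. Qed.

Lemma measurable_addv (f g : T -> euclidean R d) :
  measurable_fun [set: T] f -> measurable_fun [set: T] g ->
  measurable_fun [set: T] (fun w => addv (f w) (g w)).
Proof.
move=> mf mg; apply: measurable_vec => i.
by apply: measurable_funD; exact: measurable_coord_comp.
Qed.

Lemma measurable_euclidean_dist (f g : T -> euclidean R d) :
  measurable_fun [set: T] f -> measurable_fun [set: T] g ->
  measurable_fun [set: T] (fun w => euclidean_dist (f w) (g w)).
Proof.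
move=> mf mg; apply: measurableT_comp sqrtr_measurable _.
apply: measurable_sum => i; apply: measurable_funX.
by apply: measurable_funB; exact: measurable_coord_comp.
Qed.

Lemma measurable_euclidean_dist_lt (f g : T -> euclidean R d) (r : R) :
  measurable_fun [set: T] f -> measurable_fun [set: T] g ->
  measurable [set w | euclidean_dist (f w) (g w) < r].
Proof.
move=> mf mg; have mlt : measurable_fun [set: T] (fun w => euclidean_dist (f w) (g w) < r).
  by apply: measurable_fun_ltr => //; exact: measurable_euclidean_dist.
have := mlt measurableT [set true] I; rewrite setTI.
by congr measurable; apply/seteqP; split.
Qed.

Lemma measurable_euclidean_norm (f : T -> euclidean R d) :
  measurable_fun [set: T] f ->
  measurable_fun [set: T] (fun w => euclidean_norm (f w)).
Proof. by move=> mf; apply: measurable_euclidean_dist => //; exact: measurable_cst. Qed.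

End measurable_maps.

Lemma measurable_norm : measurable_fun [set: euclidean R d] euclidean_norm.
Proof.
by apply: (@measurable_euclidean_norm _ (euclidean R d) id); exact: measurable_id.
Qed.

Lemma lebesgue_addv a : scales_measure (lebesgue_euclidean (R := R) (d := d)) (addv^~ a) 1.
Proof.
have := @scales_power _ (measurableTypeR R) R (@lebesgue_measure R) 1 d
   (fun i (t : R) => t + nth (0 : R) a i) ler01 (fun i => lebesgue_shift _).
rewrite expr1n; set f := (fun y : d.-tuple _ => _); suff -> : addv^~ a = f by [].
apply/funext => x; apply: eq_coord => i; rewrite coord_addv /f /coord tnth_mktuple.
by rewrite [tnth a i](tnth_nth (0 : R)).
Qed.

Lemma lebesgue_scalev (c : R) : 0 < c ->
  scales_measure (lebesgue_euclidean (R := R) (d := d)) (scalev c) (c^-1 ^+ d).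
Proof.
move=> c0; have ci : 0 <= c^-1 by rewrite invr_ge0 ltW.
have := @scales_power _ (measurableTypeR R) R (@lebesgue_measure R) c^-1 d
   (fun i (t : R) => c * t) ci (fun i => lebesgue_scale c0).
set f := (fun y : d.-tuple _ => _); suff -> : scalev c = f by [].
by apply/funext => x; apply: eq_coord => i; rewrite coord_scalev.
Qed.

Definition isometry_onto (phi : euclidean R d -> euclidean R d) :=
  (forall x y, euclidean_dist (phi x) (phi y) = euclidean_dist x y) /\
  (forall y, exists x, phi x = y).

End euclid.

Section isometries.
Context {R : realType} {n : nat}.
Notation E := (euclidean R n.+1).
Notation E' := (euclidean R n).
Implicit Types (x y : E) (v t : E').

Definition consv (a : R) t : E := [tuple of (a : measurableTypeR R) :: t].
Definition headv x : R := thead x.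
Definition tailv x : E' := [tuple of behead x].

Lemma headv_cons a t : headv (consv a t) = a.
Proof. exact: theadE. Qed.

Lemma tailv_cons a t : tailv (consv a t) = t.
Proof. exact: val_inj. Qed.

Lemma consvK x : consv (headv x) (tailv x) = x.
Proof. by rewrite [in RHS](tuple_eta x). Qed.

Lemma coord_consv0 a t : coord (consv a t) ord0 = a.
Proof. by rewrite /coord tnth0. Qed.

Lemma coord_consvS a t i : coord (consv a t) (lift ord0 i) = coord t i.
Proof. by rewrite /coord tnthS. Qed.

Lemma euclidean_dist_cons a b t u :
  euclidean_dist (consv a t) (consv b u) =
  Num.sqrt ((a - b) ^+ 2 + \sum_(i < n) (coord t i - coord u i) ^+ 2).
Proof.
rewrite euclidean_distE big_ord_recl !coord_consv0; congr (Num.sqrt (_ + _)).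
by apply: eq_bigr => i _; rewrite !coord_consvS.
Qed.

Lemma euclidean_norm_cons a t :
  euclidean_norm (consv a t) = Num.sqrt (a ^+ 2 + dotv t t).
Proof.
rewrite euclidean_normE big_ord_recl coord_consv0; congr (Num.sqrt (_ + _)).
by apply: eq_bigr => i _; rewrite coord_consvS expr2.
Qed.

Lemma first_coordE x : first_coord x = headv x.
Proof. by rewrite -[x in LHS]consvK. Qed.

Lemma addv_cons a b t u : addv (consv a t) (consv b u) = consv (a + b) (addv t u).
Proof.
apply: eq_coord => i; rewrite coord_addv.
case: (unliftP ord0 i) => [j|] ->; last by rewrite !coord_consv0.
by rewrite !coord_consvS coord_addv.
Qed.

Lemma measurable_headv : measurable_fun [set: E] headv.
Proof.
apply: (eq_measurable_fun (coord^~ ord0)); last exact: measurable_coord.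
by move=> x _; rewrite -[x in LHS]consvK coord_consv0.
Qed.

Lemma measurable_tailv : measurable_fun [set: E] tailv.
Proof. exact: (@measurable_behead _ (measurableTypeR R)). Qed.

Lemma measurable_consv disp (T : measurableType disp) (f : T -> R) (g : T -> E') :
  measurable_fun [set: T] f -> measurable_fun [set: T] g ->
  measurable_fun [set: T] (fun w => consv (f w) (g w)).
Proof. exact: (@measurable_cons _ _ _ (measurableTypeR R)). Qed.

Lemma measurable_dotv disp (T : measurableType disp) d (f g : T -> euclidean R d) :
  measurable_fun [set: T] f -> measurable_fun [set: T] g ->
  measurable_fun [set: T] (fun w => dotv (f w) (g w)).
Proof.
move=> mf mg; apply: measurable_sum => i; apply: measurable_funM;
  exact: measurable_coord_comp.
Qed.

Lemma ge0_integral_euclideanS (g : E -> \bar R) :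
  measurable_fun [set: E] g -> (forall y, 0 <= g y)%E ->
  (\int[lebesgue_euclidean]_y g y =
   \int[lebesgue_measure]_a \int[lebesgue_euclidean]_t g (consv a t))%E.
Proof. by move=> mg g0; rewrite [LHS]ge0_integral_powerS. Qed.

Lemma measurable_consv2 (g : E -> \bar R) : measurable_fun [set: E] g ->
  measurable_fun [set: (measurableTypeR R) * E'] (fun p => g (consv p.1 p.2)).
Proof. move=> mg; exact: measurable_cons2 mg. Qed.

(** All additive isometries preserve Lebesgue measure, but for those needed
    below it is seen at once on a factorization into reflections and shears, so
    that it is made part of the notion. *)
Definition motion (phi : E -> E) : Prop :=
  [/\ scales_measure (lebesgue_euclidean (R := R)) phi 1,
      isometry_onto phi & forall x y, phi (addv x y) = addv (phi x) (phi y)].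

Lemma motion_comp phi psi : motion phi -> motion psi -> motion (phi \o psi).
Proof.
move=> [m1 [i1 s1] a1] [m2 [i2 s2] a2]; split; last by move=> x y /=; rewrite a2 a1.
- by rewrite -[X in scales_measure _ _ X]mulr1; exact: scales_measure_comp.
- split=> [x y /=|y]; first by rewrite i1 i2.
  by have [z <-] := s1 y; have [x <-] := s2 z; exists x.
Qed.

Lemma motion_id : motion id.
Proof. by split=> //; [exact: scales_measure_id|split=> // y; exists y]. Qed.

Lemma motion_norm phi x : motion phi -> euclidean_norm (phi x) = euclidean_norm x.
Proof.
move=> [_ [i _] a]; rewrite /euclidean_norm -[RHS]i; congr euclidean_dist.
have h : addv origin origin = origin :> E.
  by apply: eq_coord => j; rewrite coord_addv coord_origin addr0.
have := a origin origin; rewrite h => e; apply: eq_coord => j; rewrite coord_origin.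
have := congr1 (fun z => coord z j) e; rewrite coord_addv => /eqP.
by rewrite -subr_eq subrr => /eqP.
Qed.

Definition reflect_head x : E := consv (- headv x) (tailv x).

Lemma motion_reflect : motion reflect_head.
Proof.
split.
- split.
    apply: measurable_consv; last exact: measurable_tailv.
    by apply: measurable_funN; exact: measurable_headv.
  move=> g mg g0; rewrite mul1e !ge0_integral_euclideanS//; last first.
    apply: measurableT_comp mg _.
    apply: measurable_consv; last exact: measurable_tailv.
    by apply: measurable_funN; exact: measurable_headv.
  have [_ /(_ (fun a => \int[lebesgue_euclidean]_t g (consv a t)))%E] := @lebesgue_opp R.
  rewrite mul1e => <-.
  + by apply: eq_integral => a _; apply: eq_integral => t _;
      rewrite /reflect_head headv_cons tailv_cons.
  + exact: measurable_fun_fubini_tonelli_F (measurable_consv2 mg) (fun=> g0 _).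
  + by move=> a; apply: integral_ge0.
- split=> [x y|y]; last first.
    by exists (reflect_head y); rewrite /reflect_head headv_cons tailv_cons opprK consvK.
  rewrite /reflect_head euclidean_dist_cons -[x in RHS]consvK -[y in RHS]consvK.
  by rewrite euclidean_dist_cons -opprD sqrrN.
- move=> x y; rewrite -[x]consvK -[y]consvK addv_cons /reflect_head.
  by rewrite !headv_cons !tailv_cons addv_cons opprD.
Qed.

Definition shear_head (c : R) v x : E := consv (headv x + c * dotv v (tailv x)) (tailv x).
Definition shear_tail (c : R) v x : E := consv (headv x) (addv (tailv x) (scalev (c * headv x) v)).

Lemma measurable_shear_head c v : measurable_fun [set: E] (shear_head c v).
Proof.
apply: measurable_consv; last exact: measurable_tailv.
apply: measurable_funD; first exact: measurable_headv.
apply: measurable_funM; first exact: measurable_cst.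
by apply: measurable_dotv; [exact: measurable_cst|exact: measurable_tailv].
Qed.

Lemma measurable_shear_tail c v : measurable_fun [set: E] (shear_tail c v).
Proof.
apply: measurable_consv; first exact: measurable_headv.
apply: measurable_addv; first exact: measurable_tailv.
apply: measurable_vec => i; apply: measurable_funM; last exact: measurable_cst.
by apply: measurable_funM; [exact: measurable_cst|exact: measurable_headv].
Qed.

(** By Fubini: a shear translates each fibre. *)
Lemma lebesgue_shear_tail c v : scales_measure (lebesgue_euclidean (R := R)) (shear_tail c v) 1.
Proof.
split; first exact: measurable_shear_tail.
move=> g mg g0; rewrite mul1e !ge0_integral_euclideanS//; last first.
  exact: measurableT_comp mg (@measurable_shear_tail c v).
apply: eq_integral => a _.
have [_ /(_ (fun t => g (consv a t)))] := lebesgue_addv (scalev (c * a) v).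
rewrite mul1e => <-//.
- by apply: eq_integral => t _; rewrite /shear_tail headv_cons tailv_cons.
- exact: measurable_fun_pair2 (measurable_consv2 mg).
Qed.

Lemma lebesgue_shear_head c v : scales_measure (lebesgue_euclidean (R := R)) (shear_head c v) 1.
Proof.
split; first exact: measurable_shear_head.
have ms := @measurable_shear_head c v.
move=> g mg g0; rewrite mul1e !ge0_integral_euclideanS//; last first.
  exact: measurableT_comp mg ms.
rewrite (fubini_tonelli (fun p : measurableTypeR R * E' => g (shear_head c v (consv p.1 p.2))))//; last first.
  exact: (measurable_consv2 (measurableT_comp mg ms)).
rewrite (fubini_tonelli (fun p : measurableTypeR R * E' => g (consv p.1 p.2)))//; last first.
  exact: (measurable_consv2 mg).
apply: eq_integral => t _ /=.
have [_ /(_ (fun a => g (consv a t)))] := @lebesgue_shift R (c * dotv v t).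
rewrite mul1e => <-//.
- by apply: eq_integral => a _; rewrite /shear_head headv_cons tailv_cons.
- exact: measurable_fun_pair1 (measurable_consv2 mg).
Qed.

End isometries.

(** * Densities and polar coordinates *)

Section density.
Local Open Scope ereal_scope.
Context {disp : measure_display} {T : measurableType disp} {R : realType}.
Variables (mu : {measure set T -> \bar R}) (f : T -> \bar R).
Hypothesis mf : measurable_fun [set: T] f.
Hypothesis f0 : forall x, 0 <= f x.

Definition density (A : set T) : \bar R := \int[mu]_(x in A) f x.

Let density0 : density set0 = 0.
Proof. by rewrite /density integral_set0. Qed.

Let density_ge0 A : 0 <= density A.
Proof. by apply: integral_ge0. Qed.

Let density_sigma_additive : semi_sigma_additive density.
Proof.
move=> /= A mA tA mUA; rewrite /density ge0_integral_bigcup//=; last exact: measurable_funTS.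
by apply: is_cvg_ereal_nneg_natsum_cond => n _ _; exact: integral_ge0.
Qed.

Definition density_measure : {measure set T -> \bar R} :=
  HB.pack density
    (isMeasure.Build _ _ _ density density0 density_ge0 density_sigma_additive).

Import HBNNSimple.

Let integral_density_nnsfun (h : {nnsfun T >-> R}) :
  \int[density_measure]_x (h x)%:E = \int[mu]_x ((h x)%:E * f x).
Proof.
under [LHS]eq_integral do rewrite fimfunE -fsumEFin//.
rewrite [LHS]ge0_integral_fsum//; last 2 first.
  - by move=> r; exact/measurable_EFinP/measurableT_comp.
  - by move=> n x _; rewrite EFinM nnfun_muleindic_ge0.
under [RHS]eq_integral.
  move=> x xD; rewrite fimfunE -fsumEFin// ge0_mule_fsuml; last first.
    by move=> r; rewrite EFinM nnfun_muleindic_ge0.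
  over.
rewrite [RHS]ge0_integral_fsum//; last 2 first.
  - move=> r; apply: emeasurable_funM => //.
    by apply/measurable_EFinP/measurableT_comp.
  - by move=> n x _; rewrite mule_ge0// EFinM nnfun_muleindic_ge0.
apply: eq_fsbigr => r _.
have mA : measurable (h @^-1` [set r]) by exact: measurable_funPTI.
rewrite integralZl_indic_nnsfun// integral_indic// setIT.
transitivity (\int[mu]_x (r%:E * ((\1_(h @^-1` [set r]) x)%:E * f x))); last first.
  by apply: eq_integral => x _; rewrite EFinM muleA.
have [r0|r0] := leP 0%R r.
  rewrite ge0_integralZl_EFin//.
  - congr (_ * _); rewrite /= /density integral_mkcond.
    by apply: eq_integral => x _; rewrite epatch_indic muleC.
  - by move=> x _; rewrite mule_ge0// lee_fin.
  - by apply: emeasurable_funM => //; apply/measurable_EFinP.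
rewrite preimage_nnfun0// measure0 mule0 integral0_eq// => x _.
by rewrite indicE in_set0 mul0e mule0.
Qed.

Lemma ge0_integral_density (g : T -> \bar R) : measurable_fun [set: T] g ->
  (forall x, 0 <= g x) -> (forall x, f x \is a fin_num) ->
  \int[density_measure]_x g x = \int[mu]_x (g x * f x).
Proof.
move=> mg g0 ff; pose g_ := nnsfun_approx measurableT mg.
have gcvg x : EFin (g_ n x) @[n --> \oo] --> g x.
  by apply: cvg_nnsfun_approx => // y _; exact: g0.
transitivity (limn (fun n => \int[density_measure]_x (g_ n x)%:E)).
  rewrite -monotone_convergence//.
  - by apply: eq_integral => x _; apply/esym/cvg_lim => //=; exact: gcvg.
  - by move=> n; apply: measurableT_comp => //; exact: measurable_funTS.
  - by move=> n x _; rewrite lee_fin.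
  - by move=> x _ a b ab; rewrite lee_fin//; exact/lefP/nd_nnsfun_approx.
under eq_fun do rewrite integral_density_nnsfun.
rewrite -monotone_convergence//=.
- apply: eq_integral => x _; apply/cvg_lim => //=.
  by apply: cvgeZr => //; exact: gcvg.
- move=> n; apply: emeasurable_funM => //.
  by apply/measurable_EFinP; exact: measurable_funTS.
- by move=> n x _; rewrite mule_ge0// lee_fin.
- move=> x _ a b ab; apply: lee_wpmul2r => //.
  by rewrite lee_fin//; exact/lefP/nd_nnsfun_approx.
Qed.

End density.

Section box.
Context {disp : measure_display} {T : measurableType disp} {R : realType}.
Variable mu : {sigma_finite_measure set T -> \bar R}.
Local Open Scope ereal_scope.

Lemma measurable_box n (A : nat -> set T) : (forall i, measurable (A i)) ->
  measurable [set y : n.-tuple T | forall i : 'I_n, A i (tnth y i)].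
Proof.
move=> mA; rewrite (_ : mkset _ = \bigcap_(i in [set: 'I_n]) ((fun y => tnth y i) @^-1` A i)); last first.
  by apply/seteqP; split => y /= h i; [move=> _|]; exact: h.
apply: fin_bigcap_measurable => // i _; rewrite -[X in measurable X]setTI.
exact: measurable_tnth.
Qed.

Lemma power_measure_box n (A : nat -> set T) : (forall i, measurable (A i)) ->
  power_measure mu n [set y | forall i : 'I_n, A i (tnth y i)] =
  \prod_(i < n) mu (A i).
Proof.
elim: n A => [|n IH] A mA.
  rewrite big_ord0 /= diracE mem_set//= => -[].
  by case.
have E : @tuple_cons _ T n @^-1` [set y | forall i : 'I_n.+1, A i (tnth y i)] =
    A 0%N `*` [set y | forall i : 'I_n, A i.+1 (tnth y i)].
  apply/seteqP; split => [[a t] /= h|[a t] /= [h0 h] i].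
    split; first by have := h ord0; rewrite tnth0.
    by move=> i; have := h (lift ord0 i); rewrite tnthS.
  by case: (unliftP ord0 i) => [j|] ->; rewrite ?tnthS ?tnth0//; exact: h.
transitivity ((mu \x power_measure mu n)
    (A 0%N `*` [set y | forall i : 'I_n, A i.+1 (tnth y i)])).
  by rewrite -E.
rewrite product_measure1E//; last exact: (measurable_box (fun i => mA i.+1)).
by rewrite (IH (fun i => A i.+1))// big_ord_recl.
Qed.

End box.

Section polar.
Context {R : realType} {n : nat}.
Notation E := (euclidean R n.+1).
Notation area := (@sphere_area R n.+1).
Local Open Scope ereal_scope.
Let leb := (lebesgue_euclidean (R := R) (d := n.+1)).

Lemma euclidean_norm_scalev (c : R) (x : E) :
  euclidean_norm (scalev c x) = (`|c| * euclidean_norm x)%R.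
Proof.
rewrite !euclidean_normE -sqrtr_sqr -sqrtrM ?sqr_ge0// mulr_sumr.
by congr Num.sqrt; apply: eq_bigr => i _; rewrite coord_scalev exprMn.
Qed.

Lemma measurable_norm_lt (r : R) : measurable [set x : E | (euclidean_norm x < r)%R].
Proof. by apply: measurable_euclidean_dist_lt => //; exact: measurable_cst. Qed.

Lemma euclidean_ball_origin (r : R) :
  euclidean_ball origin r = [set x : E | (euclidean_norm x < r)%R].
Proof. by []. Qed.

Lemma lebesgue_norm_lt (r : R) : (0 < r)%R ->
  leb [set x | (euclidean_norm x < r)%R] =
  (r ^+ n.+1)%:E * leb [set x | (euclidean_norm x < 1)%R].
Proof.
move=> r0; have ri : (0 < r^-1)%R by rewrite invr_gt0.
have mB b := measurable_norm_lt b.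
pose g (x : E) := (\1_[set x : E | (euclidean_norm x < 1)%R] x)%:E : \bar R.
have mg : measurable_fun [set: E] g.
  by apply/measurable_EFinP; exact: measurable_indic.
have g0 x : 0 <= g x by rewrite lee_fin.
have := (lebesgue_scalev (d := n.+1) ri).2 g mg g0.
have -> : \int[leb]_x g x = leb [set x | (euclidean_norm x < 1)%R].
  by rewrite /g (integral_indic _ measurableT)// setIT.
rewrite invrK => <-.
transitivity (\int[leb]_x (\1_[set x : E | (euclidean_norm x < r)%R] x)%:E).
  by rewrite (integral_indic _ measurableT)// setIT.
apply: eq_integral => x _; rewrite /g !indicE; congr ((nat_of_bool _)%:R%:E).
apply/idP/idP => /set_mem /= h; apply/mem_set => /=; move: h;
  by rewrite euclidean_norm_scalev gtr0_norm// mulrC ltr_pdivrMr// mul1r.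
Qed.

Let side (a : E) (b : R) (i : nat) : set R :=
  `](nth (0 : R) (tval a) i - b)%R, (nth (0 : R) (tval a) i + b)%R[%classic.

Let coord_boxE (a : E) (b : R) : [set x : E | forall i, (`|coord x i - coord a i| < b)%R] =
  [set x | forall i : 'I_n.+1, side a b i (tnth x i)].
Proof.
apply/seteqP; split => x /= h i; have := h i;
  by rewrite /side /= in_itv /= -ltr_distl /coord (tnth_nth (0%R : R) a).
Qed.

Lemma measurable_coord_box (a : E) (b : R) :
  measurable [set x : E | forall i, (`|coord x i - coord a i| < b)%R].
Proof.
rewrite coord_boxE; apply: (@measurable_box _ (measurableTypeR R)) => i.
exact: measurable_itv.
Qed.

Lemma lebesgue_box (a : E) (b : R) : (0 < b)%R ->
  leb [set x | forall i, (`|coord x i - coord a i| < b)%R] = ((b *+ 2) ^+ n.+1)%:E.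
Proof.
move=> b0; rewrite coord_boxE /leb [LHS]power_measure_box//; last by move=> i; exact: measurable_itv.
rewrite (eq_bigr (fun=> (b *+ 2)%:E)); first by rewrite prodEFin prodr_const card_ord.
move=> i _.
transitivity ((@lebesgue_measure R) (side a b i)); first by [].
rewrite /side lebesgue_measure_itv /= lte_fin ifT; last by lra.
by rewrite -EFinD; congr EFin; rewrite mulr2n; ring.
Qed.

(** The unit ball contains a cube. *)
Lemma lebesgue_ball_gt0 : 0 < leb [set x : E | (euclidean_norm x < 1)%R].
Proof.
have b0 : (0 < n.+2%:R^-1 :> R)%R by rewrite invr_gt0 ltr0n.
apply: (@lt_le_trans _ _ (((n.+2%:R^-1 *+ 2) ^+ n.+1)%:E)).
  by rewrite lte_fin exprn_gt0// mulrn_wgt0.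
rewrite -(lebesgue_box origin b0); apply: le_measure.
- rewrite inE; exact: measurable_coord_box.
- rewrite inE; exact: measurable_norm_lt.
- move=> x /= h; rewrite euclidean_normE -[ltRHS]sqrtr1 ltr_sqrt//.
  (* With coordinates below [1 / (n + 2)], the square of the norm is below [(n
     + 1) / (n + 2)]. *)
  apply: (@le_lt_trans _ _ (\sum_(i < n.+1) n.+2%:R^-1)%R).
    apply: ler_sum => i _; have := h i; rewrite coord_origin subr0 => hi.
    rewrite -real_normK ?num_real// expr2 -[leRHS]mulr1.
    apply: ler_pM => //; first exact: ltW.
    by rewrite (le_trans (ltW hi))// invf_le1 ?ltr0n// ler1n.
  rewrite sumr_const card_ord -[(_ *+ n.+1)%R]mulr_natl ltr_pdivrMr ?ltr0n// mul1r.
  by rewrite ltr_nat.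
Qed.

Lemma lebesgue_ball_ltoo : leb [set x : E | (euclidean_norm x < 1)%R] < +oo.
Proof.
apply: (@le_lt_trans _ _ (((1%R *+ 2) ^+ n.+1)%:E)); last exact: ltry.
rewrite -(lebesgue_box origin ltr01); apply: le_measure.
- rewrite inE; exact: measurable_norm_lt.
- rewrite inE; exact: measurable_coord_box.
- move=> x /= h i; rewrite (le_lt_trans _ h)//.
  exact: (coord_le_dist x origin).
Qed.

Lemma lebesgue_ballE : leb [set x : E | (euclidean_norm x < 1)%R] =
  (area / n.+1%:R)%:E.
Proof.
rewrite /sphere_area mulrC mulKf ?pnatr_eq0// euclidean_ball_origin fineK//.
by rewrite ge0_fin_numE// lebesgue_ball_ltoo.
Qed.

Lemma sphere_area_gt0 : (0 < area)%R.
Proof.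
have := lebesgue_ball_gt0; rewrite lebesgue_ballE lte_fin.
by rewrite pmulr_lgt0// invr_gt0 ltr0n.
Qed.

(** The density of the norm under Lebesgue measure. *)
Let radial (r : R) : R := (if 0 <= r then area * r ^+ n else 0)%R.

Let radial_ge0 r : (0 <= radial r)%R.
Proof. by rewrite /radial; case: ifP => // r0; rewrite mulr_ge0 ?exprn_ge0// ltW// sphere_area_gt0. Qed.

Let measurable_radial : measurable_fun [set: R] radial.
Proof.
apply: measurable_fun_ifT => //.
  exact: measurable_fun_ler.
by apply: measurable_funM => //; exact: exprn_measurable.
Qed.

Let integral_radial (b : R) : (0 < b)%R ->
  \int[lebesgue_measure]_(r in `]-oo, b[) (radial r)%:E =
  (b ^+ n.+1 * (area / n.+1%:R))%:E.
Proof.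
move=> b0.
have -> : (`]-oo, b[ = `]-oo, 0%R[ `|` `[0%R, b[)%classic.
  apply/seteqP; split => x /=; rewrite !in_itv /= ?andbT.
    by move=> xb; have [x0|x0] := ltP x 0%R; [left|right]; rewrite /= ?xb.
  by move=> [xb|/andP[]//]; exact: lt_trans b0.
rewrite ge0_integral_setU//=; last 3 first.
- by apply/measurable_EFinP; exact: measurable_funTS.
- by move=> x _; rewrite lee_fin.
- apply/disj_setPS => x /=; rewrite !in_itv /= => -[x0 /andP[]].
  by rewrite leNgt x0.
rewrite integral0_eq ?add0e; last first.
  by move=> x; rewrite /= in_itv /= /radial ltNge => /negbTE ->.
rewrite integral_itv_bndo_bndc//; last first.
  by apply/measurable_EFinP; exact: measurable_funTS.
transitivity (\int[lebesgue_measure]_(r in `[0%R, b]) (area * r ^+ n)%:E).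
  by apply: eq_integral => x; rewrite inE /= in_itv /= /radial => /andP[->].
pose G (r : R) := (area / n.+1%:R * r ^+ n.+1)%R.
have dG (r : R) : is_derive r (1%R:R) G (area * r ^+ n)%R.
  have -> : G = (area / n.+1%:R)%R *: ((@id R : R -> R) ^+ n.+1)%R.
    by apply/funext => x; rewrite exprfctE.
  apply: is_derive_eq; rewrite /GRing.scale /= mulr1 mulrA divfK// pnatr_eq0 //.
rewrite (@continuous_FTC2 _ _ G)//.
- rewrite /G expr0n mulr0 sube0; congr EFin; exact: mulrC.
- apply: continuous_subspaceT => x; apply: cvgM; first exact: cvg_cst.
  exact: exprn_continuous.
- split.
  + by move=> x _; exact: ex_derive.
  + apply: cvg_at_right_filter; apply: differentiable_continuous.
    by apply/derivable1_diffP; exact: ex_derive.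
  + apply: cvg_at_left_filter; apply: differentiable_continuous.
    by apply/derivable1_diffP; exact: ex_derive.
- by move=> x _; rewrite derive1E; exact: derive_val.
Qed.

(** Because the volume of balls is homogeneous, the image of Lebesgue measure
    under the norm and the measure of density [radial] agree on the half-lines,
    which generate the Borel sets. *)
Lemma ge0_integral_radial (g : R -> \bar R) : measurable_fun [set: R] g ->
  (forall r, 0 <= g r) ->
  \int[leb]_x g (euclidean_norm x) =
  \int[lebesgue_measure]_(r in `[0%R, +oo[) (g r * (area * r ^+ n)%:E).
Proof.
move=> mg g0.
have mnorm : measurable_fun [set: E] (fun x => euclidean_norm x : measurableTypeR R).
  exact: measurable_norm.
have := @ge0_integral_pushforward _ _ E (measurableTypeR R) R _ mnorm leb setT g measurableT mg.
rewrite preimage_setT => <-; last by [].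
have mr : measurable_fun [set: measurableTypeR R] (EFin \o radial) by exact/measurable_EFinP.
have r0 x : 0 <= (EFin \o radial) x by rewrite lee_fin.
pose nu : {measure set (measurableTypeR R) -> \bar R} := density_measure lebesgue_measure mr r0.
transitivity (\int[nu]_r g r); last first.
  rewrite ge0_integral_density// [RHS]integral_mkcond; apply: eq_integral => r _.
  rewrite patchE; case: ifPn => rs.
    by move: rs; rewrite inE /= in_itv /= andbT /radial => ->.
  rewrite /=; suff -> : radial r = 0%R by rewrite mule0.
  rewrite /radial; case: ifPn => // r1; exfalso; move/negP: rs; apply.
  by rewrite inE /= in_itv /= r1.
apply: eq_measure_integral => A mA _.
pose m1 : {measure set (measurableTypeR R) -> \bar R} :=
  pushforward leb (fun x => euclidean_norm x : measurableTypeR R).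
have half_sp (b : R) : m1 mnorm `]-oo, b[%classic = nu `]-oo, b[%classic.
  rewrite /m1 /= /pushforward /nu /= /density.
  have -> : (fun x : E => euclidean_norm x) @^-1` `]-oo, b[%classic = [set x | (euclidean_norm x < b)%R].
    by apply/seteqP; split => x /=; rewrite in_itv.
  have [b0|b0] := ltP 0%R b.
    by rewrite lebesgue_norm_lt// lebesgue_ballE -EFinM -integral_radial.
  rewrite integral0_eq; last first.
    move=> x; rewrite /= in_itv /= /radial => xb; rewrite ifF//.
    by apply/negbTE; rewrite -ltNge (lt_le_trans xb).
  rewrite (_ : mkset _ = set0) ?measure0//.
  apply/seteqP; split => x //= xb; have := euclidean_norm_ge0 x.
  by rewrite leNgt (lt_le_trans xb).
pose g_ (i : nat) : set (measurableTypeR R) := `]-oo, i%:R[%classic.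
suff : m1 mnorm A = nu A by [].
apply: (@measure_unique _ R (measurableTypeR R) (@RGenInftyO.G R) g_) => //.
- exact: RGenInftyO.measurableE.
- move=> _ _ [x ->] [y ->]; exists (Order.min x y); apply/seteqP; split => z /=;
    rewrite !in_itv /= lt_min; [by move=> [-> ->]|by move=> /andP].
- by move=> i; exists i%:R.
- apply/seteqP; split => // x _; exists (Num.truncn `|x|).+1 => //=.
  rewrite /g_ /= in_itv /= (le_lt_trans (ler_norm x))//; exact: truncnS_gt.
- by move=> _ [b ->].
- move=> k; rewrite half_sp /nu /= /density.
  have [->|k0] := eqVneq k 0%N.
    rewrite integral0_eq ?ltry// => x; rewrite /= in_itv /= /radial => xb; rewrite ifF//.
    by apply/negbTE; rewrite -ltNge.
  by rewrite integral_radial ?ltry// ltr0n lt0n.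
Qed.

End polar.

(** * Rotations *)

Section rotation.
Context {R : realType} {n : nat}.
Notation E := (euclidean R n.+1).
Notation E' := (euclidean R n).
Implicit Types (x y : E) (v t u : E').

Lemma dotv_addv_scale v t u k :
  dotv v (addv t (scalev k u)) = dotv v t + k * dotv v u.
Proof.
rewrite /dotv mulr_sumr -big_split /=; apply: eq_bigr => i _.
by rewrite coord_addv coord_scalev; ring.
Qed.

Lemma dotv_scale v k : dotv (scalev k v) (scalev k v) = k ^+ 2 * dotv v v.
Proof.
rewrite /dotv mulr_sumr; apply: eq_bigr => i _; rewrite !coord_scalev; ring.
Qed.

Lemma dotv_scaler v t k : dotv (scalev k v) t = k * dotv v t.
Proof.
rewrite /dotv mulr_sumr; apply: eq_bigr => i _; rewrite !coord_scalev; ring.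
Qed.

(** The rotation with cosine [c] and sine [s] in the plane of the first axis
    and of the unit vector [v], as the usual product of three shears, the outer
    ones by the tangent [s / (1 + c)] of half the angle: this form shows that
    it preserves Lebesgue measure. *)
Definition rotate c s v : E -> E :=
  shear_head (s / (1 + c)) v \o shear_tail (- s) v \o shear_head (s / (1 + c)) v.

Lemma shear_head_onto k v y : exists x, shear_head k v x = y.
Proof.
exists (shear_head (- k) v y); rewrite -[y in RHS]consvK /shear_head headv_cons tailv_cons.
by congr consv; ring.
Qed.

Lemma shear_tail_onto k v y : exists x, shear_tail k v x = y.
Proof.
exists (shear_tail (- k) v y); rewrite -[y in RHS]consvK /shear_tail headv_cons tailv_cons.
by congr consv; apply: eq_coord => i; rewrite !coord_addv !coord_scalev; ring.
Qed.

Section unit_circle.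
Variables (c s : R) (v : E').
Hypotheses (cs : c ^+ 2 + s ^+ 2 = 1) (c1 : 1 + c != 0) (v1 : dotv v v = 1).

Lemma rotateE a t : rotate c s v (consv a t) =
  consv (c * a + s * dotv v t) (addv t (scalev (- s * a + (c - 1) * dotv v t) v)).
Proof.
have s2 : s ^+ 2 = (1 - c) * (1 + c) by rewrite -(subr0 (s ^+ 2)) -(subrr (c ^+ 2)); move: cs; lra.
rewrite /rotate /= /shear_head /shear_tail !(headv_cons, tailv_cons).
have sq : s / (1 + c) * s = 1 - c.
  by apply: (mulIf c1); rewrite -s2; field.
congr consv; last first.
  apply: eq_coord => i; rewrite !coord_addv !coord_scalev; congr (_ + _ * _).
  transitivity (- s * a - (s / (1 + c) * s) * dotv v t); first by ring.
  by rewrite sq; ring.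
rewrite dotv_addv_scale v1 mulr1.
transitivity (a * (1 - s / (1 + c) * s) +
   s / (1 + c) * (2 - s / (1 + c) * s) * dotv v t); first by ring.
rewrite sq; have -> : s / (1 + c) * (2 - (1 - c)) = s by field.
by ring.
Qed.

Lemma motion_rotate : motion (rotate c s v).
Proof.
split.
- rewrite -[X in scales_measure _ _ X](mulr1 1); apply: scales_measure_comp;
    last exact: lebesgue_shear_head.
  rewrite -[X in scales_measure _ _ X](mulr1 1); apply: scales_measure_comp.
    exact: lebesgue_shear_head.
  exact: lebesgue_shear_tail.
- split=> [x y|y]; last first.
    have [z <-] := shear_head_onto (s / (1 + c)) v y.
    have [w <-] := shear_tail_onto (- s) v z.
    have [x <-] := shear_head_onto (s / (1 + c)) v w.
    by exists x.
  rewrite -[x]consvK -[y]consvK !rotateE !euclidean_dist_cons.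
  move: (headv x) (headv y) (tailv x) (tailv y) => a b t u; congr Num.sqrt.
  set k := - s * a + _; set l := - s * b + _.
  have -> : \sum_(i < n) (coord (addv t (scalev k v)) i - coord (addv u (scalev l v)) i) ^+ 2 =
      \sum_(i < n) (coord t i - coord u i) ^+ 2 + 2 * (k - l) * (dotv v t - dotv v u) + (k - l) ^+ 2.
    have -> : (k - l) ^+ 2 = (k - l) ^+ 2 * dotv v v by rewrite v1 mulr1.
    rewrite /dotv -sumrB !mulr_sumr -!big_split /=.
    by apply: eq_bigr => i _; rewrite !coord_addv !coord_scalev; ring.
  have s2 : s ^+ 2 = 1 - c ^+ 2 by rewrite -cs; ring.
  rewrite /k /l.
  set p := dotv v t; set q := dotv v u.
  move: (\sum_(i < n) _) => S.
  transitivity (S + (a - b) ^+ 2 + (s ^+ 2 + c ^+ 2 - 1) * ((a - b) ^+ 2 + (p - q) ^+ 2)).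
    by ring.
  by rewrite s2; ring.
- move=> x y; rewrite -[x]consvK -[y]consvK addv_cons !rotateE addv_cons.
  have dD : dotv v (addv (tailv x) (tailv y)) = dotv v (tailv x) + dotv v (tailv y).
    by rewrite /dotv -big_split; apply: eq_bigr => i _; rewrite coord_addv mulrDr.
  rewrite dD; congr consv; first by ring.
  by apply: eq_coord => i; rewrite !(coord_addv, coord_scalev); ring.
Qed.

End unit_circle.

Lemma dotv_eq0 t : dotv t t = 0 -> t = origin.
Proof.
move=> h; apply: (@euclidean_dist_eq0 _ _ _ origin).
by apply/eqP; rewrite -[_ == 0]/(euclidean_norm t == 0) -sqrf_eq0 euclidean_norm_sq h.
Qed.

(** Every vector can be moved to the first axis: a reflection makes its first
    coordinate nonnegative, and a rotation in the plane of the first axis and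
    of the vector does the rest. *)
Lemma motion_to_axis x : exists phi, motion phi /\ phi x = consv (euclidean_norm x) origin.
Proof.
wlog x0 : x / 0 <= headv x.
  move=> wl; have [|x0] := leP 0 (headv x); first exact: wl.
  have [|phi [mphi phix]] := wl (reflect_head x).
    by rewrite /reflect_head headv_cons oppr_ge0 ltW.
  exists (phi \o reflect_head); split; first exact: motion_comp motion_reflect.
  by rewrite /= phix motion_norm//; exact: motion_reflect.
move: x0; rewrite -[x]consvK headv_cons euclidean_norm_cons.
move: (headv x) (tailv x) => a t a0.
have t0 : 0 <= dotv t t by rewrite -euclidean_norm_sq sqr_ge0.
have [/dotv_eq0 ->|tneq] := eqVneq (dotv t t) 0.
  have -> : dotv (origin : E') origin = 0.
    by rewrite /dotv big1// => i _; rewrite coord_origin mul0r.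
  by exists id; split; [exact: motion_id|rewrite addr0 sqrtr_sqr ger0_norm].
have tt : 0 < dotv t t by rewrite lt_neqAle eq_sym tneq.
set r := Num.sqrt _; set b := euclidean_norm t.
have b2 : b ^+ 2 = dotv t t by exact: euclidean_norm_sq.
have r2 : r ^+ 2 = a ^+ 2 + b ^+ 2.
  by rewrite sqr_sqrtr ?b2// addr_ge0// sqr_ge0.
have b0 : 0 < b.
  by rewrite lt_neqAle euclidean_norm_ge0 andbT eq_sym -sqrf_eq0 b2.
have r0 : 0 < r.
  by rewrite sqrtr_gt0 (lt_le_trans tt)// lerDr sqr_ge0.
have rn : r != 0 by rewrite gt_eqF.
have bn : b != 0 by rewrite gt_eqF.
have v1 : dotv (scalev b^-1 t) (scalev b^-1 t) = 1.
  by rewrite dotv_scale -b2; field.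
have cs : (a / r) ^+ 2 + (b / r) ^+ 2 = 1.
  by rewrite !expr_div_n -mulrDl -r2; field.
have c1 : 1 + a / r != 0.
  by rewrite gt_eqF// (lt_le_trans ltr01)// lerDl divr_ge0// ltW.
exists (rotate (a / r) (b / r) (scalev b^-1 t)); split; first exact: motion_rotate.
have vt : dotv (scalev b^-1 t) t = b.
  by rewrite dotv_scaler -b2; field.
rewrite (rotateE cs c1 v1) vt; congr consv.
  by apply: (mulfI rn); rewrite -expr2 r2; field.
apply: eq_coord => i; rewrite coord_addv !coord_scalev coord_origin.
by field; rewrite rn bn.
Qed.

End rotation.

(** * The integral over configurations far from the origin *)

Lemma measurable_boolr {disp} {T : measurableType disp} {R : realType} (b : T -> bool) :
  measurable_fun [set: T] b -> measurable_fun [set: T] (fun x => (b x)%:R : R).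
Proof.
move=> mb; apply: (eq_measurable_fun (fun x => if b x then 1 else 0 : R)).
  by move=> x _; case: (b x).
by apply: measurable_fun_ifT.
Qed.

Lemma measurable_prod_ord {disp} {T : measurableType disp} {R : realType} n
    (f : 'I_n -> T -> R) :
  (forall i, measurable_fun [set: T] (f i)) ->
  measurable_fun [set: T] (fun x => \prod_(i < n) f i x).
Proof. by move=> mf; apply: measurable_prod => i _; exact: mf. Qed.

Section weight.
Context {R : realType} {d : nat}.
Notation E := (euclidean R d).

(** Up to the factor [c_e], the density [f_e] outside the ball of radius [r]. *)
Definition weight (r : R) (x : E) : R := expR (- euclidean_norm x) * (r <= euclidean_norm x)%R%:R.

Lemma weight_ge0 r x : 0 <= weight r x.
Proof. by rewrite /weight mulr_ge0// expR_ge0. Qed.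

Lemma measurable_weight disp (T : measurableType disp) (f : T -> R) (g : T -> E) :
  measurable_fun [set: T] f -> measurable_fun [set: T] g ->
  measurable_fun [set: T] (fun w => weight (f w) (g w)).
Proof.
move=> mf mg; have mn := measurable_euclidean_norm mg.
apply: measurable_funM.
  apply: measurableT_comp; first exact: measurable_expR.
  exact: measurable_funN.
by apply: measurable_boolr; apply: measurable_fun_ler.
Qed.

End weight.

Section tail.
Context {R : realType} {n q : nat}.
Notation E := (euclidean R n.+1).
Notation area := (@sphere_area R n.+1).
Notation EqR := (q.-tuple E * measurableTypeR R)%type.
Let leb := (lebesgue_euclidean (R := R) (d := n.+1)).
Let pow := (power_measure (lebesgue_euclidean (R := R) (d := n.+1))).

Variable H : set (q.+1.-tuple E).
Hypothesis mH : measurable H.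
Hypothesis invH : forall phi : E -> E, isometry_onto phi ->
  forall z : q.+1.-tuple E, H [tuple of map phi z] <-> H z.

(** Up to the factor [c_e ^+ q.+1], the probability that [q.+1] independent
    samples lie outside the ball of radius [r] and in a configuration of [H]. *)
Definition tail_integral (r : R) : \bar R :=
  (\int[pow q.+1]_z (\1_H z * \prod_(i < q.+1) weight r (tnth z i))%:E)%E.

(** The part of [tail_integral] with the first point at [x]; the other points
    are taken relatively to it. *)
Definition fiber (r : R) (x : E) : \bar R :=
  (\int[pow q]_y (\1_H [tuple of origin :: y] *
     \prod_(i < q) weight r (addv (tnth y i) x))%:E)%E.

Definition axis (t : R) : E := consv t origin.

Lemma indic_isometry phi (z : q.+1.-tuple E) : isometry_onto phi ->
  \1_H [tuple of map phi z] = \1_H z :> R.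
Proof.
move=> /invH/(_ z) h; rewrite !indicE; congr ((nat_of_bool _)%:R).
by apply/idP/idP => /set_mem /h /mem_set.
Qed.

Lemma indic_isometry_cons phi x (y : q.-tuple E) : isometry_onto phi ->
  \1_H [tuple of phi x :: [tuple phi (tnth y i) | i < q]] =
  \1_H [tuple of x :: y] :> R.
Proof.
move=> h; rewrite -(indic_isometry [tuple of x :: y] h); congr (\1_H _).
apply: eq_from_tnth => i; rewrite tnth_map.
by case: (unliftP ord0 i) => [j|] ->; rewrite ?tnthS ?tnth0// tnth_mktuple.
Qed.

Lemma isometry_addv (a : E) : isometry_onto (addv^~ a).
Proof.
split=> [x y|y]; first exact: euclidean_dist_addv.
exists (addv y (oppv a)); apply: eq_coord => i.
by rewrite !coord_addv coord_vec; ring.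
Qed.

Lemma addv0 (x : E) : addv origin x = x.
Proof. by apply: eq_coord => i; rewrite coord_addv coord_origin add0r. Qed.

Lemma measurable_indic_comp disp (T : measurableType disp) (f : T -> q.+1.-tuple E) :
  measurable_fun [set: T] f -> measurable_fun [set: T] (fun w => \1_H (f w) : R).
Proof. by move=> mf; apply: measurableT_comp mf; exact: measurable_indic. Qed.

Lemma measurable_fiber_fun disp (T : measurableType disp) (f : T -> R)
    (g : T -> q.-tuple E) (k : T -> E) :
  measurable_fun [set: T] f -> measurable_fun [set: T] g -> measurable_fun [set: T] k ->
  measurable_fun [set: T] (fun w => (\1_H [tuple of origin :: g w] *
     \prod_(i < q) weight (f w) (addv (tnth (g w) i) (k w)))%:E).
Proof.
move=> mf mg mk; apply/measurable_EFinP; apply: measurable_funM.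
  by apply: measurable_indic_comp; exact: (@measurable_cons _ _ _ E).
apply: measurable_prod_ord => i; apply: measurable_weight => //.
apply: measurable_addv => //.
exact: (measurableT_comp (@measurable_tnth _ E q i) mg).
Qed.

Lemma fiber_fun_ge0 r (y : q.-tuple E) x :
  0 <= \1_H [tuple of origin :: y] * \prod_(i < q) weight r (addv (tnth y i) x) :> R.
Proof. by rewrite mulr_ge0//; apply: prodr_ge0 => i _; exact: weight_ge0. Qed.

Lemma fiber_ge0 r x : (0 <= fiber r x)%E.
Proof. by apply: integral_ge0 => y _; rewrite lee_fin fiber_fun_ge0. Qed.

Lemma measurable_fiber disp (T : measurableType disp) r (k : T -> E) :
  measurable_fun [set: T] k ->
  measurable_fun [set: T] (fun w => fiber r (k w)).
Proof.
move=> mk; apply: (measurable_fun_fubini_tonelli_F (m2 := pow q)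
  (fun p : T * q.-tuple E => (\1_H [tuple of origin :: p.2] *
     \prod_(i < q) weight r (addv (tnth p.2 i) (k p.1)))%:E)).
  apply: measurable_fiber_fun => //.
  exact: measurableT_comp mk measurable_fst.
by move=> p; rewrite lee_fin fiber_fun_ge0.
Qed.

(** By invariance, the first point of a configuration can be translated to the
    origin. *)
Lemma tail_fiber r :
  tail_integral r = (\int[leb]_x ((weight r x)%:E * fiber r x))%E.
Proof.
have mF : measurable_fun [set: q.+1.-tuple E]
    (fun z => (\1_H z * \prod_(i < q.+1) weight r (tnth z i))%:E).
  apply/measurable_EFinP; apply: measurable_funM; first exact: measurable_indic.
  apply: measurable_prod_ord => i; apply: measurable_weight => //.
  exact: measurable_tnth.
have F0 z : (0 <= (\1_H z * \prod_(i < q.+1) weight r (tnth z i))%:E)%E.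
  by rewrite lee_fin mulr_ge0//; apply: prodr_ge0 => i _; exact: weight_ge0.
rewrite /tail_integral [LHS]ge0_integral_powerS//; apply: eq_integral => x _.
have [_ hs] := @scales_power _ _ R leb 1 q (fun _ => addv^~ x) ler01 (fun=> lebesgue_addv x).
rewrite -[LHS]mul1e -[X in (X%:E * _)%E](expr1n _ q) -hs; last 2 first.
- exact: measurable_fun_pair2 (measurable_cons2 mF).
- by move=> y; exact: F0.
rewrite -ge0_integralZl_EFin ?weight_ge0//; last 2 first.
- by move=> y _; rewrite lee_fin fiber_fun_ge0.
- by apply: measurable_fiber_fun => //; exact: measurable_id.
apply: eq_integral => y _; rewrite -EFinM; congr EFin.
rewrite big_ord_recl tnth0 mulrCA; congr (_ * (_ * _)).
  by have := indic_isometry_cons origin y (isometry_addv x); rewrite addv0.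
by apply: eq_bigr => i _; rewrite tnthS tnth_mktuple.
Qed.

Lemma weight_motion (phi : E -> E) r x : motion phi -> weight r (phi x) = weight r x.
Proof. by move=> m; rewrite /weight motion_norm. Qed.

(** The configurations can be rotated about their first point. *)
Lemma fiber_motion (phi : E -> E) r x : motion phi -> fiber r (phi x) = fiber r x.
Proof.
move=> mphi; have [sphi iphi aphi] := mphi.
have [_ hs] := @scales_power _ _ R leb 1 q (fun _ => phi) ler01 (fun=> sphi).
rewrite /fiber -[LHS]mul1e -[X in (X%:E * _)%E](expr1n _ q) -hs; last 2 first.
- by apply: measurable_fiber_fun => //; exact: measurable_id.
- by move=> y; rewrite lee_fin fiber_fun_ge0.
apply: eq_integral => y _; congr ((_ * _)%:E).
  rewrite -(indic_isometry_cons origin y iphi); congr (\1_H _).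
  apply: val_inj => /=; congr (_ :: _).
  have : euclidean_norm (phi origin) = 0.
    by rewrite motion_norm// /euclidean_norm euclidean_distxx.
  by move=> /euclidean_dist_eq0 ->.
by apply: eq_bigr => i _; rewrite tnth_mktuple -aphi weight_motion.
Qed.

Lemma fiber_axis r x : fiber r x = fiber r (axis (euclidean_norm x)).
Proof.
have [phi [mphi phix]] := motion_to_axis x.
by rewrite -(fiber_motion r x mphi) phix.
Qed.

Lemma measurable_axis : measurable_fun [set: R] axis.
Proof.
apply: (@measurable_consv _ _ _ R id (fun=> origin)); first exact: measurable_id.
exact: measurable_cst.
Qed.

(** Polar coordinates for the first point; [rho] is the excess of its norm over
    [r]. *)
Lemma tail_polar r : 0 <= r ->
  tail_integral r =
  (\int[lebesgue_measure]_(rho in `[0%R, +oo[)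
     ((area * (r + rho) ^+ n * expR (- (r + rho)))%:E *
      fiber r (axis (r + rho))))%E.
Proof.
move=> r0; rewrite tail_fiber.
pose g (t : R) := ((expR (- t) * (r <= t)%R%:R)%:E * fiber r (axis t))%E.
have mg : measurable_fun [set: R] g.
  apply: emeasurable_funM; last exact: (measurable_fiber _ measurable_axis).
  apply/measurable_EFinP; apply: measurable_funM.
    by apply: measurableT_comp; [exact: measurable_expR|exact: oppr_measurable].
  by apply: measurable_boolr; exact: measurable_fun_ler.
have g0 t : (0 <= g t)%E.
  by rewrite /g mule_ge0 ?fiber_ge0// lee_fin mulr_ge0 ?expR_ge0.
transitivity (\int[leb]_x g (euclidean_norm x))%E.
  by apply: eq_integral => x _; rewrite /g /weight -fiber_axis.
rewrite ge0_integral_radial// integral_mkcond [RHS]integral_mkcond.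
have [_ hs] := lebesgue_shift r.
rewrite -[LHS]mul1e -hs.
- apply: eq_integral => rho _; rewrite !patchE /= addrC.
  have -> : (r + rho \in `[0%R, +oo[%classic) = (0 <= r + rho) by rewrite mem_setE in_itv /= andbT.
  have -> : (rho \in `[0%R, +oo[%classic) = (0 <= rho) by rewrite mem_setE in_itv /= andbT.
  have [rho0|rho0] := leP 0 rho.
    rewrite addr_ge0// /g lerDl rho0 mulr1 muleAC -EFinM; congr (_%:E * _)%E; ring.
  by case: ifP => // _; rewrite /g lerDl leNgt rho0 /= mulr0 !mul0e.
- apply: (measurable_restrictT _ _).1 => //.
  apply: measurable_funTS; apply: emeasurable_funM => //.
  apply/measurable_EFinP; apply: measurable_funM => //; exact: exprn_measurable.
- apply: erestrict_ge0 => x; rewrite /= in_itv /= andbT => x0.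
  by rewrite mule_ge0// lee_fin mulr_ge0 ?exprn_ge0// ltW// sphere_area_gt0.
Qed.

(** The limit of [scaled_fun] as [r] tends to infinity. Seen from a far point
    on the first axis, the norm grows like the first coordinate, and the sphere
    that bounds the forbidden ball looks like a hyperplane at distance [p.2]. *)
Definition limit_fun (p : q.-tuple E * R) : R :=
  (0 <= p.2)%R%:R * \1_H [tuple of origin :: p.1] *
  (expR (- (q.+1%:R * p.2 + \sum_(i < q) first_coord (tnth p.1 i))) *
   \prod_(i < q) (- p.2 < first_coord (tnth p.1 i))%R%:R).

(** The integrand of [tail_polar] divided by [r ^+ n * expR (- (q.+1%:R * r))],
    the order of magnitude of [tail_integral r]. *)
Definition scaled_fun (r : R) (p : q.-tuple E * R) : R :=
  (0 <= p.2)%R%:R * \1_H [tuple of origin :: p.1] *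
  ((1 + p.2 / r) ^+ n * expR (- (q.+1%:R * p.2)) *
   \prod_(i < q) (expR (r + p.2) * weight r (addv (tnth p.1 i) (axis (r + p.2))))).

Lemma scaled_fun_ge0 r p : 0 < r -> 0 <= scaled_fun r p.
Proof.
move=> r0; rewrite /scaled_fun; have [p0|p0] := leP 0 p.2; last by rewrite !mul0r.
rewrite mul1r mulr_ge0// mulr_ge0//.
  by rewrite mulr_ge0 ?expR_ge0// exprn_ge0// addr_ge0// divr_ge0// ltW.
by apply: prodr_ge0 => i _; rewrite mulr_ge0 ?expR_ge0 ?weight_ge0.
Qed.

Lemma limit_fun_ge0 p : 0 <= limit_fun p.
Proof.
rewrite /limit_fun mulr_ge0// mulr_ge0 ?expR_ge0//.
by apply: prodr_ge0 => i _.
Qed.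

Lemma measurable_axis_comp disp (T : measurableType disp) (f : T -> R) :
  measurable_fun [set: T] f -> measurable_fun [set: T] (fun w => axis (f w)).
Proof. by move=> mf; exact: measurableT_comp measurable_axis mf. Qed.

Lemma measurable_origin_cons :
  measurable_fun [set: EqR]
    (fun p => \1_H [tuple of origin :: p.1] : R).
Proof. by apply: measurable_indic_comp; exact: (@measurable_cons _ _ _ E). Qed.

Lemma measurable_scaled_fun r :
  measurable_fun [set: EqR] (scaled_fun r).
Proof.
have m2 : measurable_fun [set: EqR] snd by exact: measurable_snd.
apply: measurable_funM.
  apply: measurable_funM; last exact: measurable_origin_cons.
  by apply: measurable_boolr; apply: measurable_fun_ler.
apply: measurable_funM.
  apply: measurable_funM.
    apply: measurable_funX; apply: measurable_funD => //.
    exact: measurable_funM.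
  apply: measurableT_comp; first exact: measurable_expR.
  by apply: measurable_funN; apply: measurable_funM.
have mr : measurable_fun [set: EqR] (fun p => r + p.2).
  exact: measurable_funD.
apply: measurable_prod_ord => i; apply: measurable_funM.
  by apply: measurableT_comp; first exact: measurable_expR.
apply: measurable_weight => //; apply: measurable_addv.
  exact: (measurableT_comp (@measurable_tnth _ E q i) measurable_fst).
exact: measurable_axis_comp.
Qed.

Lemma measurable_first_coord disp (T : measurableType disp) (f : T -> E) :
  measurable_fun [set: T] f -> measurable_fun [set: T] (fun w => first_coord (f w)).
Proof.
move=> mf; apply: (eq_measurable_fun (headv \o f)).
  by move=> w _; rewrite first_coordE.
by apply: measurableT_comp mf; exact: measurable_headv.
Qed.

Lemma measurable_limit_fun :
  measurable_fun [set: EqR] limit_fun.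
Proof.
have m2 : measurable_fun [set: EqR] snd by exact: measurable_snd.
have mt i : measurable_fun [set: EqR] (fun p => first_coord (tnth p.1 i)).
  apply: measurable_first_coord.
  exact: (measurableT_comp (@measurable_tnth _ E q i) measurable_fst).
apply: measurable_funM.
  apply: measurable_funM; last exact: measurable_origin_cons.
  by apply: measurable_boolr; apply: measurable_fun_ler.
apply: measurable_funM.
  apply: measurableT_comp; first exact: measurable_expR.
  apply: measurable_funN; apply: measurable_funD; first exact: measurable_funM.
  exact: measurable_sum.
apply: measurable_prod_ord => i; apply: measurable_boolr; apply: measurable_fun_ltr => //.
exact: measurable_funN.
Qed.

Lemma tail_scaled r : 0 < r ->
  (tail_integral r =
   (area * (r ^+ n * expR (- (q.+1%:R * r))))%:E *
   \int[pow q \x lebesgue_measure]_p (scaled_fun r p)%:E)%E.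
Proof.
move=> r0; have s0 : 0 <= area by rewrite ltW// sphere_area_gt0.
have k0 : 0 <= area * (r ^+ n * expR (- (q.+1%:R * r))).
  by rewrite mulr_ge0// mulr_ge0 ?expR_ge0// exprn_ge0// ltW.
have mS : measurable_fun [set: EqR] (EFin \o scaled_fun r).
  by apply/measurable_EFinP; exact: measurable_scaled_fun.
have S0 p : (0 <= (EFin \o scaled_fun r) p)%E by rewrite lee_fin scaled_fun_ge0.
rewrite tail_polar; last exact: ltW.
have -> : (\int[pow q \x lebesgue_measure]_p (scaled_fun r p)%:E =
    \int[lebesgue_measure]_rho \int[pow q]_y (scaled_fun r (y, rho))%:E)%E.
  exact: (fubini_tonelli2 (m1 := pow q) (m2 := @lebesgue_measure R) _ mS S0).
rewrite -ge0_integralZl_EFin//; last 2 first.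
- by move=> rho _; apply: integral_ge0 => y _; rewrite lee_fin scaled_fun_ge0.
- exact: (measurable_fun_fubini_tonelli_G (m1 := pow q) _ mS S0).
rewrite [LHS]integral_mkcond; apply: eq_integral => rho _; rewrite patchE.
rewrite mem_setE in_itv /= andbT; case: ifPn => rho0; last first.
  rewrite integral0_eq ?mule0// => y _; rewrite /scaled_fun /= (negbTE rho0).
  by rewrite !mul0r.
have c0 : 0 <= area * (r + rho) ^+ n * expR (- (r + rho)).
  by rewrite mulr_ge0 ?expR_ge0// mulr_ge0// exprn_ge0// addr_ge0// ltW.
rewrite /fiber -ge0_integralZl_EFin//; last 2 first.
- by move=> y _; rewrite lee_fin fiber_fun_ge0.
- by apply: measurable_fiber_fun => //; exact: measurable_id.
rewrite -ge0_integralZl_EFin//; last 2 first.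
- by move=> y _; rewrite lee_fin scaled_fun_ge0.
- by apply: (measurable_fun_pair1 (f := EFin \o scaled_fun r)).
apply: eq_integral => y _; rewrite /= -!EFinM; congr EFin.
rewrite /scaled_fun /= rho0 mul1r [in RHS]big_split /= prodr_const card_ord.
set P := \prod_(i < q) _; set h := \1_H _.
have -> : expR (r + rho) ^+ q = expR (q%:R * (r + rho)) by rewrite -expRM_natl.
have -> : (r + rho) ^+ n = r ^+ n * (1 + rho / r) ^+ n.
  by rewrite -exprMn mulrDr mulr1 mulrCA divff ?mulr1// gt_eqF.
have -> : expR (- (r + rho)) = expR (- (q.+1%:R * r)) * expR (- (q.+1%:R * rho)) * expR (q%:R * (r + rho)).
  by rewrite -!expRD; congr expR; rewrite -natr1; ring.
by ring.
Qed.

End tail.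

(** * Convergence of the rescaled integral *)

Lemma cvg_prod_ord {R : realType} q (f : 'I_q -> nat -> R) (l : 'I_q -> R) :
  (forall i, f i @ \oo --> l i) ->
  (fun k => \prod_(i < q) f i k) @ \oo --> \prod_(i < q) l i.
Proof.
move=> h; elim: (index_enum _) => [|i s IH].
  by under eq_fun do rewrite big_nil; rewrite big_nil; exact: cvg_cst.
under eq_fun do rewrite big_cons; rewrite big_cons; exact: cvgM.
Qed.

Section norm_axis.
Context {R : realType} {n : nat}.
Notation E := (euclidean R n.+1).
Implicit Types (y : E).

Lemma norm_addv_axis y (t : R) : euclidean_norm (addv y (axis t)) =
  Num.sqrt ((first_coord y + t) ^+ 2 + dotv (tailv y) (tailv y)).
Proof.
rewrite -[y in LHS]consvK first_coordE addv_cons euclidean_norm_cons.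
congr (Num.sqrt (_ + dotv _ _)); apply: eq_coord => i;
  by rewrite coord_addv coord_origin addr0.
Qed.

Lemma norm_axis (t : R) : 0 <= t -> euclidean_norm (axis t : E) = t.
Proof.
move=> t0; rewrite euclidean_norm_cons /dotv big1; last first.
  by move=> i _; rewrite coord_origin mul0r.
by rewrite addr0 sqrtr_sqr ger0_norm.
Qed.

Lemma le_norm_addv_axis y (t : R) : 0 <= t ->
  t - euclidean_norm (addv y (axis t)) <= euclidean_norm y.
Proof.
move=> t0; rewrite lerBlDr -[leLHS](norm_axis t0) addrC.
apply: le_trans (euclidean_norm_triangle _ (addv y (axis t))) _.
rewrite lerD2l euclidean_distC.
by rewrite -[X in euclidean_dist _ X]addv0 euclidean_dist_addv.
Qed.

Lemma norm_addv_axis_bounds y (t : R) : 0 < first_coord y + t ->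
  first_coord y + t <= euclidean_norm (addv y (axis t)) <=
  first_coord y + t + dotv (tailv y) (tailv y) / (first_coord y + t).
Proof.
move=> u0; rewrite norm_addv_axis; set u := first_coord y + t in u0 *.
have p0 : 0 <= dotv (tailv y) (tailv y) by rewrite -euclidean_norm_sq sqr_ge0.
set p := dotv _ _ in p0 *.
have pu : 0 <= p / u by rewrite divr_ge0// ltW.
apply/andP; split.
  by rewrite -[leLHS](ger0_norm (ltW u0)) -sqrtr_sqr ler_wsqrtr// lerDl.
have v0 : 0 <= u + p / u by rewrite addr_ge0// ltW.
rewrite -[leRHS](ger0_norm v0) -sqrtr_sqr ler_wsqrtr//.
have -> : (u + p / u) ^+ 2 = u ^+ 2 + p + (p + (p / u) ^+ 2).
  by field; rewrite gt_eqF.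
by rewrite lerDl addr_ge0// sqr_ge0.
Qed.

Lemma cvg_norm_addv_axis y (t_ : nat -> R) : t_ @ \oo --> +oo ->
  (fun k => euclidean_norm (addv y (axis (t_ k))) - t_ k) @ \oo --> first_coord y.
Proof.
move=> t_oo; set a := first_coord y; set p := dotv (tailv y) (tailv y).
have pos : \forall k \near \oo, 0 < a + t_ k.
  near=> k; have : - a < t_ k by near: k; move/cvgryPgt : t_oo; exact.
  lra.
apply: (@squeeze_cvgr _ _ _ _ (cst a) (fun k => a + p / (a + t_ k))).
- near=> k; have u0 : 0 < a + t_ k by near: k.
  have /andP[h1 h2] := norm_addv_axis_bounds u0.
  by rewrite /= lerBrDr h1 lerBlDr (le_trans h2)// /a /p addrAC.
- exact: cvg_cst.
- rewrite -[X in _ --> X]addr0; apply: cvgD; first exact: cvg_cst.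
  rewrite -[X in _ --> X](mulr0 p); apply: cvgM; first exact: cvg_cst.
  apply: (gtr0_cvgV0 (f := fun k => a + t_ k) pos).2.
  apply/cvgryPge => A; near=> k.
  have : A - a <= t_ k by near: k; move/cvgryPge : t_oo; exact.
  lra.
Unshelve. all: by end_near. Qed.

(** Where [first_coord y = - rho] the limiting indicator jumps, so that these
    points are left out. *)
Lemma cvg_scaled_weight y (rho : R) (r_ : nat -> R) : r_ @ \oo --> +oo ->
  first_coord y != - rho ->
  (fun k => expR (r_ k + rho) * weight (r_ k) (addv y (axis (r_ k + rho)))) @ \oo -->
  expR (- first_coord y) * (- rho < first_coord y)%R%:R.
Proof.
move=> r_oo y_rho.
have t_oo : (fun k => r_ k + rho) @ \oo --> +oo.
  apply/cvgryPge => A; near=> k.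
  have : A - rho <= r_ k by near: k; move/cvgryPge : r_oo; exact.
  lra.
have := cvg_norm_addv_axis (y := y) t_oo; set N := fun k => _ => cN.
have -> : (fun k => expR (r_ k + rho) * weight (r_ k) (addv y (axis (r_ k + rho)))) =
   (fun k => expR (- N k) * (- rho <= N k)%R%:R).
  apply/funext => k; rewrite /weight mulrA -expRD /N.
  congr (expR _ * _%:R); first by ring.
  by rewrite [in RHS]lerBrDr [- rho + _]addrC addrK.
apply: cvgM.
  apply: (@cvg_comp _ _ _ (fun k => - N k) expR); first exact: cvgN cN.
  exact: continuous_expR.
have [lt|ge] := ltP (- rho) (first_coord y).
  apply: cvg_near_cst; near=> k; suff -> : - rho <= N k by [].
  apply: ltW; near: k; move: cN => /cvgr_gt; exact.
have {}lt : first_coord y < - rho by rewrite lt_neqAle y_rho.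
apply: cvg_near_cst; near=> k; rewrite leNgt; suff -> : N k < - rho by [].
near: k; move: cN => /cvgr_lt; exact.
Unshelve. all: by end_near. Qed.

End norm_axis.

Section dominated.
Context {R : realType} {n q : nat}.
Notation E := (euclidean R n.+1).
Notation EqR := (q.-tuple E * measurableTypeR R)%type.
Let pow := (power_measure (lebesgue_euclidean (R := R) (d := n.+1))).
Let mu := @lebesgue_measure R.

Definition half_expR (rho : R) : R := (0 <= rho)%R%:R * expR (- (rho / 2)).

Lemma half_expR_ge0 rho : 0 <= half_expR rho.
Proof. by rewrite mulr_ge0 ?expR_ge0. Qed.

Lemma measurable_half_expR : measurable_fun [set: R] half_expR.
Proof.
apply: measurable_funM; first by apply: measurable_boolr; exact: measurable_fun_ler.
apply: measurableT_comp; first exact: measurable_expR.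
by apply: measurable_funN; exact: measurable_funM.
Qed.

Lemma integralZl_half_expR (c : R) : 0 <= c ->
  (\int[mu]_rho (c%:E * (half_expR rho)%:E) = c%:E * \int[mu]_rho (half_expR rho)%:E)%E.
Proof.
move=> c0; apply: ge0_integralZl_EFin => //.
- by move=> rho _; rewrite lee_fin half_expR_ge0.
- by apply/measurable_EFinP; exact: measurable_half_expR.
Qed.

Lemma integral_half_expR_lty : (\int[mu]_rho (half_expR rho)%:E < +oo)%E.
Proof.
have h0 : (0 : R) < 2^-1 by rewrite invr_gt0.
have : (\int[mu]_rho ((2^-1)%:E * (half_expR rho)%:E) = 1)%E.
  rewrite -[RHS](integral_exponential_pdf h0); apply: eq_integral => rho _.
  rewrite /exponential_pdf patchE mem_setE in_itv /= andbT /half_expR.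
  case: ifPn => rho0; last by rewrite mul0r mule0.
  by rewrite mul1r -EFinM mulNr [_ / 2]mulrC.
rewrite integralZl_half_expR ?ltW// => h.
by rewrite ltey; apply/eqP => oo; move: h; rewrite [X in (_ * X)%E]oo gt0_muley// lte_fin.
Qed.

(** As [1 + rho <= N * expR (rho / N)] for [N = 2 (n + 1)], the polynomial
    factor costs less than half of the exponential one. *)
Lemma expR_half_bound (rho : R) : 0 <= rho ->
  (1 + rho) ^+ n * expR (- rho) <= n.+1.*2%:R ^+ n * expR (- (rho / 2)).
Proof.
move=> rho0; set N : R := n.+1.*2%:R.
have N2 : 2 <= N by rewrite /N ler_nat doubleS.
have N0 : 0 < N by lra.
have h : 1 + rho <= N * expR (rho / N).
  apply: (@le_trans _ _ (N * (1 + rho / N))).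
    by rewrite mulrDr mulr1 mulrCA divff ?gt_eqF// mulr1 lerD2r; lra.
  by rewrite ler_pM2l// expR_ge1Dx.
apply: (@le_trans _ _ ((N * expR (rho / N)) ^+ n * expR (- rho))).
  rewrite ler_pM2r ?expR_gt0//; apply: lerXn2r => //; rewrite nnegrE.
    by rewrite addr_ge0.
  by rewrite mulr_ge0 ?expR_ge0// ltW.
rewrite exprMn -mulrA ler_pM2l ?exprn_gt0//.
rewrite -expRM_natl -expRD ler_expR.
have : n%:R * (rho / N) <= rho / 2.
  rewrite mulrCA ler_wpM2l// ler_pdivrMr// /N -muln2 natrM mulrCA mulVf ?pnatr_eq0//.
  by rewrite mulr1 ler_nat.
lra.
Qed.

Variable H : set (q.+1.-tuple E).
Hypothesis mH : measurable H.
Variable D : R.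
Hypothesis bddH : forall z : q.+1.-tuple E, H z ->
  forall i, euclidean_dist (tnth z i) (thead z) < D.

Definition near_origin : set (q.-tuple E) :=
  [set y | forall i : 'I_q, euclidean_norm (tnth y i) < D].

Lemma measurable_near_origin : measurable near_origin.
Proof. exact: (@measurable_box _ E q (fun=> [set x | euclidean_norm x < D]) (fun=> measurable_norm_lt D)). Qed.

Lemma near_originP (y : q.-tuple E) : H [tuple of origin :: y] -> near_origin y.
Proof.
by move=> /bddH h i; have := h (lift ord0 i); rewrite tnthS theadE.
Qed.

(** The points of a configuration of [H] are within [D] of the first one, so
    that each factor of the product is at most [expR D]; the rest is
    [expR_half_bound]. *)
Definition dominator (p : q.-tuple E * R) : R :=
  n.+1.*2%:R ^+ n * expR D ^+ q *
  (\1_near_origin p.1 * half_expR p.2).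

Lemma measurable_dominator :
  measurable_fun [set: EqR] dominator.
Proof.
have m2 : measurable_fun [set: EqR] snd by exact: measurable_snd.
apply: measurable_funM; first exact: measurable_cst.
apply: measurable_funM.
  have mi : measurable_fun [set: q.-tuple E] (\1_near_origin : _ -> R).
    by apply: measurable_indic; exact: measurable_near_origin.
  exact: measurableT_comp mi measurable_fst.
exact: measurableT_comp measurable_half_expR m2.
Qed.

Lemma dominator_ge0 p : 0 <= dominator p.
Proof. by rewrite /dominator !mulr_ge0 ?exprn_ge0 ?expR_ge0 ?half_expR_ge0. Qed.

Lemma lebesgue_norm_lt_fin :
  exists v : R, lebesgue_euclidean [set x : E | euclidean_norm x < D] = v%:E.
Proof.
have [D0|D0] := ltP 0 D.
  by rewrite lebesgue_norm_lt// lebesgue_ballE -EFinM; eexists.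
exists 0; rewrite (_ : mkset _ = set0) ?measure0//.
apply/seteqP; split => x //= xD; have := euclidean_norm_ge0 x.
by rewrite leNgt (lt_le_trans xD).
Qed.

Lemma near_origin_fin : exists v : R, pow q near_origin = v%:E.
Proof.
have [v hv] := lebesgue_norm_lt_fin; exists (v ^+ q).
rewrite /pow [LHS](@power_measure_box _ E R _ q (fun=> [set x | euclidean_norm x < D]))//; last first.
  by move=> _; exact: measurable_norm_lt.
rewrite (eq_bigr (fun=> v%:E)); first by rewrite prodEFin prodr_const card_ord.
by move=> i _; exact: hv.
Qed.

Lemma integrable_dominator :
  (pow q \x mu)%E.-integrable [set: EqR] (EFin \o dominator).
Proof.
have md : measurable_fun [set: EqR] (EFin \o dominator).
  by apply/measurable_EFinP; exact: measurable_dominator.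
apply/integrableP; split => //.
apply: (@le_lt_trans _ _ (\int[pow q \x mu]_p (dominator p)%:E)%E).
  rewrite le_eqVlt; apply/orP; left; apply/eqP; apply: eq_integral => p _.
  by rewrite /= ger0_norm// dominator_ge0.
have d0 p : (0 <= (EFin \o dominator) p)%E by rewrite lee_fin dominator_ge0.
have -> : (\int[pow q \x mu]_p (dominator p)%:E =
    \int[pow q]_y \int[mu]_rho (dominator (y, rho))%:E)%E.
  exact: (fubini_tonelli1 (m1 := pow q) (m2 := @lebesgue_measure R) _ md d0).
have [v hv] := near_origin_fin.
have := integral_half_expR_lty; set I := (\int[mu]_rho _)%E => Ioo.
have I0 : (0 <= I)%E by apply: integral_ge0 => x _; rewrite lee_fin half_expR_ge0.
set K := n.+1.*2%:R ^+ n * expR D ^+ q.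
have K0 : 0 <= K by rewrite mulr_ge0 ?exprn_ge0 ?expR_ge0.
have -> : (\int[pow q]_y \int[mu]_rho (dominator (y, rho))%:E =
    \int[pow q]_y ((K%:E * I) * (\1_near_origin y)%:E))%E.
  apply: eq_integral => y _; rewrite muleAC -EFinM.
  rewrite -integralZl_half_expR ?mulr_ge0//.
  by apply: eq_integral => rho _; rewrite /dominator /= -EFinM mulrA.
have mN := measurable_near_origin.
rewrite ge0_integralZl//.
- apply: lte_mul_pinfty.
  + by rewrite mule_ge0.
  + by rewrite ge0_fin_numE ?mule_ge0// lte_mul_pinfty.
  + by apply: (@le_lt_trans _ _ v%:E); [rewrite -hv integral_indic// setIT|exact: ltry].
- by apply/measurable_EFinP; exact: measurable_indic.
- by rewrite mule_ge0.
Qed.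

Lemma scaled_le_dominator r p : 1 <= r -> scaled_fun H r p <= dominator p.
Proof.
case: p => y rho r1; rewrite /scaled_fun /dominator /half_expR /=.
have r0 : 0 < r by lra.
have [rho0|rho0] := leP 0 rho; last by rewrite !(mul0r, mulr0).
rewrite !mul1r [\1_H _]indicE; have [Hy|_] := boolP (_ \in H); last first.
  by rewrite mul0r mulr_ge0 ?mulr_ge0 ?exprn_ge0 ?expR_ge0.
have yD : near_origin y by apply: near_originP; exact: set_mem Hy.
rewrite mul1r indicE mem_set// mul1r.
have hP : \prod_(i < q) (expR (r + rho) * weight r (addv (tnth y i) (axis (r + rho)))) <= expR D ^+ q.
  rewrite -[q in leRHS]card_ord -prodr_const; apply: ler_prod => i _.
  rewrite mulr_ge0 ?expR_ge0 ?weight_ge0//= /weight mulrA -expRD.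
  apply: (@le_trans _ _ (expR (r + rho - euclidean_norm (addv (tnth y i) (axis (r + rho)))) * 1)).
    by rewrite ler_pM2l ?expR_gt0// lern1 leq_b1.
  rewrite mulr1 ler_expR (le_trans (le_norm_addv_axis _ _))//; last exact: ltW.
  by rewrite addr_ge0// ltW.
rewrite [leRHS]mulrAC; apply: ler_pM => //.
- by rewrite mulr_ge0 ?expR_ge0// exprn_ge0// addr_ge0// divr_ge0// ltW.
- by apply: prodr_ge0 => i _; rewrite mulr_ge0 ?expR_ge0 ?weight_ge0.
apply: le_trans (expR_half_bound rho0); apply: ler_pM.
- by rewrite exprn_ge0// addr_ge0// divr_ge0// ltW.
- exact: expR_ge0.
- apply: lerXn2r; rewrite ?nnegrE ?addr_ge0 ?divr_ge0//; first exact: ltW.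
  by rewrite lerD2l ler_pdivrMr// ler_peMr.
- by rewrite ler_expR lerN2 ler_peMl// ler1n.
Qed.

Definition exceptional : set EqR :=
  [set p | exists i, first_coord (tnth p.1 i) = - p.2].

Lemma cvg_scaled_fun (r_ : nat -> R) p : r_ @ \oo --> +oo -> ~ exceptional p ->
  (fun k => scaled_fun H (r_ k) p) @ \oo --> limit_fun H p.
Proof.
case: p => y rho r_oo yrho; rewrite /scaled_fun /limit_fun /=.
apply: cvgM; first exact: cvg_cst.
have -> : expR (- (q.+1%:R * rho + \sum_(i < q) first_coord (tnth y i))) *
     \prod_(i < q) (- rho < first_coord (tnth y i))%R%:R =
  1 ^+ n * expR (- (q.+1%:R * rho)) *
  \prod_(i < q) (expR (- first_coord (tnth y i)) * (- rho < first_coord (tnth y i))%R%:R).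
  rewrite expr1n mul1r big_split /= mulrA; congr (_ * _).
  by rewrite opprD expRD -sumrN expR_sum.
apply: cvgM.
  apply: cvgM; last exact: cvg_cst.
  have c1 : (fun k => 1 + rho / r_ k) @ \oo --> (1 : R).
    rewrite -[X in _ --> X]addr0; apply: cvgD; first exact: cvg_cst.
    rewrite -[X in _ --> X](mulr0 rho); apply: cvgM; first exact: cvg_cst.
    apply: (gtr0_cvgV0 (f := r_) _).2 => //.
    by move/cvgryPgt : r_oo; exact.
  exact: (cvg_comp _ (fun x : R => x ^+ n) c1 (@exprn_continuous R n 1)).
apply: cvg_prod_ord => i; apply: cvg_scaled_weight => //.
by apply/eqP => h; apply: yrho; exists i.
Qed.

Lemma measurable_exceptional : measurable exceptional.
Proof.
rewrite (_ : exceptional = \bigcup_(i in [set: 'I_q]) [set p | first_coord (tnth p.1 i) = - p.2]); last first.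
  by apply/seteqP; split => p /=; [move=> [i h]; exists i|move=> [i _ h]; exists i].
apply: fin_bigcup_measurable => // i _.
have me : measurable_fun [set: EqR]
    (fun p => first_coord (tnth p.1 i) == - p.2).
  apply: measurable_fun_eqr.
    apply: measurable_first_coord.
    exact: (measurableT_comp (@measurable_tnth _ E q i) measurable_fst).
  apply: measurable_funN; exact: measurable_snd.
have := me measurableT [set true] I; rewrite setTI.
by congr measurable; apply/seteqP; split => p /= /eqP.
Qed.

(** For a given [y], at most [q] values of [rho] are exceptional. *)
Lemma exceptional0 : (pow q \x mu)%E exceptional = 0%E.
Proof.
rewrite /product_measure1 /=; apply: integral0_eq => y _ /=.
apply: countable_lebesgue_measure0; apply: finite_set_countable.
apply: (@sub_finite_set _ _ ((fun i : 'I_q => - first_coord (tnth y i)) @` setT)).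
  by move=> rho; rewrite /xsection /= => /set_mem [i /= h]; exists i => //; rewrite h opprK.
exact: finite_image.
Qed.

Lemma cvg_integral_scaled_fun (r_ : nat -> R) :
  (forall k, 1 <= r_ k) -> r_ @ \oo --> +oo ->
  (\int[pow q \x mu]_p (limit_fun H p)%:E < +oo)%E /\
  (fun k => \int[pow q \x mu]_p (scaled_fun H (r_ k) p)%:E)%E @ \oo -->
     (\int[pow q \x mu]_p (limit_fun H p)%:E)%E.
Proof.
move=> r1 r_oo.
have := @dominated_convergence _ EqR R (pow q \x mu)%E
  setT measurableT (fun k => EFin \o scaled_fun H (r_ k)) (EFin \o limit_fun H)
  (EFin \o dominator).
case.
- by move=> k; apply/measurable_EFinP; exact: measurable_scaled_fun.
- by apply/measurable_EFinP; exact: measurable_limit_fun.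
- exists exceptional; split; first exact: measurable_exceptional.
    exact: exceptional0.
  move=> p /= np; apply: contrapT => pe; apply: np => _.
  apply: cvg_EFin; first exact: nearW.
  exact: cvg_scaled_fun.
- exact: integrable_dominator.
- apply/nearW => p k _ /=; rewrite lee_fin ger0_norm ?scaled_le_dominator//.
  by rewrite scaled_fun_ge0// (lt_le_trans ltr01).
- move=> /integrableP[_ foo] _ h; split => //.
  by under eq_integral do rewrite -[X in X%:E]ger0_norm ?limit_fun_ge0//.
Qed.

End dominated.

(** * Hollow configurations of points *)

Section meets.
Context {R : realType} {d : nat}.
Notation E := (euclidean R d).
Implicit Types (x y p : E).

Lemma euclidean_dist_lt x y (b : R) : 0 < b ->
  (forall i, `|coord x i - coord y i| < b) -> euclidean_dist x y < d.+1%:R * b.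
Proof.
move=> b0 h; rewrite euclidean_distE.
have db : 0 < d.+1%:R * b by rewrite mulr_gt0// ltr0n.
rewrite -[ltRHS](gtr0_norm db) -sqrtr_sqr ltr_sqrt ?exprn_gt0//.
apply: (@le_lt_trans _ _ (\sum_(i < d) b ^+ 2)).
  apply: ler_sum => i _; rewrite -[leLHS]real_normK ?num_real//.
  by apply: lerXn2r; rewrite ?nnegrE// ltW.
rewrite sumr_const card_ord -[_ *+ d]mulr_natl exprMn ltr_pM2r ?exprn_gt0//.
by rewrite -natrX ltr_nat expnS expn1 (leq_trans (ltnSn _))// leq_pmulr.
Qed.

Definition meets m (z : m.-tuple E) (J : pred 'I_m) : Prop :=
  exists p, forall j, J j -> euclidean_dist p (tnth z j) < 1.

Definition rat_point (v : {ffun 'I_d -> rat}) : E := vec (fun i => ratr (v i)).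

(** The common points form an open set. Hence meeting is a countable union of
    measurable conditions. *)
Lemma meets_rat m (z : m.-tuple E) J : meets z J ->
  exists v, forall j, J j -> euclidean_dist (rat_point v) (tnth z j) < 1.
Proof.
move=> [p hp].
pose e : R := \big[Num.min/1]_(j < m | J j) (1 - euclidean_dist p (tnth z j)).
have e0 : 0 < e by apply: lt_bigmin => // j Jj; rewrite subr_gt0 hp.
have eh0 : 0 < e / d.+1%:R by rewrite divr_gt0.
have hv i : exists v : rat, `|ratr v - coord p i| < e / d.+1%:R.
  have lt : coord p i - e / d.+1%:R < coord p i + e / d.+1%:R.
    by rewrite ltrD2l (lt_trans _ eh0)// oppr_lt0.
  have [v] := rat_in_itvoo lt.
  by rewrite in_itv /= -ltr_distl => ?; exists v.
pose v := [ffun i => projT1 (cid (hv i))].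
exists v => j Jj; rewrite (le_lt_trans (euclidean_triangle p _ _))//.
have : euclidean_dist (rat_point v) p < e.
  rewrite -[ltRHS](@divfK _ d.+1%:R) ?pnatr_eq0// mulrC.
  apply: euclidean_dist_lt => // i.
  by rewrite coord_vec ffunE; case: cid.
have : e <= 1 - euclidean_dist p (tnth z j) by exact: bigmin_le_cond.
lra.
Qed.

Lemma measurable_meets m J : measurable [set z : m.-tuple E | meets z J].
Proof.
have -> : [set z : m.-tuple E | meets z J] =
    \bigcup_k (if choice.unpickle (s := {ffun 'I_d -> rat}) k is Some v then
      [set z | forall j, J j -> euclidean_dist (rat_point v) (tnth z j) < 1] else set0).
  apply/seteqP; split => z /=; last by move=> [k _]; case: (choice.unpickle (s := {ffun 'I_d -> rat}) k) => //= v hv; exists (rat_point v).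
  by move=> /meets_rat[v hv]; exists (choice.pickle v) => //; rewrite choice.pickleK.
apply: bigcupT_measurable => k; case: (choice.unpickle (s := {ffun 'I_d -> rat}) k) => // v.
rewrite (_ : mkset _ = \bigcap_(j in [set j | J j]) [set z : m.-tuple E | (euclidean_dist (rat_point v) (tnth z j) < 1)]) //.
apply: fin_bigcap_measurable => // j _.
by apply: measurable_euclidean_dist_lt => //; exact: (@measurable_tnth _ E).
Qed.

Lemma meets_isometry m (z : m.-tuple E) J phi : isometry_onto phi ->
  meets [tuple of map phi z] J <-> meets z J.
Proof.
move=> [iso onto]; split=> [[p hp]|[p hp]].
  have [p' p'E] := onto p; exists p' => j /hp.
  by rewrite tnth_map -p'E iso.
by exists (phi p) => j /hp; rewrite tnth_map iso.
Qed.

(** The point configurations that [cech _ 1] turns into a hollow simplex. *)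
Definition hollow_points m : set (m.-tuple E) :=
  [set z | ~ meets z xpredT /\ forall i, meets z (predC1 i)].

Lemma measurable_hollow_points m : measurable (@hollow_points m).
Proof.
rewrite (_ : @hollow_points m = ~` [set z | meets z xpredT] `&`
    \bigcap_(i in [set: 'I_m]) [set z | meets z (predC1 i)]); last first.
  apply/seteqP; split => z /= -[h1 h2]; split; [exact: h1|by move=> i _; exact: h2|exact: h1|].
  by move=> i; exact: (h2 i I).
apply: measurableI; first by apply: measurableC; exact: measurable_meets.
by apply: fin_bigcap_measurable => // i _; exact: measurable_meets.
Qed.

Lemma hollow_points_isometry m (z : m.-tuple E) phi : isometry_onto phi ->
  hollow_points [tuple of map phi z] <-> hollow_points z.
Proof.
move=> iso; split=> -[h1 h2]; split.
- by move=> h; apply: h1; apply/meets_isometry.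
- by move=> i; have /(meets_isometry _ _ iso) := h2 i.
- by move=> h; apply: h1; move: h => /(meets_isometry _ _ iso).
- by move=> i; apply/meets_isometry.
Qed.

(** Any two points avoid a third one, so that their balls meet. *)
Lemma hollow_points_close m (z : m.+3.-tuple E) i j : hollow_points z ->
  euclidean_dist (tnth z i) (tnth z j) < 2.
Proof.
move=> [_ h]; have [l li lj] : exists2 l, i != l & j != l.
  have : (0 < #|(~: [set i; j])%SET|)%N.
    by rewrite cardsCs finset.setCK cards2 card_ord subn_gt0; case: (_ != _).
  by move=> /card_gt0P[l]; rewrite !inE negb_or => /andP[? ?]; exists l; rewrite eq_sym.
have [p hp] := h l.
apply: (le_lt_trans (euclidean_triangle p _ _)); rewrite (euclidean_distC _ p).
have := hp i li; have := hp j lj; lra.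
Qed.

Lemma euclidean_dist_sq x y : euclidean_dist x y ^+ 2 = dotv x x - 2 * dotv x y + dotv y y.
Proof.
rewrite euclidean_distE sqr_sqrtr ?sumsq_ge0// /dotv mulr_sumr -sumrN -!big_split /=.
by apply: eq_bigr => i _; ring.
Qed.

Lemma dotvC x y : dotv x y = dotv y x.
Proof. by apply: eq_bigr => i _; rewrite mulrC. Qed.

(** Points on the unit sphere whose weighted barycentre is the origin have no
    smaller enclosing ball than the unit one; if moreover each facet has a
    smaller one, then a slight dilation is hollow, and stays so when it is
    perturbed. *)
Lemma hollow_points_perturb m (U : 'I_m -> E) (w : 'I_m -> R) :
  (0 < m)%N ->
  (forall i, dotv (U i) (U i) = 1) -> (forall i, 0 < w i) ->
  (forall x, \sum_i w i * dotv x (U i) = 0) ->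
  (forall l, exists p, forall i, i != l -> euclidean_dist p (U i) < 1) ->
  exists2 s : R, 0 < s & exists2 b : R, 0 < b &
    forall (c : E) (z : m.-tuple E),
      (forall i, euclidean_dist (tnth z i) (addv (scalev s (U i)) c) < b) ->
      hollow_points z.
Proof.
move=> m0 U1 w0 wU hf.
pose q l := projT1 (cid (hf l)).
have hq l i : i != l -> euclidean_dist (q l) (U i) < 1 by rewrite /q; case: cid => p /= h; exact: h.
pose e : R := \big[Num.min/1]_(l < m) \big[Num.min/1]_(i < m | i != l) (1 - euclidean_dist (q l) (U i)).
have e0 : 0 < e.
  by apply: lt_bigmin => // l _; apply: lt_bigmin => // i il; rewrite subr_gt0 hq.
have e1 : e <= 1 by exact: bigmin_le_id.
have qe l i : i != l -> euclidean_dist (q l) (U i) <= 1 - e.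
  move=> il; rewrite lerBrDr -lerBrDl.
  apply: (@le_trans _ _ (\big[Num.min/1]_(j < m | j != l) (1 - euclidean_dist (q l) (U j)))).
    exact: bigmin_le.
  exact: bigmin_le_cond.
(* Balls of radius [1 - e] enclose the facets. Dilated by [1 + e / 2], they
   have a radius below [1 - e / 2], and the smallest ball around all points has
   radius [1 + e / 2]; moving the points by [e / 4] does not bring either of
   them to 1. *)
exists (1 + e / 2); first by lra.
exists (e / 4); first by lra.
set s := 1 + e / 2.
have s0 : 0 < s by rewrite /s; lra.
have shift c x y : euclidean_dist (addv (scalev s x) c) (addv (scalev s y) c) = s * euclidean_dist x y.
  rewrite euclidean_dist_addv !euclidean_distE -[X in X * _](gtr0_norm s0) -sqrtr_sqr.
  rewrite -sqrtrM ?sqr_ge0// mulr_sumr; congr Num.sqrt; apply: eq_bigr => i _.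
  by rewrite !coord_scalev; ring.
move=> c z hz; split; last first.
  move=> l; exists (addv (scalev s (q l)) c) => j jl.
  rewrite (le_lt_trans (euclidean_triangle (addv (scalev s (U j)) c) _ _))// shift.
  rewrite [X in _ + X]euclidean_distC.
  have h1 := hz j; have h2 : s * euclidean_dist (q l) (U j) <= s * (1 - e) by rewrite ler_pM2l// qe.
  have h3 : s * (1 - e) + e / 4 <= 1 by rewrite /s; nra.
  lra.
move=> [p hp].
pose p' := scalev s^-1 (addv p (oppv c)).
have pE : p = addv (scalev s p') c.
  apply: eq_coord => i; rewrite coord_addv /p' !coord_scalev coord_addv coord_vec.
  by field; rewrite gt_eqF.
have lt1 i : euclidean_dist p' (U i) < 1.
  rewrite -(ltr_pM2l s0) -(shift c) -pE mulr1.
  apply: (le_lt_trans (euclidean_triangle (tnth z i) _ _)).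
  have := hz i; have := hp i isT; rewrite /s; lra.
have lt2 i : dotv p' p' - 2 * dotv p' (U i) < 0.
  have : euclidean_dist p' (U i) ^+ 2 < 1 by rewrite expr_lt1// euclidean_dist_ge0.
  rewrite euclidean_dist_sq U1; lra.
have : \sum_i w i * (dotv p' p' - 2 * dotv p' (U i)) < \sum_(i < m) 0.
  apply: ltr_sum; last by move=> i _; rewrite nmulr_llt0// pmulr_rlt0.
  by apply/hasP; exists (Ordinal m0); rewrite ?mem_index_enum.
have -> : \sum_i w i * (dotv p' p' - 2 * dotv p' (U i)) =
   \sum_i w i * dotv p' p' - 2 * \sum_i w i * dotv p' (U i).
  by rewrite mulr_sumr -sumrB; apply: eq_bigr => i _; ring.
rewrite wU mulr0 subr0 big1_eq ltNge; apply/negP; rewrite negbK.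
apply: sumr_ge0 => i _; rewrite mulr_ge0 ?(ltW (w0 i))//.
by rewrite -euclidean_norm_sq sqr_ge0.
Qed.

End meets.

Section simplex.
Context {R : realType} {d q : nat}.
Hypotheses (q0 : (0 < q)%N) (qd : (q <= d)%N).
Notation E := (euclidean R d).

Let basis (i : 'I_q) : E := vec (fun j => (j == i :> nat)%:R).
Let ones : E := vec (fun j => (j < q)%N%:R).
Let s : R := Num.sqrt q%:R.

Let s2 : s ^+ 2 = q%:R. Proof. by rewrite sqr_sqrtr. Qed.
Let s0 : 0 < s. Proof. by rewrite sqrtr_gt0 ltr0n. Qed.

Let dotv_basis x i : dotv x (basis i) = coord x (widen_ord qd i).
Proof.
rewrite /dotv (bigD1 (widen_ord qd i))//= coord_vec /= eqxx mulr1 big1 ?addr0// => j.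
by rewrite -val_eqE /= => /negbTE ji; rewrite coord_vec ji mulr0.
Qed.

Let dotv_ones x : dotv x ones = \sum_(i < q) dotv x (basis i).
Proof.
under eq_bigr do rewrite dotv_basis.
rewrite /dotv (bigID (fun j : 'I_d => (j < q)%N)) /= [X in _ + X]big1 ?addr0; last first.
  by move=> j /negbTE jq; rewrite coord_vec jq mulr0.
rewrite (big_ord_narrow qd) /=; apply: eq_bigr => i _.
by rewrite coord_vec /= ltn_ord mulr1.
Qed.

(** Not regular, but its inner products are immediate; it is inscribed in the
    unit sphere, and the origin is its barycentre for the weights
    [simplex_weight]. *)
Definition simplex (i : 'I_q.+1) : E :=
  if unlift ord0 i is Some j then basis j else scalev (- s^-1) ones.

Definition simplex_weight (i : 'I_q.+1) : R := if i == ord0 then s else 1.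

Let simplex0 : simplex ord0 = scalev (- s^-1) ones.
Proof. by rewrite /simplex unlift_none. Qed.

Let simplexS j : simplex (lift ord0 j) = basis j.
Proof. by rewrite /simplex liftK. Qed.

Let ones_basis i : dotv ones (basis i) = 1.
Proof. by rewrite dotv_basis coord_vec /= ltn_ord. Qed.

Let basis_basis i j : dotv (basis i) (basis j) = (i == j)%:R.
Proof. by rewrite dotv_basis coord_vec /= eq_sym val_eqE. Qed.

Lemma simplex_norm i : dotv (simplex i) (simplex i) = 1.
Proof.
case: (unliftP ord0 i) => [j|] ->; first by rewrite simplexS basis_basis eqxx.
rewrite simplex0 dotv_scale sqrrN dotv_ones.
under eq_bigr do rewrite ones_basis.
by rewrite sumr_const card_ord exprVn s2 mulVf// pnatr_eq0 -lt0n.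
Qed.

Lemma simplex_barycentre x : \sum_i simplex_weight i * dotv x (simplex i) = 0.
Proof.
rewrite big_ord_recl /simplex_weight eqxx simplex0 dotvC dotv_scaler dotvC.
under eq_bigr do rewrite eq_sym (negbTE (neq_lift _ _)) mul1r simplexS.
by rewrite -dotv_ones mulrA mulrN mulfV ?gt_eqF// mulN1r addNr.
Qed.

(** A point [u] whose inner products with the vertices of the facet are
    positive is enough: a small step from the origin towards [u] gets closer to
    all of them. *)
Lemma simplex_facet l : exists p, forall i, i != l -> euclidean_dist p (simplex i) < 1.
Proof.
suff [u hu] : exists u, forall i, i != l -> s^-1 <= dotv u (simplex i).
  pose a := s^-1 / (dotv u u + 1).
  have uu : 0 <= dotv u u by rewrite -euclidean_norm_sq sqr_ge0.
  have a0 : 0 < a by rewrite divr_gt0 ?invr_gt0//; lra.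
  exists (scalev a u) => i il.
  rewrite -(@expr_lt1 _ 2 (euclidean_dist _ _))// ?euclidean_dist_ge0//.
  rewrite euclidean_dist_sq simplex_norm dotv_scale dotv_scaler.
  have h := hu i il; have si : 0 < s^-1 by rewrite invr_gt0.
  have ha : a * (dotv u u + 1) = s^-1 by rewrite /a divfK// gt_eqF//; lra.
  have : a * (a * dotv u u - 2 * dotv u (simplex i)) < 0.
    rewrite pmulr_rlt0//; lra.
  lra.
have s1 : s^-1 <= 1.
  by rewrite invf_le1// -sqrtr1 ler_wsqrtr// ler1n.
case: (unliftP ord0 l) => [j|] ->.
  exists (addv ones (scalev (- q.+1%:R) (basis j))) => i.
  case: (unliftP ord0 i) => [i'|] ->.
    rewrite (inj_eq lift_inj) simplexS dotvC dotv_addv_scale [dotv _ ones]dotvC ones_basis.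
    by rewrite basis_basis => /negbTE ->; rewrite mulr0 addr0.
  move=> _; rewrite simplex0 dotvC dotv_scaler dotv_addv_scale dotv_ones.
  under eq_bigr do rewrite ones_basis.
  rewrite sumr_const card_ord ones_basis mulr1 -natr1.
  by rewrite opprD addrA subrr sub0r mulrNN mulr1.
exists ones => i; case: (unliftP ord0 i) => [i'|] ->; last by rewrite eqxx.
by move=> _; rewrite simplexS ones_basis.
Qed.

Lemma hollow_points_open : exists a : 'I_q -> E, exists2 b : R, 0 < b &
  forall y : q.-tuple E, (forall i j, `|coord (tnth y i) j - coord (a i) j| < b) ->
    hollow_points [tuple of origin :: y].
Proof.
have w0 i : 0 < simplex_weight i by rewrite /simplex_weight; case: ifP.
have [r r0 [b b0 h]] :=
  hollow_points_perturb (ltn0Sn q) simplex_norm w0 simplex_barycentre simplex_facet.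
pose c := oppv (scalev r (simplex ord0)).
exists (fun i => addv (scalev r (simplex (lift ord0 i))) c).
exists (b / d.+1%:R); first by rewrite divr_gt0.
move=> y hy; apply: (h c) => i.
case: (unliftP ord0 i) => [j|] ->; last first.
  rewrite tnth0; suff -> : addv (scalev r (simplex ord0)) c = origin by rewrite euclidean_distxx.
  by apply: eq_coord => j; rewrite coord_addv coord_origin [coord c j]coord_vec subrr.
rewrite tnthS -[ltRHS](@divfK _ d.+1%:R) ?pnatr_eq0// mulrC.
by apply: euclidean_dist_lt; [rewrite divr_gt0|move=> j'; exact: hy].
Qed.

End simplex.

Section positivity.
Context {R : realType} {n q : nat}.
Hypotheses (q0 : (0 < q)%N) (qn : (q <= n.+1)%N).
Notation E := (euclidean R n.+1).
Let pow := (power_measure (lebesgue_euclidean (R := R) (d := n.+1))).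
Let mu := @lebesgue_measure R.

(** The integrand is positive on a product of cubes around a hollow simplex,
    times an interval. *)
Lemma limit_integral_gt0 :
  (0 < \int[pow q \x mu]_p (limit_fun (@hollow_points R n.+1 q.+1) p)%:E)%E.
Proof.
have mH := @measurable_hollow_points R n.+1 q.+1.
have [a [b b0 hab]] := hollow_points_open (R := R) q0 qn.
pose A (i : nat) : set E := if insub i is Some j
  then [set x : E | forall j', `|coord x j' - coord (a j) j'| < b] else setT.
have mA i : measurable (A i).
  by rewrite /A; case: insub => // j; exact: measurable_coord_box.
(* A lower bound for [rho] that makes all the indicators of [limit_fun] equal
   to 1 on the cubes. *)
pose M : R := \sum_(i < q) (`|coord (a i) ord0| + b).
pose Y : set (q.-tuple E) := [set y | forall i : 'I_q, A i (tnth y i)].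
have mY : measurable Y by exact: (@measurable_box _ E q A mA).
pose B := Y `*` `[M, (M + 1)%R]%classic : set (q.-tuple E * measurableTypeR R).
have mB : measurable B by apply: measurableX.
have M0 : 0 <= M by apply: sumr_ge0 => i _; rewrite addr_ge0// ltW.
have pos p : B p -> 0 < limit_fun (@hollow_points R n.+1 q.+1) p.
  case: p => y rho [/= Yy]; rewrite in_itv /= => /andP[Mrho _].
  have Yc i j : `|coord (tnth y i) j - coord (a i) j| < b.
    by have := Yy i; rewrite /A valK => /(_ j).
  rewrite /limit_fun /= (le_trans M0 Mrho) mul1r indicE mem_set ?mul1r; last exact: hab.
  rewrite mulr_gt0 ?expR_gt0//; apply: prodr_gt0 => i _.
  suff -> : - rho < first_coord (tnth y i) by rewrite ltr01.
  have -> : first_coord (tnth y i) = coord (tnth y i) ord0.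
    by rewrite first_coordE -[X in coord X _]consvK coord_consv0.
  have := Yc i ord0; rewrite ltr_distl => /andP[h _].
  have : `|coord (a i) ord0| + b <= M.
    by rewrite /M (bigD1 i)//= lerDl; apply: sumr_ge0 => j _; rewrite addr_ge0// ltW.
  have := ler_norm (- coord (a i) ord0); rewrite normrN; lra.
rewrite lt_neqAle eq_sym integral_ge0 ?andbT; last by move=> p _; rewrite lee_fin limit_fun_ge0.
apply/eqP => I0.
have mf : measurable_fun [set: q.-tuple E * measurableTypeR R]
    (EFin \o limit_fun (@hollow_points R n.+1 q.+1)).
  by apply/measurable_EFinP; exact: measurable_limit_fun.
have : (\int[pow q \x mu]_p `|(EFin \o limit_fun (@hollow_points R n.+1 q.+1)) p| = 0)%E.
  rewrite -I0; apply: eq_integral => p _.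
  by rewrite /= ger0_norm// limit_fun_ge0.
move/(ae_eq_integral_abs _ measurableT mf) => [N [mN N0 BN]].
have B0 : (pow q \x mu)%E B = 0%E.
  apply: (subset_measure0 mB mN _ N0) => p Bp; apply: BN => /= /(_ I).
  by move=> [p0]; have := pos p Bp; rewrite p0 ltxx.
have : ((pow q \x mu) B = pow q Y * mu `[M, (M + 1)%R]%classic)%E.
  exact: product_measure1E.
have -> : (mu `[M, (M + 1)%R]%classic = 1)%E.
  by rewrite /mu lebesgue_measure_itv /= lte_fin ltrDl ltr01 -EFinD addrAC subrr add0r.
rewrite mule1 B0 => /esym/eqP.
rewrite [X in X == _](power_measure_box _ _ mA) (eq_bigr (fun=> ((b *+ 2) ^+ n.+1)%:E)); last first.
  by move=> i _; rewrite /A valK; exact: lebesgue_box.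
by rewrite prodEFin eqe prodr_const expf_eq0 expf_eq0 mulrn_eq0 /= gt_eqF// andbF.
Qed.

End positivity.

(** * Joint law of independent samples *)

Section joint_law.
Context {disp : measure_display} {T : measurableType disp} {R : realType}.
Variable mu : {sigma_finite_measure set T -> \bar R}.
Local Open Scope ereal_scope.

Lemma power_integral_prod m (g : nat -> T -> R) :
  (forall j, measurable_fun [set: T] (g j)) -> (forall j x, (0 <= g j x)%R) ->
  \int[power_measure mu m]_z (\prod_(j < m) g j (tnth z j))%:E =
  \prod_(j < m) \int[mu]_x (g j x)%:E.
Proof.
elim: m g => [|m IH] g mg g0.
  rewrite integral_power0; first by rewrite !big_ord0.
  by under eq_fun do rewrite big_ord0; exact: measurable_cst.
have mP p (h : nat -> T -> R) : (forall j, measurable_fun [set: T] (h j)) ->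
    measurable_fun [set: p.-tuple T] (fun z => (\prod_(j < p) h j (tnth z j))%:E).
  move=> mh; apply/measurable_EFinP; apply: measurable_prod_ord => j.
  by apply: measurableT_comp (mh j) _; exact: measurable_tnth.
rewrite [LHS]ge0_integral_powerS//; last 2 first.
- exact: mP.
- by move=> y; rewrite lee_fin; apply: prodr_ge0.
set C := \int[power_measure mu m]_z (\prod_(j < m) g j.+1 (tnth z j))%:E.
have C0 : 0 <= C by apply: integral_ge0 => y _; rewrite lee_fin; apply: prodr_ge0.
transitivity (\int[mu]_x ((g 0%N x)%:E * C)).
  apply: eq_integral => x _; rewrite -[RHS]ge0_integralZl_EFin//; last 2 first.
  - by move=> y _; rewrite lee_fin; apply: prodr_ge0.
  - exact: (mP _ (fun j => g j.+1)).
  apply: eq_integral => y _; rewrite -EFinM big_ord_recl tnth0; congr (_ * _)%:E.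
  by apply: eq_bigr => j _; rewrite tnthS.
rewrite ge0_integralZr//; last 2 first.
- exact/measurable_EFinP.
- by move=> x _; rewrite lee_fin.
by rewrite big_ord_recl; congr (_ * _); exact: (IH (fun j => g j.+1)).
Qed.

Definition boxes m : set (set (m.-tuple T)) :=
  [set B | exists2 A : nat -> set T, (forall j, measurable (A j)) &
    B = [set z | forall j : 'I_m, A j (tnth z j)]].

Lemma measurable_boxes m : @measurable _ (m.-tuple T) = <<s @boxes m >>.
Proof.
apply/seteqP; split.
  apply: smallest_sub; first exact: smallest_sigma_algebra.
  case: m => [|m]; first by rewrite big_ord0.
  rewrite -bigcup_mkord_ord => C [i im [A mA <-]]; rewrite setTI; apply: sub_sigma_algebra.
  exists (fun j => if j == (inord i : 'I_m.+1) :> nat then A else setT) => [j|]; first by case: ifP.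
  apply/seteqP; split => z /=.
    by move=> Az j; case: ifP => // /eqP /val_inj ->.
  by move=> /(_ (inord i)); rewrite eqxx.
by apply: smallest_sub; [exact: sigma_algebra_measurable|move=> _ [A mA ->]; exact: measurable_box].
Qed.

Context {disp' : measure_display} {Omega : measurableType disp'}.
Variable P : probability Omega R.
Variable X : nat -> Omega -> T.
Hypothesis mX : forall i, measurable_fun [set: Omega] (X i).
Variable f : T -> R.
Hypotheses (mf : measurable_fun [set: T] f) (f0 : forall x, (0 <= f x)%R).
Hypothesis Xf : forall i A, measurable A ->
  P (X i @^-1` A) = \int[mu]_(x in A) (f x)%:E.
Hypothesis indep : forall (J : {fset nat}) (A : nat -> set T),
  (forall i, measurable (A i)) ->
  P (\bigcap_(i in [set` J]) X i @^-1` A i) = \prod_(i <- J) P (X i @^-1` A i).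

Definition sample_tuple m (t : m.-tuple nat) (w : Omega) : m.-tuple T :=
  [tuple of map (X^~ w) t].

Lemma measurable_sample_tuple m (t : m.-tuple nat) :
  measurable_fun [set: Omega] (sample_tuple t).
Proof.
apply/measurable_fun_tnthP => i; apply: (eq_measurable_fun (X (tnth t i))) => //.
by move=> w _ /=; rewrite tnth_map.
Qed.

(** Independent samples with density [f] have the product density: both sides
    are finite measures that agree on boxes. *)
Lemma joint_law m (t : m.-tuple nat) (A : set (m.-tuple T)) : uniq t -> measurable A ->
  P (sample_tuple t @^-1` A) =
  \int[power_measure mu m]_z (\1_A z * \prod_(j < m) f (tnth z j))%:E.
Proof.
move=> ut mA.
pose F (z : m.-tuple T) := (\prod_(j < m) f (tnth z j))%:E : \bar R.
have mF : measurable_fun [set: m.-tuple T] F.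
  apply/measurable_EFinP; apply: measurable_prod_ord => j.
  by apply: measurableT_comp mf _; exact: measurable_tnth.
have F0 z : 0 <= F z by rewrite lee_fin; apply: prodr_ge0.
pose m1 : {measure set (m.-tuple T) -> \bar R} := pushforward P (sample_tuple t).
pose nu : {measure set (m.-tuple T) -> \bar R} := density_measure (power_measure mu m) mF F0.
have mt := measurable_sample_tuple t.
transitivity (nu A); last first.
  rewrite /nu /= /density integral_mkcond; apply: eq_integral => z _.
  by rewrite epatch_indic /F -EFinM mulrC.
suff : m1 mt A = nu A by [].
apply: (@measure_unique _ R _ (@boxes m) (fun=> setT) (@measurable_boxes m)) => //.
- move=> _ _ [B mB ->] [C mC ->]; exists (fun j => B j `&` C j).
    by move=> j; exact: measurableI.
  apply/seteqP; split => z /=; first by move=> [h h'] j; split.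
  by move=> h; split => j; have [] := h j.
- by move=> i; exists (fun=> setT) => //; apply/seteqP; split.
- by rewrite bigcup_const//; exists 0%N.
- move=> _ [B mB ->].
  (* Independence is about families indexed by the samples, whereas [B] is
     indexed by the positions in [t]. *)
  pose B' (i : nat) := B (index i t).
  pose J : {fset nat} := [fset j | j in tval t]%fset.
  have inJ i : (i \in J) = (i \in t) by rewrite /J !inE.
  transitivity (P (\bigcap_(i in [set` J]) X i @^-1` B' i)).
    congr (P _); apply/seteqP; split => w /=.
      move=> h i /=; rewrite inJ => it; rewrite /B'.
      have it' : (index i t < m)%N by rewrite -[X in (_ < X)%N](size_tuple t) index_mem.
      have := h (Ordinal it'); rewrite tnth_map /= (tnth_nth 0%N) /= nth_index//.
    move=> h j; have := h (tnth t j); rewrite /= inJ mem_tnth => /(_ isT).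
    by rewrite /B' tnth_map (tnth_nth 0%N) index_uniq ?size_tuple.
  rewrite indep; last by move=> i; exact: mB.
  rewrite (perm_big t)/=; last first.
    by apply: uniq_perm; [exact: fset_uniq|exact: ut|exact: inJ].
  rewrite (big_nth 0%N) size_tuple big_mkord /nu /= /density [RHS]integral_mkcond.
  rewrite [RHS](eq_integral (fun z => (\prod_(j < m) (\1_(B j) (tnth z j) * f (tnth z j)))%:E)); last first.
    move=> z _; rewrite patchE /F; case: ifPn => [/set_mem /= Bz|/negP Bz].
      by congr EFin; apply: eq_bigr => j _; rewrite indicE mem_set ?mul1r.
    have [j Bj] : exists j : 'I_m, ~ B j (tnth z j).
      by apply/existsNP => h; apply: Bz; apply/mem_set => /= j; exact: h.
    by rewrite (bigD1 j)//= indicE memNset// !mul0r.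
  rewrite (@power_integral_prod m (fun j x => \1_(B j) x * f x)%R); last 2 first.
  - by move=> j; apply: measurable_funM => //; exact: measurable_indic.
  - by move=> j x; rewrite mulr_ge0.
  apply: eq_bigr => j _.
  rewrite Xf; last exact: mB.
  rewrite /B' index_uniq ?size_tuple// integral_mkcond.
  by apply: eq_integral => x _; rewrite epatch_indic -EFinM mulrC.
- move=> k; apply: (@le_lt_trans _ _ 1); last exact: ltry.
  rewrite /m1 /= /pushforward preimage_setT; exact: probability_le1.
Qed.

End joint_law.

(** * Minimal cycles of the Čech complex of the outer samples *)

Local Close Scope classical_set_scope.

Section cech_complex.
Context (F : fieldType) {R : realType} {d : nat}.
Notation E := (euclidean R d).
Variable Y : {fset E}.
Implicit Types (s t : {set Y}) (u v : Y).

Let K := cech Y 1.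
Definition near_vertices u v : bool := euclidean_dist (val u) (val v) < 2.

Lemma cechP s : reflect
  (s != finset.set0 /\ exists p, forall v, v \in s -> euclidean_dist p (val v) < 1)
  (s \in K).
Proof.
rewrite inE; apply: (iffP andP) => -[s0].
  by move=> /asboolP[p hp]; split => //; exists p => v vs; exact: hp.
by move=> [p hp]; split => //; apply/asboolP; exists p => v vs; exact: hp.
Qed.

Lemma cech_down s t : s \in K -> t \subset s -> t != finset.set0 -> t \in K.
Proof.
move=> /cechP[_ [p hp]] /fintype.subsetP ts t0; apply/cechP; split => //.
by exists p => v /ts; exact: hp.
Qed.

Lemma cech_near s u v : s \in K -> u \in s -> v \in s -> u != v -> near_vertices u v.
Proof.
move=> /cechP[_ [p hp]] us vs _; rewrite /near_vertices.
rewrite (le_lt_trans (euclidean_triangle p _ _))//.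
rewrite euclidean_distC; have := hp u us; have := hp v vs; lra.
Qed.

Definition lists m (z : m.-tuple E) s : Prop :=
  uniq z /\ forall v, (v \in s) = (val v \in (z : seq E)).

Lemma lists_nth m (z : m.-tuple E) s v : lists z s -> v \in s ->
  exists j, val v = tnth z j.
Proof. by move=> [_ h]; rewrite h => /tnthP. Qed.

Lemma cells_hollow_points k (z : k.+2.-tuple E) s : (0 < k)%N ->
  lists z s -> (forall j, tnth z j \in Y) ->
  (s \in cells K k) <-> hollow_points z.
Proof.
case: k z => // k z _ zs zY; have [uz hz] := zs.
have inj : injective (tnth z) by apply/tuple_uniqP.
have sc : #|s| = k.+3.
  rewrite cardE -(size_map val) -[RHS](size_tuple z); apply: perm_size; apply: uniq_perm => //.
    by rewrite (map_inj_uniq val_inj) enum_uniq.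
  move=> y; apply/mapP/idP => [[v vs ->]|yz]; first by rewrite -hz -mem_enum.
  have /tnthP[j yj] := yz; have yY : y \in Y by rewrite yj.
  by exists [` yY]%fset => //; rewrite mem_enum hz.
have s0 : s != finset.set0 by rewrite -card_gt0 sc.
have vtx j : exists2 v, v \in s & val v = tnth z j.
  by exists [` zY j]%fset => //; rewrite hz /= mem_tnth.
rewrite /= inE sc eqxx /=; split.
  move=> /andP[sK /forallP sf]; split.
    move=> [p hp]; move/negP: sK; apply; apply/cechP; split => //; exists p => v vs.
    by have [j ->] := lists_nth zs vs; exact: hp.
  move=> i; have [v vs vz] := vtx i; have := sf v; rewrite vs /= => /cechP[_ [p hp]].
  exists p => j /= ji; have [u us uz'] := vtx j; rewrite -uz'; apply: hp.
  rewrite !inE us andbT; apply: contraNneq ji => uv; apply/eqP/inj.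
  by rewrite -uz' -vz uv.
move=> [h1 h2]; apply/andP; split.
  apply/negP => /cechP[_ [p hp]]; apply: h1; exists p => j _.
  by have [v vs <-] := vtx j; exact: hp.
apply/forallP => v; apply/implyP => vs; apply/cechP; split.
  by rewrite -card_gt0; move: sc; rewrite (cardsD1 v) vs add1n => -[->].
have [i vi] := lists_nth zs vs; have [p hp] := h2 i.
exists p => u; rewrite !inE => /andP[uv us]; have [j uj] := lists_nth zs us.
rewrite uj; apply: hp => /=; apply: contraNneq uv => ji.
by apply/eqP/val_inj; rewrite uj vi ji.
Qed.

(** Without one of two equal points, the balls have the same intersection. *)
Lemma hollow_points_uniq m (z : m.-tuple E) : hollow_points z -> uniq z.
Proof.
move=> [h1 h2]; apply/negPn/negP => nu; apply: h1.
have [i [j [ij zij]]] : exists i j, i != j /\ tnth z i = tnth z j.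
  apply: contrapT => h; move/negP: nu; apply; apply/tuple_uniqP => i j zij.
  by apply/eqP/negPn/negP => ij; apply: h; exists i, j.
have [p hp] := h2 i; exists p => l _.
have [->|li] := eqVneq l i; last exact: hp.
by rewrite zij; apply: hp; rewrite /= eq_sym.
Qed.

End cech_complex.

Lemma tuple1E (T : Type) (z : 1.-tuple T) : tval z = [:: tnth z ord0].
Proof. by case: z => -[|a [|b l]] sz //; rewrite (tnth_nth a). Qed.

(** The number of points of a minimal [k]-cycle besides its first one. *)
Definition excess (k : nat) : nat := if k is 0 then 0 else k.+1.

(** The positions of the vertices of a component that carries exactly one
    [k]-cycle: one point if [k = 0], a hollow simplex otherwise. *)
Definition cycle_points {R : realType} {d : nat} (k : nat) :
    set ((excess k).+1.-tuple (euclidean R d)) :=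
  if k is j.+1 then @hollow_points R d j.+3 else setT.

Arguments cycle_points {R d} k.

Section counting.
Context (F : fieldType) {R : realType} {d : nat}.
Notation E := (euclidean R d).
Variables (n : nat) (x : 'I_n -> E).
Variable k : nat.

Definition point_seq (I : {set 'I_n}) : seq E := [seq x i | i <- enum I].

Definition cell_sets (r : R) : {set {set 'I_n}} :=
  finset.finset (fun I : {set 'I_n} => (#|I| == (excess k).+1) &&
    `[< (exists2 z, tval z = point_seq I & cycle_points k z) /\
        forall i, i \in I -> r <= euclidean_norm (x i) >]).

(** The bound 6 is for a simplex, whose vertices are at distance less than 2
    from each other, with two more points that are attached one after the other
    at distance less than 2. Tuples are enough, since their number serves as an
    upper bound only. *)
Definition near_tuples (r : R) : {set (excess k).+2.-tuple 'I_n} :=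
  finset.finset (fun t : (excess k).+2.-tuple 'I_n => uniq t &&
    `[< forall a, r <= euclidean_norm (x (tnth t a)) /\
          euclidean_dist (x (tnth t a)) (x (tnth t ord0)) < 6 >]).

Variables (Y : {fset E}) (r : R).
Hypothesis hY : forall y, (y \in Y) = [exists i, x i == y] && (r <= euclidean_norm y).
Let K := cech Y 1.

Lemma cycle_points_cell z (s : {set Y}) : lists z s -> (forall j, tnth z j \in Y) ->
  (s \in cells K k) <-> cycle_points k z.
Proof.
move=> zs zY; have [uz hz] := zs.
case: k z zs zY uz hz => [|k'] z zs zY uz hz; last exact: cells_hollow_points.
split=> // _; have sE : s = [set [` zY ord0]%fset]%SET.
  apply/setP => v; rewrite hz inE -val_eqE /=.
  by rewrite (tuple1E z) inE.
apply/facesP; rewrite sE cards1; split => //; last by rewrite -card_gt0 cards1.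
apply/cechP; split; first by rewrite -card_gt0 cards1.
by exists (tnth z ord0) => v /set1P ->; rewrite euclidean_distxx.
Qed.

(** [x] need not be injective, so that a vertex has to be assigned one of its
    indices. *)
Lemma vertex_index (v : Y) : exists i, x i == val v.
Proof. by have := valP v; rewrite hY => /andP[/existsP]. Qed.

Let iota v : 'I_n := xchoose (vertex_index v).
Let iotaE v : x (iota v) = val v.
Proof. exact/eqP/(xchooseP (vertex_index v)). Qed.

Let iota_inj : injective iota.
Proof. by move=> u v uv; apply: val_inj; rewrite -!iotaE uv. Qed.

Let vertex_norm (v : Y) : r <= euclidean_norm (val v).
Proof. by have := valP v; rewrite hY => /andP[]. Qed.

Lemma point_seq_iota (s : {set Y}) (v : Y) : (v \in s) = (val v \in point_seq (iota @: s)).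
Proof.
apply/idP/mapP => [vs|[i]].
  by exists (iota v); rewrite ?iotaE// mem_enum imset_f.
by rewrite mem_enum => /imsetP[u us ->]; rewrite iotaE => /val_inj ->.
Qed.

Lemma uniq_point_seq_iota (s : {set Y}) : uniq (point_seq (iota @: s)).
Proof.
rewrite map_inj_in_uniq ?enum_uniq// => i j; rewrite !mem_enum.
by move=> /imsetP[u _ ->] /imsetP[v _ ->]; rewrite !iotaE => /val_inj ->.
Qed.

Lemma cells_le_cell_sets : (#|cells K k| <= #|cell_sets r|)%N.
Proof.
pose g (I : {set 'I_n}) : {set Y} := finset.finset (fun v => iota v \in I).
apply: leq_trans (leq_imset_card g _); apply: subset_leq_card.
apply/fintype.subsetP => s sc; apply/imsetP; exists (iota @: s); last first.
  by apply/setP => v; rewrite inE mem_imset.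
have cI : #|iota @: s| = (excess k).+1.
  by rewrite card_imset// (card_cells sc); case: (k).
rewrite inE cI eqxx /=; apply/asboolP; split; last first.
  by move=> i /imsetP[v _ ->]; rewrite iotaE.
have sz : size (point_seq (iota @: s)) == (excess k).+1 by rewrite size_map -cardE cI.
exists (Tuple sz) => //; apply/(@cycle_points_cell _ s) => //.
  by split; [exact: uniq_point_seq_iota|move=> v; exact: point_seq_iota].
move=> j; have : tnth (Tuple sz) j \in Tuple sz by exact: mem_tnth.
by move=> /mapP[i]; rewrite mem_enum => /imsetP[v _ ->] ->; rewrite iotaE; exact: valP.
Qed.

Let near := (@near_vertices R d Y).

(** List a crowded face and then the two vertices that witness that it is
    crowded; the face is recovered from its indices at the head of the tuple. *)
Lemma crowded_le_near_tuples : (0 < k)%N -> (#|crowded K near k| <= #|near_tuples r|)%N.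
Proof.
move=> k0.
pose g (t : (excess k).+2.-tuple 'I_n) : {set Y} :=
  finset.finset (fun v => iota v \in take k.+1 t).
apply: leq_trans (leq_imset_card g _); apply: subset_leq_card.
apply/fintype.subsetP => s; rewrite inE => /andP[sf].
have /facesP[sK s0 sc] := sf.
move=> /existsP[u /and3P[us /existsP[a /andP[as_ au]] /existsP[w /andP[wus /existsP[b /andP[bus bw]]]]]].
have szE : size (enum (iota @: s)) = k.+1 by rewrite -cardE card_imset.
pose t := enum (iota @: s) ++ [:: iota u; iota w].
have tz : size t == (excess k).+2.
  by rewrite size_cat szE /= addn2; case: (k) k0.
apply/imsetP; exists (Tuple tz); last first.
  apply/setP => v; rewrite inE /= /t -szE take_size_cat// mem_enum mem_imset//.
rewrite inE; apply/andP; split.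
  rewrite /= cat_uniq enum_uniq /= !inE orbF !mem_enum !(mem_imset _ _ iota_inj) negb_or us /=.
  move: wus; rewrite !inE negb_or => /andP[wu ws].
  by rewrite ws /= andbT (inj_eq iota_inj) eq_sym.
have tY y : y \in t -> exists v, y = iota v /\ (v \in s \/ v = u \/ v = w).
  rewrite mem_cat mem_enum => /orP[/imsetP[v vs ->]|]; first by exists v; split => //; left.
  by rewrite !inE => /orP[] /eqP ->; [exists u|exists w]; split => //; right; [left|right].
have ss v v' : v \in s -> v' \in s -> euclidean_dist (val v) (val v') < 2.
  move=> vs v's; have [->|vv] := eqVneq v v'; first by rewrite euclidean_distxx.
  exact: (cech_near sK).
have su v : v \in s -> euclidean_dist (val u) (val v) < 4.
  move=> vs; apply: (le_lt_trans (euclidean_triangle (val a) _ _)).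
  have := ss a v as_ vs; have : euclidean_dist (val u) (val a) < 2 by rewrite euclidean_distC.
  lra.
have sw v : v \in s -> euclidean_dist (val w) (val v) < 6.
  move=> vs; apply: (le_lt_trans (euclidean_triangle (val b) _ _)).
  have : euclidean_dist (val w) (val b) < 2 by rewrite euclidean_distC.
  have : euclidean_dist (val b) (val v) < 4.
    move: bus; rewrite !inE => /orP[/eqP ->|bs]; first exact: su.
    by have := ss b v bs vs; lra.
  lra.
apply/asboolP => i; have /tY[v [vE vc]] : tnth (Tuple tz) i \in t by exact: mem_tnth.
rewrite vE iotaE; split; first exact: vertex_norm.
have [h hs hE] : exists2 h, h \in s & tnth (Tuple tz) ord0 = iota h.
  have : nth (iota u) (enum (iota @: s)) 0 \in iota @: s by rewrite -mem_enum mem_nth// szE.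
  move=> /imsetP[h hs hE]; exists h => //.
  by rewrite (tnth_nth (iota u)) /= /t nth_cat szE ltn0Sn.
rewrite hE iotaE; case: vc => [vs|[->|->]].
- by have := ss v h vs hs; lra.
- by have := su h hs; lra.
- exact: sw.
Qed.

Lemma betti_le_cell_sets : (betti F K k <= #|cell_sets r| + #|near_tuples r|)%N.
Proof.
apply: leq_trans (ge_betti F (@cech_down R d Y) (@cech_near R d Y) k) _.
apply: leq_add; first exact: cells_le_cell_sets.
have := crowded_le_near_tuples; move: #|near_tuples r| => N.
by case: (k) => // k' h; exact: h.
Qed.

(** Stronger than being detached in [K]: a point of [I] is not shared by
    another index. *)
Definition apart (I : {set 'I_n}) : bool :=
  [forall i, forall j, (i \in I) ==> (j \notin I) ==> (2 <= euclidean_dist (x i) (x j))].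

Lemma apartP I i j : apart I -> i \in I -> j \notin I -> 2 <= euclidean_dist (x i) (x j).
Proof. by move=> /forallP/(_ i)/forallP/(_ j)/implyP h /h /implyP; exact. Qed.

Variable r' : R.
Hypothesis rr' : r <= r'.

Let cells_of (I : {set 'I_n}) : {set Y} := finset.finset (fun v => val v \in point_seq I).

Let point_in (I : {set 'I_n}) i : I \in cell_sets r' -> i \in I -> x i \in Y.
Proof.
rewrite inE => /andP[_ /asboolP[_ h]] iI; rewrite hY (le_trans rr')//; last exact: h.
by rewrite andbT; apply/existsP; exists i.
Qed.

Lemma cells_of_cells I : I \in cell_sets r' -> cells_of I \in cells K k.
Proof.
move=> Ic; have := Ic; rewrite inE => /andP[/eqP cI /asboolP[[z zE zc] _]].
apply/(@cycle_points_cell z) => //.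
  split; last by move=> v; rewrite inE zE.
  move: z zc {zE}; case: (k) => [z _|k' z]; last exact: hollow_points_uniq.
  by rewrite tuple1E.
move=> j; have : tnth z j \in (z : seq E) by exact: mem_tnth.
by rewrite zE => /mapP[i]; rewrite mem_enum => iI ->; exact: point_in iI.
Qed.

Lemma cells_of_detached I : I \in cell_sets r' -> apart I -> detached near (cells_of I).
Proof.
move=> Ic Ia; apply/forallP => w; apply/implyP => wI; apply/negP => /existsP[a /andP[aI]].
rewrite /near /near_vertices; move: aI; rewrite inE => /mapP[i]; rewrite mem_enum => iI ->.
have := valP w; rewrite hY => /andP[/existsP[j /eqP jw] _]; rewrite -jw ltNge.
rewrite (apartP Ia)//; apply: contraNN wI => jI.
by rewrite inE -jw; apply/mapP; exists j; rewrite // mem_enum.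
Qed.

Lemma cells_of_inj I J : I \in cell_sets r' -> J \in cell_sets r' -> apart I -> apart J ->
  cells_of I = cells_of J -> I = J.
Proof.
wlog suff sub : I J / I \in cell_sets r' -> J \in cell_sets r' -> apart I -> apart J ->
    cells_of I = cells_of J -> I \subset J.
  by move=> Ic Jc Ia Ja IJ; apply/eqP; rewrite finset.eqEsubset !sub.
move=> Ic Jc Ia Ja IJ; apply/fintype.subsetP => i iI; apply/negPn/negP => iJ.
have : [` point_in Ic iI]%fset \in cells_of I.
  by rewrite inE /=; apply/mapP; exists i => //; rewrite mem_enum.
rewrite IJ inE /= => /mapP[j]; rewrite mem_enum => jJ ij.
have := apartP Ja jJ iJ; rewrite ij euclidean_distxx; lra.
Qed.

Lemma apart_le_betti : (#|[set I in cell_sets r' | apart I]%SET| <= betti F K k)%N.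
Proof.
rewrite -(card_in_imset (f := cells_of)); last first.
  by move=> I J; rewrite !inE => /andP[+ ?] /andP[+ ?] => h1 h2; apply: cells_of_inj => //; rewrite inE.
apply: (le_betti F (@cech_down R d Y) (@cech_near R d Y)).
  by apply/fintype.subsetP => s /imsetP[I]; rewrite inE => /andP[Ic _] ->; exact: cells_of_cells.
by move=> s /imsetP[I]; rewrite inE => /andP[Ic Ia] ->; exact: cells_of_detached.
Qed.

(** The sample that comes close to [I] need not lie beyond [r'], whence a
    smaller radius. *)
Lemma close_le_near_tuples :
  (#|[set I in cell_sets r' | ~~ apart I]%SET| <= #|near_tuples (r' - 6)|)%N.
Proof.
pose g (t : (excess k).+2.-tuple 'I_n) : {set 'I_n} :=
  finset.finset (fun i => i \in take (excess k).+1 t).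
apply: leq_trans (leq_imset_card g _); apply: subset_leq_card.
apply/fintype.subsetP => I; rewrite inE => /andP[Ic].
have := Ic; rewrite inE => /andP[/eqP cI /asboolP[[z zE zc] nI]].
move=> /forallPn[i /forallPn[j]]; rewrite !negb_imply => /and3P[iI jI].
rewrite -ltNge => ij.
have szE : size (enum I) = (excess k).+1 by rewrite -cardE.
pose t := rcons (enum I) j.
have tz : size t == (excess k).+2 by rewrite size_rcons szE.
apply/imsetP; exists (Tuple tz); last first.
  by apply/setP => l; rewrite inE /= /t -szE -cats1 take_size_cat// mem_enum.
have II a b : a \in I -> b \in I -> euclidean_dist (x a) (x b) < 2.
  move=> aI bI.
  have za c : c \in I -> exists l, x c = tnth z l.
    move=> cI'; apply/tnthP; rewrite [_ \in _]/(_ \in tval z) zE.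
    by apply/mapP; exists c; rewrite // mem_enum.
  have [[la ->] [lb ->]] := (za a aI, za b bI).
  move: z zc la lb {zE za}; case: (k) => [z _ la lb|k' z zc la lb].
    by rewrite [la]ord1 [lb]ord1 euclidean_distxx.
  exact: hollow_points_close.
rewrite inE; apply/andP; split; first by rewrite /= rcons_uniq enum_uniq mem_enum jI.
have jn : euclidean_norm (x i) <= euclidean_norm (x j) + euclidean_dist (x i) (x j).
  exact: euclidean_norm_triangle.
have := nI i iI => ni.
apply/asboolP => a.
have [h hI hE] : exists2 h, h \in I & tnth (Tuple tz) ord0 = h.
  have : nth i (enum I) 0 \in I by rewrite -mem_enum mem_nth// szE.
  by move=> hI; eexists; first exact: hI; rewrite (tnth_nth i) /= /t nth_rcons szE.
rewrite hE; have : tnth (Tuple tz) a \in t by exact: mem_tnth.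
rewrite mem_rcons inE mem_enum => /orP[/eqP ->|aI]; split.
- lra.
- apply: (le_lt_trans (euclidean_triangle (x i) _ _)).
  rewrite euclidean_distC; have := II i h iI hI; lra.
- have := nI _ aI; lra.
- have := II _ h aI hI; lra.
Qed.

(** A radius [r'] beyond [r] selects fewer configurations, which contribute to
    the same Betti number. *)
Lemma cell_sets_le_betti :
  (#|cell_sets r'| <= betti F K k + #|near_tuples (r' - 6)|)%N.
Proof.
rewrite -(cardsID (finset.finset apart)) leq_add//.
  apply: leq_trans apart_le_betti; apply: subset_leq_card.
  by apply/fintype.subsetP => I; rewrite !inE.
apply: leq_trans close_le_near_tuples; apply: subset_leq_card.
by apply/fintype.subsetP => I; rewrite !inE => /andP[-> ->].
Qed.

End counting.

Local Open Scope classical_set_scope.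
Local Open Scope ring_scope.

(** * Asymptotics along the cutoff radii *)

Section cutoff.
Context {R : realType}.

Lemma cvg_ln_nat : (fun k : nat => ln k%:R : R) @ \oo --> +oo.
Proof.
apply/cvgryPge => A; near=> k.
have kA : expR A <= k%:R :> R by near: k; exact: nbhs_infty_ger.
have k0 : 0 < k%:R :> R by rewrite (lt_le_trans _ kA)// expR_gt0.
by rewrite -(expRK A) ler_ln// posrE ?expR_gt0.
Unshelve. all: by end_near. Qed.

Lemma cvg_lnln_nat : (fun k : nat => ln (ln k%:R) : R) @ \oo --> +oo.
Proof.
apply/cvgryPge => A; near=> k.
have kA : expR A <= ln k%:R :> R by near: k; move/cvgryPge : cvg_ln_nat; exact.
have k0 : 0 < ln k%:R :> R by rewrite (lt_le_trans _ kA)// expR_gt0.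
by rewrite -(expRK A) ler_ln// posrE ?expR_gt0.
Unshelve. all: by end_near. Qed.

Lemma cvg_lnln_over_ln : (fun k : nat => ln (ln k%:R) / ln k%:R : R) @ \oo --> 0.
Proof.
apply: (@squeeze_cvgr _ _ _ _ (cst 0) (fun k => 2 / ln (ln k%:R))).
- near=> k.
  have l0 : 0 < ln k%:R :> R by near: k; move/cvgryPgt : cvg_ln_nat; exact.
  have L0 : 0 < ln (ln k%:R) :> R by near: k; move/cvgryPgt : cvg_lnln_nat; exact.
  apply/andP; split; first by rewrite divr_ge0// ltW.
  rewrite ler_pdivrMr// mulrAC ler_pdivlMr//.
  have := expR_ge1Dxn 1 (ltW L0); rewrite lnK ?posrE//.
  rewrite -expr2 (_ : 2`!%:R = 2)//; lra.
- exact: cvg_cst.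
- rewrite -[X in _ --> X](mulr0 2); apply: cvgM; first exact: cvg_cst.
  apply: (gtr0_cvgV0 (f := fun k : nat => ln (ln k%:R)) _).2; last exact: cvg_lnln_nat.
  by move/cvgryPgt : cvg_lnln_nat; exact.
Unshelve. all: by end_near. Qed.

Variables (a b : R).
Definition radius (k : nat) : R := ln k%:R + a * ln (ln k%:R) + b.

Lemma cvg_radius_over_ln : (fun k => radius k / ln k%:R) @ \oo --> (1 : R).
Proof.
have := cvg_lnln_over_ln; set f := fun k => _ => cf.
have ci : (fun k : nat => (ln k%:R)^-1 : R) @ \oo --> 0.
  apply: (gtr0_cvgV0 (f := fun k : nat => ln k%:R) _).2; last exact: cvg_ln_nat.
  by move/cvgryPgt : cvg_ln_nat; exact.
have : (fun k => 1 + a * f k + b * (ln k%:R)^-1) @ \oo --> 1 + a * 0 + b * 0.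
  apply: cvgD; last by apply: cvgM => //; exact: cvg_cst.
  by apply: cvgD; [exact: cvg_cst|apply: cvgM => //; exact: cvg_cst].
rewrite !mulr0 !addr0; apply: cvg_trans; apply: near_eq_cvg; near=> k.
have l0 : 0 < ln k%:R :> R by near: k; move/cvgryPgt : cvg_ln_nat; exact.
by rewrite /f /radius; field; rewrite gt_eqF.
Unshelve. all: by end_near. Qed.

Lemma cvg_radius : radius @ \oo --> +oo.
Proof.
apply/cvgryPge => A; near=> k.
have l0 : 0 < ln k%:R :> R by near: k; move/cvgryPgt : cvg_ln_nat; exact.
have h : 2^-1 < radius k / ln k%:R.
  by near: k; move: cvg_radius_over_ln => /cvgr_gt; apply; rewrite invf_lt1 ?ltr1n.
have lA : 2 * A <= ln k%:R by near: k; move/cvgryPge : cvg_ln_nat; exact.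
by move: h; rewrite ltr_pdivlMr//; lra.
Unshelve. all: by end_near. Qed.

Lemma cvg_expR_lnln (c : R) : c < 0 -> (fun k : nat => expR (c * ln (ln k%:R))) @ \oo --> (0 : R).
Proof.
move=> c0; have -> : (fun k : nat => expR (c * ln (ln k%:R))) =
    (fun z => expR (- z)) \o (fun k : nat => - c * ln (ln k%:R) : R).
  by apply/funext => k /=; congr expR; ring.
apply: (@cvg_comp _ _ _ _ _ _ (pinfty_nbhs R)); last exact: cvgr_expR.
apply/cvgryPge => A; near=> k.
have h : A / - c <= ln (ln k%:R) by near: k; move/cvgryPge : cvg_lnln_nat; exact.
by move: h; rewrite ler_pdivrMr ?oppr_gt0// mulrC.
Unshelve. all: by end_near. Qed.

Lemma cvgy_expR_lnln (c : R) : 0 < c -> (fun k : nat => expR (c * ln (ln k%:R))) @ \oo --> +oo.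
Proof.
move=> c0; apply/cvgryPge => A; near=> k.
have h : A / c <= ln (ln k%:R) by near: k; move/cvgryPge : cvg_lnln_nat; exact.
move: h; rewrite ler_pdivrMr// mulrC => h; rewrite (le_trans h)//.
by rewrite (le_trans _ (expR_ge1Dx _))// lerDr.
Unshelve. all: by end_near. Qed.

End cutoff.

Section tail_asymptotics.
Context {R : realType} {n q : nat}.
Notation E := (euclidean R n.+1).
Variable H : set (q.+1.-tuple E).
Hypothesis mH : measurable H.
Hypothesis invH : forall phi : E -> E, isometry_onto phi ->
  forall z : q.+1.-tuple E, H [tuple of map phi z] <-> H z.
Variable D : R.
Hypothesis bddH : forall z : q.+1.-tuple E, H z ->
  forall i, euclidean_dist (tnth z i) (thead z) < D.
Let pow := (power_measure (lebesgue_euclidean (R := R) (d := n.+1))).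

Definition limit_integral : \bar R :=
  (\int[pow q \x @lebesgue_measure R]_p (limit_fun H p)%:E)%E.

Lemma limit_integral_fin : limit_integral \is a fin_num.
Proof.
have r1 k : 1 <= (k.+1%:R : R) by rewrite ler1n.
have roo : (fun k : nat => k.+1%:R : R) @ \oo --> +oo.
  apply/cvgryPge => A; near=> k; rewrite (@le_trans _ _ k%:R)//.
    by near: k; exact: nbhs_infty_ger.
  by rewrite ler_nat.
have [h _] := cvg_integral_scaled_fun mH bddH r1 roo.
rewrite ge0_fin_numE//; apply: integral_ge0 => p _; rewrite lee_fin; exact: limit_fun_ge0.
Unshelve. all: by end_near. Qed.

(** With the radius [ln k + a * ln (ln k) + b], the order of magnitude [r ^+ n
    * expR (- (q.+1%:R * r))] is [expR (- (q.+1%:R * b))] times a power of [ln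
    k] over [k ^+ q.+1], because [radius a b k / ln k] tends to 1. *)
Lemma tail_asymptotics (a b : R) : exists2 v : nat -> R,
  v @ \oo --> @sphere_area R n.+1 * expR (- (q.+1%:R * b)) * fine limit_integral &
  \forall k \near \oo, ((k%:R ^+ q.+1)%:E * tail_integral H (radius a b k) =
    (expR ((n%:R - q.+1%:R * a) * ln (ln k%:R)) * v k)%:E)%E.
Proof.
(* Domination requires radii that are at least 1. *)
pose r k := Num.max 1 (radius a b k).
have r1 k : 1 <= r k by rewrite le_max lexx.
have roo : r @ \oo --> +oo.
  apply/cvgryPge => A; near=> k; rewrite le_max; apply/orP; right.
  by near: k; move/cvgryPge : (cvg_radius a b); exact.
have [_] := cvg_integral_scaled_fun mH bddH r1 roo.
rewrite -/limit_integral -(fineK limit_integral_fin) => /fine_cvgP[Sfin Scvg].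
pose S k := fine (\int[pow q \x @lebesgue_measure R]_p (scaled_fun H (r k) p)%:E)%E.
exists (fun k => @sphere_area R n.+1 * expR (- (q.+1%:R * b)) * ((radius a b k / ln k%:R) ^+ n * S k)).
  apply: cvgM; first exact: cvg_cst.
  rewrite -[X in _ --> X]mul1r -[X in X * _](expr1n _ n); apply: cvgM => //.
  exact: (cvg_comp _ (fun x : R => x ^+ n) (cvg_radius_over_ln a b) (@exprn_continuous R n 1)).
near=> k.
have l0 : 0 < ln k%:R :> R by near: k; move/cvgryPgt : (@cvg_ln_nat R); exact.
have k0 : 0 < k%:R :> R by near: k; exact: nbhs_infty_gtr.
have rk : r k = radius a b k.
  apply/max_idPr; near: k; move/cvgryPge : (cvg_radius a b); exact.
have rk0 : 0 < radius a b k by rewrite -rk (lt_le_trans ltr01).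
rewrite tail_scaled// -rk.
have <- : (S k)%:E = (\int[pow q \x @lebesgue_measure R]_p (scaled_fun H (r k) p)%:E)%E.
  by rewrite fineK//; near: k.
rewrite -!EFinM rk; congr EFin; rewrite expr_div_n.
have -> : expR ((n%:R - q.+1%:R * a) * ln (ln k%:R)) =
    ln k%:R ^+ n * expR (- (q.+1%:R * a * ln (ln k%:R))) :> R.
  by rewrite mulrBl expRD expRM_natl lnK ?posrE.
have -> : expR (- (q.+1%:R * radius a b k)) = (k%:R ^+ q.+1)^-1 *
    expR (- (q.+1%:R * a * ln (ln k%:R))) * expR (- (q.+1%:R * b)).
  have -> : (k%:R ^+ q.+1)^-1 = expR (- (q.+1%:R * ln k%:R)) :> R.
    by rewrite expRN expRM_natl lnK ?posrE.
  by rewrite -!expRD /radius; congr expR; ring.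
have kn : k%:R ^+ q.+1 != 0 :> R by rewrite expf_neq0// gt_eqF.
have ln0 : ln k%:R ^+ n != 0 :> R by rewrite expf_neq0// gt_eqF.
by field; rewrite ln0 kn.
Unshelve. all: by end_near. Qed.

End tail_asymptotics.

(** * Expected numbers of configurations *)

(** No measurability is asked for: a Betti number is compared with counts that
    are measurable, and is not shown to be so itself. *)
Lemma le_integral_ge0 {disp} {T : measurableType disp} {R : realType}
    (mu : {measure set T -> \bar R}) (f g : T -> \bar R) :
  (forall x, 0 <= f x)%E -> (forall x, f x <= g x)%E ->
  (\int[mu]_x f x <= \int[mu]_x g x)%E.
Proof.
move=> f0 fg; have g0 x : (0 <= g x)%E by exact: le_trans (fg x).
rewrite !ge0_integralTE//; apply: le_ereal_sup => _ [h /= hf <-].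
by exists h => // x; exact: le_trans (hf x) (fg x).
Qed.

Lemma sume_const {R : realType} (I : finType) (A : {set I}) (x : \bar R) :
  (0 <= x)%E -> (\sum_(i in A) x = #|A|%:R%:E * x)%E.
Proof.
move=> x0; rewrite big_const; elim: #|A| => [|m IH] /=; first by rewrite mul0e.
by rewrite IH -[in RHS]natr1 EFinD ge0_muleDl ?lee_fin// mul1e addeC.
Qed.

Section expected_card.
Context {disp : measure_display} {Omega : measurableType disp} {R : realType}.
Variable P : probability Omega R.
Variables (I : finType) (A : Omega -> {set I}).
Hypothesis mA : forall i, measurable [set w | i \in A w].

Let cardE w : (#|A w|%:R : R) = \sum_(i : I) \1_[set w | i \in A w] w.
Proof.
rewrite -sum1_card natr_sum [LHS]big_mkcond /=; apply: eq_bigr => i _.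
rewrite indicE; case: ifPn => iA; first by rewrite mem_set.
by rewrite memNset //= (negbTE iA).
Qed.

Lemma measurable_card : measurable_fun [set: Omega] (fun w => #|A w|%:R : R).
Proof.
under eq_fun do rewrite cardE.
by apply: measurable_sum => i; exact: measurable_indic.
Qed.

Lemma expected_card :
  (\int[P]_w (#|A w|%:R : R)%:E = \sum_(i : I) P [set w | i \in A w])%E.
Proof.
under eq_integral do rewrite cardE -sumEFin.
rewrite ge0_integral_sum//; last by move=> i; apply/measurable_EFinP; exact: measurable_indic.
by apply: eq_bigr => i _; rewrite integral_indic// setIT.
Qed.

End expected_card.

Lemma cvg_binomial {R : realType} m :
  (fun k : nat => 'C(k, m)%:R / k%:R ^+ m) @ \oo --> (m`!%:R^-1 : R).
Proof.
have h : (fun k : nat => \prod_(i < m) (1 - i%:R * (k%:R : R)^-1)) @ \oo --> \prod_(i < m) (1 : R).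
  apply: cvg_prod_ord => i; rewrite -[X in _ --> X]subr0; apply: cvgB; first exact: cvg_cst.
  rewrite -[X in _ --> X](mulr0 i%:R); apply: cvgM; first exact: cvg_cst.
  apply: (gtr0_cvgV0 (f := fun k : nat => k%:R : R) _).2; last exact: cvgr_idn.
  by near=> k; near: k; exact: nbhs_infty_gtr.
rewrite big1_eq in h.
rewrite -[X in _ --> X]mulr1.
have : (fun k : nat => m`!%:R^-1 * \prod_(i < m) (1 - i%:R * (k%:R : R)^-1)) @ \oo --> (m`!%:R^-1 * 1 : R).
  by apply: cvgM => //; exact: cvg_cst.
apply: cvg_trans; apply: near_eq_cvg; near=> k.
have k0 : 0 < k%:R :> R by near: k; exact: nbhs_infty_gtr.
have mk : (m <= k)%N by near: k; exact: nbhs_infty_ge.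
apply: (mulfI (_ : m`!%:R != 0 :> R)); first by rewrite pnatr_eq0 -lt0n fact_gt0.
rewrite mulrA mulfV ?mul1r; last by rewrite pnatr_eq0 -lt0n fact_gt0.
rewrite mulrA [_ * 'C(_, _)%:R]mulrC -natrM bin_ffact ffact_prod natr_prod.
rewrite -[m in k%:R ^+ m]card_ord -prodr_const -prodf_div; apply: eq_bigr => i _.
rewrite natrB; last by rewrite (leq_trans (ltnW (ltn_ord i))).
by rewrite mulrBl divff ?gt_eqF.
Unshelve. all: by end_near. Qed.

Lemma tail_integral_ge0 {R : realType} {n q : nat} (H : set (q.+1.-tuple (euclidean R n.+1))) r :
  (0 <= tail_integral H r)%E.
Proof.
apply: integral_ge0 => z _; rewrite lee_fin mulr_ge0//.
by apply: prodr_ge0 => i _; exact: weight_ge0.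
Qed.

Section model.
Context {disp : measure_display} {Omega : measurableType disp} {R : realType} {n : nat}.
Variable P : probability Omega R.
Notation E := (euclidean R n.+1).
Variable X : nat -> {RV P >-> E}.
Hypothesis Xindep : mutually_independent X.
Hypothesis Xdens : forall i, has_density (X i) f_e.
Let c := @c_e R n.+1.

Lemma c_e_ge0 : 0 <= c.
Proof.
by rewrite invr_ge0 fine_ge0// integral_ge0// => x _; rewrite lee_fin expR_ge0.
Qed.

(** The integral that defines [c_e] is not known to be finite or positive
    beforehand, but otherwise [f_e] would vanish, and it is the density of a
    sample. *)
Lemma c_e_gt0 : 0 < c.
Proof.
rewrite lt_neqAle c_e_ge0 andbT eq_sym; apply/eqP => c0.
have := Xdens 0 measurableT; rewrite probability_setT integral0_eq.
  by move/eqP; rewrite eqe oner_eq0.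
by move=> x _; rewrite /f_e -/c c0 mul0r.
Qed.

Lemma measurable_f_e : measurable_fun [set: E] f_e.
Proof.
apply: measurable_funM; first exact: measurable_cst.
apply: measurableT_comp; first exact: measurable_expR.
by apply: measurable_funN; exact: measurable_norm.
Qed.

Let Xf (i : nat) (w : Omega) : E := X i w.
Let mX i : measurable_fun [set: Omega] (Xf i).
Proof. exact: measurable_funPT. Qed.

Lemma prob_tail q (H : set (q.+1.-tuple E)) (t : q.+1.-tuple nat) (r : R) :
  measurable H -> uniq t ->
  let A := [set w | H (sample_tuple Xf t w) /\ forall j, r <= euclidean_norm (Xf (tnth t j) w)] in
  measurable A /\ P A = ((c ^+ q.+1)%:E * tail_integral H r)%E.
Proof.
move=> mH ut A.
pose N : set (q.+1.-tuple E) := [set z | forall j : 'I_q.+1, r <= euclidean_norm (tnth z j)].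
have mN : measurable N.
  rewrite (_ : N = [set y | forall i : 'I_q.+1, (~` [set x : E | euclidean_norm x < r]) (tnth y i)]).
    apply: (@measurable_box _ E q.+1 (fun=> ~` [set x : E | euclidean_norm x < r])) => _.
    exact: measurableC (measurable_norm_lt r).
  by apply/seteqP; split => z /= h j; have := h j; rewrite leNgt; move/negP.
have AE : A = sample_tuple Xf t @^-1` (H `&` N).
  apply/seteqP; split => w /= -[h1 h2]; split => // j; have := h2 j; by rewrite tnth_map.
have mHN : measurable (H `&` N) by exact: measurableI.
rewrite AE; split.
  by rewrite -[X in measurable X]setTI; exact: (measurable_sample_tuple mX t).
have f0 (x : E) : 0 <= f_e x.
  by rewrite /f_e mulr_ge0 ?expR_ge0//; exact: c_e_ge0.
rewrite (joint_law mX measurable_f_e f0 Xdens Xindep ut mHN).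
have c0 : 0 <= c ^+ q.+1 by rewrite exprn_ge0//; exact: c_e_ge0.
rewrite /tail_integral -ge0_integralZl_EFin//.
- apply: eq_integral => z _; rewrite -EFinM; congr EFin.
  rewrite /f_e big_split /= prodr_const card_ord /weight big_split /=.
  have -> : \1_(H `&` N) z = \1_H z * \prod_(i < q.+1) (r <= euclidean_norm (tnth z i))%R%:R :> R.
    rewrite indicI; congr (_ * _); rewrite indicE.
    have [/set_mem Nz|Nz] := boolP (z \in N).
      by rewrite big1// => i _; rewrite Nz.
    have [j Nj] : exists j, ~ r <= euclidean_norm (tnth z j).
      by apply/existsNP => h; move/negP: Nz; apply; apply/mem_set.
    by rewrite (bigD1 j)//= (negbTE (introN idP Nj)) mul0r.
  by rewrite -/c; ring.
- by move=> z _; rewrite lee_fin mulr_ge0//; apply: prodr_ge0 => i _; exact: weight_ge0.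
- apply/measurable_EFinP; apply: measurable_funM; first exact: measurable_indic.
  apply: measurable_prod_ord => i; apply: measurable_weight => //; exact: measurable_tnth.
Qed.

Variable k : nat.
Let q := excess k.

Lemma measurable_cycle_points : measurable (@cycle_points R n.+1 k).
Proof. by rewrite /cycle_points; case: k => // k'; exact: measurable_hollow_points. Qed.

Lemma cycle_points_isometry (phi : E -> E) : isometry_onto phi ->
  forall z : (excess k).+1.-tuple E, cycle_points k [tuple of map phi z] <-> cycle_points k z.
Proof.
by rewrite /cycle_points; case: k => // k' iso z; exact: hollow_points_isometry.
Qed.

Lemma cycle_points_close (z : (excess k).+1.-tuple E) : cycle_points k z ->
  forall i, euclidean_dist (tnth z i) (thead z) < 6.
Proof.
move: z; case: k => [|k'] z zc i; first by rewrite [i]ord1 euclidean_distxx.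
by rewrite (lt_trans (hollow_points_close i ord0 zc))// ltr_nat.
Qed.

Definition near_points m : set (m.+1.-tuple E) :=
  [set z | forall i, euclidean_dist (tnth z i) (thead z) < 6].

Lemma measurable_near_points m : measurable (@near_points m).
Proof.
rewrite (_ : @near_points m = \bigcap_(i in [set: 'I_m.+1])
    [set z : m.+1.-tuple E | (euclidean_dist (tnth z i) (thead z) < 6)]); last first.
  by apply/seteqP; split => z /= h i; [move=> _|]; exact: h.
apply: fin_bigcap_measurable => // i _.
by apply: measurable_euclidean_dist_lt; exact: (@measurable_tnth _ E).
Qed.

Lemma near_points_isometry m (phi : E -> E) : isometry_onto phi ->
  forall z : m.+1.-tuple E, near_points [tuple of map phi z] <-> near_points z.
Proof.
move=> [iso _] z; rewrite /near_points /thead; split=> h i; have := h i; by rewrite !tnth_map iso.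
Qed.

Let positions N (w : Omega) : 'I_N -> E := fun i => Xf (val i) w.
Let cells_at N w r := cell_sets (positions w : 'I_N -> E) k r.
Let near_at N w r := near_tuples (positions w : 'I_N -> E) k r.

(** By linearity, as every set of [q.+1] samples has the same probability to be
    counted. *)
Lemma expected_cell_sets N (r : R) :
  measurable_fun [set: Omega] (fun w => #|cells_at N w r|%:R : R) /\
  (\int[P]_w (#|cells_at N w r|%:R : R)%:E =
  'C(N, q.+1)%:R%:E * ((c ^+ q.+1)%:E * tail_integral (@cycle_points R n.+1 k) r))%E.
Proof.
have h (I : {set 'I_N}) : measurable [set w | I \in cells_at N w r] /\
    P [set w | I \in cells_at N w r] =
    (if #|I| == q.+1 then (c ^+ q.+1)%:E * tail_integral (@cycle_points R n.+1 k) r else 0)%E.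
  case: ifPn => [/eqP cI|cI]; last first.
    rewrite (_ : mkset _ = set0) ?measure0//.
    by apply/seteqP; split => w //=; rewrite /cells_at inE (negbTE cI).
  have tz : size (map val (enum I)) == q.+1 by rewrite size_map -cardE cI.
  have ut : uniq (Tuple tz) by rewrite /= (map_inj_uniq val_inj) enum_uniq.
  have [mA PA] := prob_tail r measurable_cycle_points ut.
  suff -> : [set w | I \in cells_at N w r] =
    [set w | cycle_points k (sample_tuple Xf (Tuple tz) w) /\
       forall j, r <= euclidean_norm (Xf (tnth (Tuple tz) j) w)] by [].
  have zE w : tval (sample_tuple Xf (Tuple tz) w) = point_seq (positions w) I.
    by rewrite /= -map_comp.
  apply/seteqP; split => w /=.
    rewrite /cells_at inE => /andP[_ /asboolP[[z zE' zc] hr]]; split.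
      by have <- : z = sample_tuple Xf (Tuple tz) w by apply: val_inj; rewrite /= zE' -zE.
    move=> j; have : tnth (Tuple tz) j \in Tuple tz by exact: mem_tnth.
    by move=> /mapP[i]; rewrite mem_enum => iI ->; exact: hr.
  move=> [zc hr]; rewrite /cells_at inE cI eqxx /=; apply/asboolP; split.
    by exists (sample_tuple Xf (Tuple tz) w).
  move=> i iI; have : val i \in Tuple tz by apply/mapP; exists i; rewrite // mem_enum.
  by move=> /tnthP[j ij]; have := hr j; rewrite -ij.
split; first exact: measurable_card (fun I => (h I).1).
rewrite expected_card; last by move=> I; exact: (h I).1.
under eq_bigr do rewrite (h _).2.
rewrite -big_mkcond /= (eq_bigl (fun I => I \in finset.finset (fun I : {set 'I_N} => #|I| == q.+1))); last first.
  by move=> I; rewrite inE.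
rewrite sume_const ?card_draws ?card_ord//.
by rewrite mule_ge0 ?lee_fin ?exprn_ge0 ?c_e_ge0//; exact: tail_integral_ge0.
Qed.

Lemma expected_near_tuples N (r : R) :
  measurable_fun [set: Omega] (fun w => #|near_at N w r|%:R : R) /\
  (\int[P]_w (#|near_at N w r|%:R : R)%:E <=
  (N%:R ^+ q.+2)%:E * ((c ^+ q.+2)%:E * tail_integral (@near_points q.+1) r))%E.
Proof.
set p := ((c ^+ q.+2)%:E * _)%E.
have p0 : (0 <= p)%E.
  by rewrite mule_ge0 ?lee_fin ?exprn_ge0 ?c_e_ge0//; exact: tail_integral_ge0.
have h (t : (excess k).+2.-tuple 'I_N) : measurable [set w | t \in near_at N w r] /\
    (P [set w | t \in near_at N w r] <= p)%E.
  have [ut|ut] := boolP (uniq t); last first.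
    rewrite (_ : mkset _ = set0) ?measure0//.
    by apply/seteqP; split => w //=; rewrite /near_at inE (negbTE ut).
  have ut' : uniq [tuple of map val t] by rewrite /= (map_inj_uniq val_inj).
  have [mA PA] := prob_tail r (@measurable_near_points q.+1) ut'.
  suff -> : [set w | t \in near_at N w r] =
    [set w | near_points (sample_tuple Xf [tuple of map val t] w) /\
       forall j, r <= euclidean_norm (Xf (tnth [tuple of map val t] j) w)] by split => //; rewrite PA.
  apply/seteqP; split => w /=.
    rewrite /near_at inE => /andP[_ /asboolP ht]; split=> j; have [h1 h2] := ht j.
      by rewrite /thead !tnth_map.
    by rewrite tnth_map.
  move=> [h1 h2]; rewrite /near_at inE ut /=; apply/asboolP => j; split.
    by have := h2 j; rewrite tnth_map.
  by have := h1 j; rewrite /thead !tnth_map.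
split; first exact: measurable_card (fun t => (h t).1).
rewrite expected_card; last by move=> t; exact: (h t).1.
apply: (@le_trans _ _ (\sum_(t : (excess k).+2.-tuple 'I_N) p)%E).
  by apply: lee_sum => t _; exact: (h t).2.
rewrite (eq_bigl (fun t => t \in [set: (excess k).+2.-tuple 'I_N]%SET)); last first.
  by move=> t; rewrite inE.
by rewrite sume_const// cardsT card_tuple card_ord natrX.
Qed.

Variable F : fieldType.

Let outer_mem N r w y : (y \in outer_samples X N r w) =
  [exists i, (positions w : 'I_N -> E) i == y] && (r <= euclidean_norm y).
Proof.
rewrite !inE /=; congr andb.
  apply/imfsetP/existsP => [[i _ ->]|[i /eqP <-]]; first by exists i.
  by exists i.
by rewrite in_setC /euclidean_ball; apply/idP/idP => [/negP h|h];
  [rewrite leNgt; apply/negP => h'; apply: h; rewrite inE|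
   apply/negP; rewrite inE /= => h'; move: h; rewrite leNgt -/(euclidean_norm y) h'].
Qed.

Let betti_upper N r w : (betti_outer X F k N r w <=
  #|cells_at N w r| + #|near_at N w r|)%N.
Proof. apply: betti_le_cell_sets; exact: outer_mem. Qed.

Let betti_lower N r r' w : r <= r' -> (#|cells_at N w r'| <=
  betti_outer X F k N r w + #|near_at N w (r' - 6)|)%N.
Proof. apply: cell_sets_le_betti; exact: outer_mem. Qed.

Lemma expected_betti_le N r :
  ('E_P[fun w => (betti_outer X F k N r w)%:R] <=
   'C(N, q.+1)%:R%:E * ((c ^+ q.+1)%:E * tail_integral (@cycle_points R n.+1 k) r) +
   (N%:R ^+ q.+2)%:E * ((c ^+ q.+2)%:E * tail_integral (@near_points q.+1) r))%E.
Proof.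
have [mC <-] := expected_cell_sets N r; have [mT hT] := expected_near_tuples N r.
apply: le_trans (leeD2l _ hT); rewrite -ge0_integralD//; last 2 first.
- exact/measurable_EFinP.
- exact/measurable_EFinP.
rewrite unlock; apply: le_integral_ge0 => w /=; first by rewrite lee_fin.
by rewrite -EFinD lee_fin -natrD ler_nat; exact: betti_upper.
Qed.

Lemma le_expected_betti N r r' : r <= r' ->
  ('C(N, q.+1)%:R%:E * ((c ^+ q.+1)%:E * tail_integral (@cycle_points R n.+1 k) r') <=
   'E_P[fun w => (betti_outer X F k N r w)%:R] +
   (N%:R ^+ q.+2)%:E * ((c ^+ q.+2)%:E * tail_integral (@near_points q.+1) (r' - 6)))%E.
Proof.
move=> rr'.
have [mC <-] := expected_cell_sets N r'; have [mT hT] := expected_near_tuples N (r' - 6).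
apply: le_trans (leeD2l _ hT).
pose a w : R := #|cells_at N w r'|%:R.
pose b w : R := #|near_at N w (r' - 6)|%:R.
have mS : measurable_fun [set: Omega] (fun w => Num.max 0 (a w - b w)).
  by apply: measurable_maxr => //; exact: measurable_funB.
apply: (@le_trans _ _ (\int[P]_w (Num.max 0 (a w - b w))%:E + \int[P]_w (b w)%:E)%E).
  rewrite -ge0_integralD//; last 4 first.
  - by move=> w _; rewrite lee_fin le_max lexx.
  - exact/measurable_EFinP.
  - by move=> w _; rewrite lee_fin.
  - exact/measurable_EFinP.
  apply: le_integral_ge0 => w; first by rewrite lee_fin.
  rewrite -EFinD lee_fin -lerBlDr le_max; apply/orP; right; exact: lexx.
apply: leeD2r; rewrite unlock; apply: le_integral_ge0 => w.
  by rewrite lee_fin le_max lexx.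
rewrite lee_fin ge_max ler0n /= lerBlDr -natrD ler_nat; exact: betti_lower.
Qed.

End model.

(** * Limits of the expected Betti numbers *)

Section limit_constant.
Context (F : fieldType) {R : realType} {n : nat}.
Notation E := (euclidean R n.+1).

(** If two entries of [z] coincide, then the set of its entries is too small
    for [T_], and [z] is not hollow. *)
Lemma T_hollow_points k (z : k.+3.-tuple E) :
  (T_ F k.+1 [fset x in (z : seq E)]%fset)%:R = \1_(@hollow_points R n.+1 k.+3) z :> R.
Proof.
set Y := [fset x in (z : seq E)]%fset.
have inY y : (y \in Y) = (y \in (z : seq E)) by rewrite /Y !inE.
rewrite indicE; congr ((nat_of_bool _)%:R); rewrite /T_.
have [uz|nuz] := boolP (uniq z); last first.
  rewrite memNset; last by move=> /hollow_points_uniq uz; rewrite uz in nuz.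
  rewrite (_ : (#|` Y| == k.+3)%N = false)//; apply/negbTE; apply: contraNN nuz.
  by rewrite card_fseq => /eqP zc; rewrite -[uniq _]negbK -ltn_size_undup zc size_tuple ltnn.
have Yc : #|` Y| = k.+3 by rewrite card_fseq undup_id// size_tuple.
rewrite Yc eqxx /=.
rewrite (betti_min F (@cech_down R n.+1 Y) (@cech_near R n.+1 Y)); last by rewrite -cardfE.
have lz : lists z (finset.setT : {set Y}).
  by split=> // v; rewrite inE -inY; exact/esym/valP.
have zY j : tnth z j \in Y by rewrite inY mem_tnth.
have := cells_hollow_points (k := k.+1) isT lz zY; rewrite /=.
case: (_ \in _) => -[h1 h2].
  by rewrite mem_set//; exact: h1.
by rewrite memNset// => /h2.
Qed.

Lemma limit_integralE k : limit_integral (@cycle_points R n.+1 k) =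
  (\int[lebesgue_measure]_(rho in `[0%R, +oo[)
     \int[power_measure lebesgue_euclidean (excess k)]_y
       (limit_fun (@cycle_points R n.+1 k) (y, rho))%:E)%E.
Proof.
have mL := measurable_limit_fun (@measurable_cycle_points R n k).
have mE : measurable_fun [set: (excess k).-tuple E * measurableTypeR R]
   (EFin \o limit_fun (@cycle_points R n.+1 k)) by exact/measurable_EFinP.
have L0 p : (0 <= (EFin \o limit_fun (@cycle_points R n.+1 k)) p)%E.
  by rewrite lee_fin limit_fun_ge0.
transitivity (\int[lebesgue_measure]_rho
    \int[power_measure lebesgue_euclidean (excess k)]_y
      (limit_fun (@cycle_points R n.+1 k) (y, rho))%:E)%E.
  exact: (fubini_tonelli2 (m1 := power_measure lebesgue_euclidean (excess k))
    (m2 := @lebesgue_measure R) _ mE L0).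
rewrite [RHS]integral_mkcond; apply: eq_integral => rho _.
rewrite patchE mem_setE in_itv /= andbT; case: ifPn => // rho0.
by rewrite integral0_eq// => y _; rewrite /limit_fun /= (negbTE rho0) !mul0r.
Qed.

(** A single point: what remains is the exponential density of [rho]. *)
Lemma limit_integral0 : limit_integral (@cycle_points R n.+1 0) = 1%E.
Proof.
rewrite limit_integralE -(integral_exponential_pdf (@ltr01 R)).
rewrite integral_mkcond; apply: eq_integral => rho _.
have mE : measurable_fun [set: 0.-tuple E * measurableTypeR R]
   (EFin \o limit_fun (@cycle_points R n.+1 0)).
  by apply/measurable_EFinP; exact: (measurable_limit_fun (@measurable_cycle_points R n 0)).
rewrite /exponential_pdf !patchE mem_setE in_itv /= andbT; case: ifPn => // rho0.
rewrite integral_dirac//; last first.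
  exact: (measurable_fun_pair1 (T1 := 0.-tuple E) (f := EFin \o limit_fun (@cycle_points R n.+1 0)) rho mE).
rewrite diracT mul1e /limit_fun /= rho0 !big_ord0 indicE mem_set//.
by rewrite addr0 !mul1r mulr1 mulN1r.
Qed.

Lemma mu_eE k : mu_e F n.+1 k =
  ((sphere_area n.+1 * c_e n.+1 ^+ (excess k).+1 / ((excess k).+1)`!%:R)%:E *
    limit_integral (@cycle_points R n.+1 k))%E.
Proof.
case: k => [|k] /=; first by rewrite limit_integral0 expr1 divr1 mule1.
rewrite (limit_integralE k.+1).
apply: (congr1 (fun x => _ * x)%E).
apply: eq_integral => rho.
rewrite inE /= in_itv /= andbT => rho0.
apply: eq_integral => y _; rewrite /limit_fun /= rho0 mul1r mulrA; congr ((_ * _ * _)%:E).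
by rewrite -T_hollow_points.
Qed.

Lemma limit_integral_cycle_gt0 k : (k < n.+1)%N ->
  (0 < limit_integral (@cycle_points R n.+1 k))%E.
Proof.
case: k => [_|k kn]; first by rewrite limit_integral0 lte01.
exact: limit_integral_gt0.
Qed.

End limit_constant.

Section limits.
Context {disp : measure_display} {Omega : measurableType disp} {R : realType} {n : nat}.
Variable P : probability Omega R.
Notation E := (euclidean R n.+1).
Notation area := (@sphere_area R n.+1).
Variable X : nat -> {RV P >-> E}.
Hypothesis Xindep : mutually_independent X.
Hypothesis Xdens : forall i, has_density (X i) f_e.
Variables (F : fieldType) (k : nat).
Notation cycles := (@cycle_points R n.+1 k).
Let m := (excess k).+1.
Let c := @c_e R n.+1.
Let L := fine (limit_integral cycles).

Let cells_mean N r : \bar R :=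
  ('C(N, m)%:R%:E * ((c ^+ m)%:E * tail_integral cycles r))%E.
Let near_mean N r : \bar R :=
  ((N%:R ^+ m.+1)%:E * ((c ^+ m.+1)%:E * tail_integral (@near_points R n m) r))%E.

Lemma cells_asymptotics (a b : R) : exists2 v : nat -> R,
  v @ \oo --> area * c ^+ m / m`!%:R * expR (- (m%:R * b)) * L &
  \forall N \near \oo, (cells_mean N (radius a b N) =
    (expR ((n%:R - m%:R * a) * ln (ln N%:R)) * v N)%:E)%E.
Proof.
have [v cv hv] := tail_asymptotics (@measurable_cycle_points R n k)
  (@cycle_points_isometry R n k) (@cycle_points_close R n k) a b.
exists (fun N => 'C(N, m)%:R / N%:R ^+ m * c ^+ m * v N).
  have -> : area * c ^+ m / m`!%:R * expR (- (m%:R * b)) * L =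
    m`!%:R^-1 * c ^+ m * (area * expR (- (m%:R * b)) * L) by ring.
  by apply: cvgM => //; apply: cvgM; [exact: cvg_binomial|exact: cvg_cst].
near=> N.
have N0 : N%:R ^+ m != 0 :> R.
  by rewrite expf_neq0// gt_eqF//; near: N; exact: nbhs_infty_gtr.
have h : ((N%:R ^+ m)%:E * tail_integral cycles (radius a b N) =
    (expR ((n%:R - m%:R * a) * ln (ln N%:R)) * v N)%:E)%E by near: N.
transitivity (('C(N, m)%:R / N%:R ^+ m * c ^+ m)%:E * ((N%:R ^+ m)%:E *
   tail_integral cycles (radius a b N)))%E.
  by rewrite /cells_mean !muleA -!EFinM; congr (_%:E * _)%E; field.
by rewrite h -EFinM; congr EFin; ring.
Unshelve. all: by end_near. Qed.

Lemma near_asymptotics (a b : R) : exists2 v : nat -> R,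
  (exists l : R, v @ \oo --> l) &
  \forall N \near \oo, (near_mean N (radius a b N) =
    (expR ((n%:R - m.+1%:R * a) * ln (ln N%:R)) * v N)%:E)%E.
Proof.
have [v cv hv] := tail_asymptotics (@measurable_near_points R n m)
  (@near_points_isometry R n m) (fun z h => h) a b.
exists (fun N => c ^+ m.+1 * v N); first by eexists; apply: cvgM; [exact: cvg_cst|exact: cv].
near=> N; rewrite /near_mean muleCA.
have -> : ((N%:R ^+ m.+1)%:E * tail_integral (@near_points R n m) (radius a b N) =
    (expR ((n%:R - m.+1%:R * a) * ln (ln N%:R)) * v N)%:E)%E by near: N.
by rewrite -EFinM; congr EFin; ring.
Unshelve. all: by end_near. Qed.

Let u (a b : R) N : \bar R := ('E_P[fun w => (betti_outer X F k N (radius a b N) w)%:R])%E.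

Lemma u_ge0 a b N : (0 <= u a b N)%E.
Proof. by rewrite /u unlock; apply: integral_ge0 => w _; rewrite lee_fin. Qed.

Let u_le_means a b N :
  (u a b N <= cells_mean N (radius a b N) + near_mean N (radius a b N))%E.
Proof. exact: (expected_betti_le Xindep Xdens k F N (radius a b N)). Qed.

Let means_le_u a a' N : radius a 0 N <= radius a' 0 N ->
  (cells_mean N (radius a' 0 N) <= u a 0 N + near_mean N (radius a' (0 - 6) N))%E.
Proof.
move=> rr; have := le_expected_betti Xindep Xdens k F N rr.
by rewrite /radius -!(addrA _ 0) add0r.
Qed.

(** One more point divides the expected number by [(ln N) ^ a], up to a
    constant. *)
Lemma near_negligible (a b : R) : n%:R < m.+1%:R * a -> exists2 e : nat -> R,
  e @ \oo --> (0 : R) &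
  \forall N \near \oo, (near_mean N (radius a b N) = (e N)%:E)%E.
Proof.
move=> na; have [v [l cv] hv] := near_asymptotics a b.
exists (fun N => expR ((n%:R - m.+1%:R * a) * ln (ln N%:R)) * v N) => //.
by rewrite -(mul0r l); apply: cvgM => //; apply: cvg_expR_lnln; rewrite subr_lt0.
Qed.

Lemma expected_betti_cvg0 (a : R) : n%:R < m%:R * a -> 0 < a -> u a 0 @ \oo --> 0%E.
Proof.
move=> na a0.
have [v cv hv] := cells_asymptotics a 0.
have nm : n%:R < m.+1%:R * a by rewrite -natr1 mulrDl mul1r; lra.
have [e ce he] := near_negligible 0 nm.
pose g N : R := expR ((n%:R - m%:R * a) * ln (ln N%:R)) * v N + e N.
have cg : g @ \oo --> (0 : R).
  rewrite -[X in _ --> X]addr0; apply: cvgD => //.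
  rewrite -[X in _ --> X](mul0r (area * c ^+ m / m`!%:R * expR (- (m%:R * 0)) * L)).
  by apply: cvgM => //; apply: cvg_expR_lnln; rewrite subr_lt0.
apply: (@squeeze_cvge _ _ _ _ (cst 0%E) _ (EFin \o g)).
- near=> N; rewrite /= u_ge0 /=.
  apply: le_trans (u_le_means a 0 N) _.
  by rewrite /g EFinD; apply: leeD; rewrite le_eqVlt; apply/orP; left; apply/eqP; near: N.
- exact: cvg_cst.
- by apply: cvg_EFin => //; exact: nearW.
Unshelve. all: by end_near. Qed.

Lemma expected_betti_cvg (a : R) : n%:R = m%:R * a -> 0 < a -> u a 0 @ \oo --> mu_e F n.+1 k.
Proof.
move=> na a0.
have [v cv hv] := cells_asymptotics a 0.
have nm : n%:R < m.+1%:R * a by rewrite -natr1 mulrDl mul1r -na; lra.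
have [e ce he] := near_negligible 0 nm.
have [e' ce' he'] := near_negligible (0 - 6) nm.
have -> : mu_e F n.+1 k = (area * c ^+ m / m`!%:R * L)%:E.
  rewrite mu_eE [RHS]EFinM fineK//.
  exact: (limit_integral_fin (@measurable_cycle_points R n k) (@cycle_points_close R n k)).
rewrite mulr0 oppr0 expR0 mulr1 in cv.
apply: (@squeeze_cvge _ _ _ _ (fun N => (v N - e' N)%:E) _ (fun N => (v N + e N)%:E)).
- near=> N.
  have hvN : (cells_mean N (radius a 0 N) = (v N)%:E)%E.
    transitivity (expR ((n%:R - m%:R * a) * ln (ln N%:R)) * v N)%:E; first by near: N.
    by rewrite na subrr mul0r expR0 mul1r.
  have heN : (near_mean N (radius a 0 N) = (e N)%:E)%E by near: N.
  have heN' : (near_mean N (radius a (0 - 6) N) = (e' N)%:E)%E by near: N.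
  apply/andP; split.
    rewrite EFinB leeBlDr// -hvN -heN'.
    exact: means_le_u.
  rewrite EFinD -hvN -heN.
  exact: u_le_means.
- apply: cvg_EFin; first exact: nearW.
  by rewrite -[X in _ --> X]subr0; apply: cvgB.
- apply: cvg_EFin; first exact: nearW.
  by rewrite -[X in _ --> X]addr0; apply: cvgD.
Unshelve. all: by end_near. Qed.

(** The case [a <= 0], where near tuples are not negligible, is covered by
    means of another exponent: configurations are only counted beyond the
    larger radius of exponent [a']. *)
Lemma expected_betti_cvgy (a a' : R) : a <= a' -> m%:R * a' < n%:R -> 0 < a' ->
  0 < L -> u a 0 @ \oo --> +oo%E.
Proof.
move=> aa' na a0 L0.
have [v cv hv] := cells_asymptotics a' 0.
have [w [l cw] hw] := near_asymptotics a' (0 - 6).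
have c0 : 0 < c := c_e_gt0 Xdens.
rewrite mulr0 oppr0 expR0 mulr1 in cv.
set K := area * c ^+ m / m`!%:R * L in cv.
have K0 : 0 < K.
  rewrite /K mulr_gt0// divr_gt0 ?ltr0n ?fact_gt0// mulr_gt0 ?exprn_gt0//.
  exact: sphere_area_gt0.
have cd : (fun N => v N - expR (- a' * ln (ln N%:R)) * w N) @ \oo --> K.
  rewrite -[X in _ --> X]subr0 -(mul0r l); apply: cvgB => //; apply: cvgM => //.
  by apply: cvg_expR_lnln; rewrite oppr_lt0.
apply/cvgeyPge => A; near=> N.
have hvN : (cells_mean N (radius a' 0 N) =
    (expR ((n%:R - m%:R * a') * ln (ln N%:R)) * v N)%:E)%E by near: N.
have hwN : (near_mean N (radius a' (0 - 6) N) =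
    (expR ((n%:R - m.+1%:R * a') * ln (ln N%:R)) * w N)%:E)%E by near: N.
have LN0 : 0 < ln (ln N%:R) :> R by near: N; move/cvgryPgt : (@cvg_lnln_nat R); exact.
have rr : radius a 0 N <= radius a' 0 N.
  by rewrite /radius lerD2r lerD2l ler_wpM2r// ltW.
have := means_le_u rr; rewrite hvN hwN -leeBlDr//; apply: le_trans; rewrite -EFinB lee_fin.
have -> : expR ((n%:R - m%:R * a') * ln (ln N%:R)) * v N -
    expR ((n%:R - m.+1%:R * a') * ln (ln N%:R)) * w N =
    expR ((n%:R - m%:R * a') * ln (ln N%:R)) * (v N - expR (- a' * ln (ln N%:R)) * w N).
  rewrite mulrBr mulrA -expRD; congr (_ - expR _ * _).
  by rewrite -natr1; ring.
have h1 : K / 2 <= v N - expR (- a' * ln (ln N%:R)) * w N.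
  by apply: ltW; near: N; move: cd => /cvgr_gt; apply; lra.
have h2 : Num.max 0 (A / (K / 2)) <= expR ((n%:R - m%:R * a') * ln (ln N%:R)).
  near: N; have : 0 < n%:R - m%:R * a' by lra.
  by move=> /cvgy_expR_lnln/cvgryPge; exact.
have K2 : 0 < K / 2 by lra.
apply: (@le_trans _ _ (Num.max 0 (A / (K / 2)) * (K / 2))).
  by rewrite -ler_pdivrMr// le_max lexx orbT.
by apply: ler_pM => //; [rewrite le_max lexx|exact: ltW].
Unshelve. all: by end_near. Qed.

End limits.

Theorem corollary2p5 (R : realType) (F : fieldType) (d : nat)
    (disp : measure_display) (Omega : measurableType disp)
    (P : probability Omega R) (X : nat -> {RV P >-> euclidean R d})
    (k : nat) (eps : R) :
  (2 <= d)%N ->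
  mutually_independent X ->
  (forall i : nat, has_density (X i) f_e) ->
  0 < eps ->
  [/\ 'E_P[fun w => (betti_outer X F k n (cutoff_radius d k eps n) w)%:R]%E
        @[n --> \oo] --> 0%E,
      'E_P[fun w => (betti_outer X F k n (cutoff_radius d k 0 n) w)%:R]%E
        @[n --> \oo] --> mu_e F d k
    & (k < d)%N ->
      'E_P[fun w => (betti_outer X F k n (cutoff_radius d k (- eps) n) w)%:R]%E
        @[n --> \oo] --> +oo%E].
Proof.
case: d X => [//|n] X d2 Xi Xd eps0.
have n0 : 0 < n%:R :> R by rewrite ltr0n.
set m := (excess k).+1.
have m0 : 0 < m%:R :> R by rewrite ltr0n.
have nm0 : 0 < n%:R / m%:R :> R by exact: divr_gt0.
have mnm : m%:R * (n%:R / m%:R) = n%:R :> R by rewrite mulrCA divff ?mulr1// gt_eqF.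
have rE e : cutoff_radius n.+1 k e = radius (n%:R / m%:R + e) 0.
  apply/funext => N; rewrite /cutoff_radius /radius addr0 /m; case: (k) => [|k'] //.
  by rewrite divr1.
rewrite !rE; split.
- apply: expected_betti_cvg0 => //; last by rewrite addr_gt0.
  by rewrite mulrDr mnm ltrDl mulr_gt0.
- by apply: expected_betti_cvg => //; rewrite addr0.
(* The exponent has to stay positive. *)
- move=> kd; pose e := Num.min eps (n%:R / m%:R / 2).
  have e0 : 0 < e by rewrite lt_min eps0 divr_gt0.
  have e1 : e <= n%:R / m%:R / 2 by rewrite ge_min lexx orbT.
  apply: (@expected_betti_cvgy _ _ _ _ _ _ Xi Xd F k _ (n%:R / m%:R - e)).
  + by rewrite lerD2l lerN2 ge_min lexx.
  + by rewrite mulrBr mnm gtrBl mulr_gt0.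
  + lra.
  + apply: fine_gt0; rewrite limit_integral_cycle_gt0//= ltey_eq.
    by rewrite (limit_integral_fin (@measurable_cycle_points R n k) (@cycle_points_close R n k)).
Qed.
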